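(* For $N=4L+1$ with $L\ge 0$ an integer, let $\{\boldsymbol\phi_n\}_{0\le n\le N-1}\subset\mathbb R^N$ be the vectors defined in the context (by Gram–Schmidt orthogonalization), and let $\psi_n$ denote the Hermite functions. (i) The vectors $\{\boldsymbol\phi_n\}_{0\le n\le N-1}$ form an orthonormal basis of $\mathbb R^N$ consisting of eigenvectors of the discrete Fourier transform: for all $0\le n\le N-1$ we have $\mathcal F\boldsymbol\phi_n=(-\mathrm i)^n\boldsymbol\phi_n$. (ii) For $0\le n\le 7$ we have $$\max_{-2L\le k\le 2L}\bigl|\epsilon^{-1/2}\phi_n(k)-\psi_n(\epsilon k)\bigr|\to 0\quad\text{as }N\to+\infty,$$ where $\epsilon:=\sqrt{2\pi/N}$ and the limit is taken along integers $N=4L+1$.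
   Context: For $N=4L+1$, vectors in $\mathbb C^N$ (and $\mathbb R^N$) are indexed by $I_N=\{-2L,\dots,2L\}$; the entry of $\mathbf u$ at index $k$ is written $u(k)$. The dot product is $\mathbf u\cdot\mathbf v=\sum_{k\in I_N}u(k)v(k)$, and the Euclidean norm is given by $\|\mathbf u\|^2=\mathbf u\cdot\bar{\mathbf u}$. The (centered) discrete Fourier transform $\mathcal F:\mathbb C^N\to\mathbb C^N$ is $$(\mathcal F\mathbf u)(j)=\frac1{\sqrt N}\sum_{k\in I_N}e^{-2\pi \mathrm i kj/N}u(k),\qquad j\in I_N.$$ The Hermite functions are $$\psi_n(x)=(-1)^n(\sqrt\pi\,2^n n!)^{-1/2}e^{x^2/2}\frac{d^n}{dx^n}e^{-x^2},\qquad n\ge0.$$ The sequence $S(k)$, $k\ge0$ (depending on $N$), is defined by $S(0)=1$ and $S(k)=\prod_{j=1}^k2\sin(\pi j/N)$ for $k\ge1$ (so $S(k)=0$ for $k\ge N$). Define vectors in $\mathbb R^N$ by, for $k\in I_N$, $$u_n(k)=S(3L+n+k)S(3L+n-k)\quad(-L\le n\le L),$$ $$v_n(k)=\sin(2\pi k/N)S(3L+n+k)S(3L+n-k)\quad(-L\le n\le L-1).$$ Define $$\mathbf w_n=\mathbf u_n+N^{-1/2}S(2L+2n)\mathbf u_{-n}\quad(0\le n\le L),$$ $$\mathbf x_n=\mathbf v_n+N^{-1/2}S(2L+2n+1)\mathbf v_{-n-1}\quad(0\le n\le L-1),$$ $$\mathbf y_n=-\mathbf u_{n+1}+N^{-1/2}S(2L+2n+2)\mathbf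 u_{-n-1}\quad(0\le n\le L-1),$$ $$\mathbf z_n=-\mathbf v_n+N^{-1/2}S(2L+2n+1)\mathbf v_{-n-1}\quad(0\le n\le L-1).$$ Apply the (unnormalized) Gram–Schmidt algorithm separately to each of the four families: for $\mathbf a\in\{\mathbf w,\mathbf x,\mathbf y,\mathbf z\}$, $$\tilde{\mathbf a}_n=\mathbf a_n-\sum_{j=0}^{n-1}\frac{\mathbf a_n\cdot\tilde{\mathbf a}_j}{\|\tilde{\mathbf a}_j\|^2}\tilde{\mathbf a}_j,$$ with $0\le n\le L$ for $\mathbf w$ and $0\le n\le L-1$ for $\mathbf x,\mathbf y,\mathbf z$. The $N$ vectors $\boldsymbol\phi_0,\dots,\boldsymbol\phi_{N-1}$ are $$\boldsymbol\phi_{4n}=\frac{\tilde{\mathbf w}_n}{\|\tilde{\mathbf w}_n\|}\ (0\le n\le L),\quad \boldsymbol\phi_{4n+1}=\frac{\tilde{\mathbf x}_n}{\|\tilde{\mathbf x}_n\|},\quad \boldsymbol\phi_{4n+2}=\frac{\tilde{\mathbf y}_n}{\|\tilde{\mathbf y}_n\|},\quad \boldsymbol\phi_{4n+3}=\frac{\tilde{\mathbf z}_n}{\|\tilde{\mathbf z}_n\|}\ (0\le n\le L-1).$$ *)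

(* Defs.v *)
From HB Require Import structures.
From mathcomp Require Import all_boot all_order all_algebra.
From mathcomp Require Import all_classical all_reals all_analysis.
From mathcomp Require Import complex.
Set Implicit Arguments.
Unset Strict Implicit.
Unset Printing Implicit Defensive.
Import Order.TTheory GRing.Theory Num.Theory.
Import numFieldNormedType.Exports.
Local Open Scope classical_set_scope.
Local Open Scope ring_scope.

Notation dimN L := (4 * L).+1.

(* Positions i = 0, ..., 4L of a row vector stand for the centered indices
   k = i - 2L = -2L, ..., 2L. *)
Definition cidx (L : nat) (i : 'I_(dimN L)) : int := i%:Z - (2 * L)%:Z.

Definition dot (K : pzRingType) (m : nat) (u v : 'rV[K]_m) : K :=
  \sum_(k < m) u 0 k * v 0 k.

Section Vectors.
Variable R : realType.
Implicit Types (L n : nat) (d k : int).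

(* Only real vectors are normed here, so no conjugate appears. *)
Definition enorm (m : nat) (u : 'rV[R]_m) : R := Num.sqrt (dot u u).

Definition expi (t : R) : R[i] := Complex (cos t) (sin t).

Definition toC (m : nat) (u : 'rV[R]_m) : 'rV[R[i]]_m :=
  map_mx (real_complex R) u.

Definition DFT L (u : 'rV[R[i]]_(dimN L)) : 'rV[R[i]]_(dimN L) :=
  \row_j (real_complex R (Num.sqrt (dimN L)%:R)^-1 *
    \sum_k expi (- (2 * pi * (cidx k)%:~R * (cidx j)%:~R / (dimN L)%:R))
           * u 0 k).

Definition hermite n (x : R) : R :=
  (-1) ^+ n * (Num.sqrt pi * 2 ^+ n * n`!%:R) `^ (- 2^-1)
  * expR (x ^+ 2 / 2) * derive1n n (fun t : R => expR (- t ^+ 2)) x.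

Definition sinprod L n : R :=
  \prod_(1 <= j < n.+1) (2 * sin (pi * j%:R / (dimN L)%:R)).

(* For -L <= d and -2L <= k <= 2L the integers 3L + d + k and 3L + d - k are
   nonnegative, so the absolute value below is only a cast to nat. *)
Definition SS L d k : R :=
  sinprod L (absz ((3 * L)%:Z + d + k)%R) * sinprod L (absz ((3 * L)%:Z + d - k)%R).

Definition vec_u L d : 'rV[R]_(dimN L) := \row_i SS L d (cidx i).

Definition vec_v L d : 'rV[R]_(dimN L) :=
  \row_i (sin (2 * pi * (cidx i)%:~R / (dimN L)%:R) * SS L d (cidx i)).

Definition coefS L n : R := (Num.sqrt (dimN L)%:R)^-1 * sinprod L n.

Definition vec_w L n : 'rV[R]_(dimN L) :=
  vec_u L n%:Z + coefS L (2 * L + 2 * n) *: vec_u L (- n%:Z).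

Definition vec_x L n : 'rV[R]_(dimN L) :=
  vec_v L n%:Z + coefS L (2 * L + 2 * n + 1) *: vec_v L (- n%:Z - 1).

Definition vec_y L n : 'rV[R]_(dimN L) :=
  - vec_u L (n%:Z + 1) + coefS L (2 * L + 2 * n + 2) *: vec_u L (- n%:Z - 1).

Definition vec_z L n : 'rV[R]_(dimN L) :=
  - vec_v L n%:Z + coefS L (2 * L + 2 * n + 1) *: vec_v L (- n%:Z - 1).

Definition gs_step (m : nat) (a : 'rV[R]_m) (s : seq 'rV[R]_m) : 'rV[R]_m :=
  a - \sum_(t <- s) (dot a t / enorm t ^+ 2) *: t.

Fixpoint gs_seq (m : nat) (a : nat -> 'rV[R]_m) n : seq 'rV[R]_m :=
  if n is n'.+1 then rcons (gs_seq a n') (gs_step (a n') (gs_seq a n'))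
  else [::].

Definition gs (m : nat) (a : nat -> 'rV[R]_m) n : 'rV[R]_m :=
  gs_step (a n) (gs_seq a n).

Lemma gsE (m : nat) (a : nat -> 'rV[R]_m) n :
  gs a n = a n - \sum_(j < n) (dot (a n) (gs a j) / enorm (gs a j) ^+ 2) *: gs a j.
Proof.
rewrite {1}/gs /gs_step; congr (_ - _).
suff -> : gs_seq a n = [seq gs a j | j <- iota 0 n].
  by rewrite big_map -{1}[n]subn0 -/(index_iota 0 n) big_mkord.
elim: n => [//|n IHn].
have -> : iota 0 n.+1 = rcons (iota 0 n) n.
  by rewrite -cats1 -[n.+1]addn1 iotaD.
by rewrite map_rcons /= -IHn.
Qed.

Definition normalize (m : nat) (u : 'rV[R]_m) : 'rV[R]_m := (enorm u)^-1 *: u.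

(* Meaningful only for n <= 4L: for larger n the families leave their ranges. *)
Definition phi L n : 'rV[R]_(dimN L) :=
  let family := match (n %% 4)%N with
    | 0 => vec_w L | 1 => vec_x L | 2 => vec_y L | _ => vec_z L end in
  normalize (gs family (n %/ 4)).

Definition eps L : R := Num.sqrt (2 * pi / (dimN L)%:R).

End Vectors.

(* Main.v *)
Require Import Defs.
From mathcomp Require Import all_boot all_order all_algebra.
From mathcomp Require Import all_classical all_reals all_analysis.
From mathcomp Require Import complex.
From mathcomp Require Import ring lra zify.
Import Order.TTheory GRing.Theory Num.Theory.
Import numFieldNormedType.Exports.

(** Eigenvectors. Let [S] be the product of sines, [N = 4 L + 1] and
    [X = 4 sin^2 (pi k / N)]. The vectors satisfy [u_(d+1) = (q_(d+1) - X) u_d] with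
    constants [q_d] ([u_step]). The discrete Fourier transform turns multiplication
    by [X] into a second difference, and by induction on [d] it maps [u_d] to a
    multiple of [u_(-d)] and [v_d] to a multiple of [v_(-d-1)] ([cos_transformE],
    [sin_transformE]); this is the finite q-binomial theorem in disguise. The multiples
    belonging to opposite vectors are mutually inverse ([dft_coefM]), so the families
    [w], [x], [y], [z] consist of eigenvectors for the eigenvalues [1], [- i], [- 1],
    [i]. Within a family the supports grow strictly ([family_peak]), hence
    Gram-Schmidt produces nonzero orthogonal vectors; different families are
    orthogonal because the transform is symmetric ([eigvec_orth]). The [N] unit vectors
    obtained are therefore an orthonormal basis of eigenvectors.

    The Gaussian. The quotient of consecutive entries of [u_(-2)] is
    [sin (alpha - beta) / sin (alpha + beta)] with [alpha] near [pi / 4] and [beta] a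
    half-integer multiple of [eps^2 / 2], hence about [exp (- 2 beta)]; the exponents
    add up to [x^2 / 2] at the node [x = eps k]. So [u_(-2)], divided by its value at the
    origin, tends to [exp (- x^2 / 2)], uniformly against every polynomial weight
    ([gcvg_center]). The other vectors are [u_(-2)] times polynomials in sines of the
    position, which tend to polynomials in [x] after scaling ([pcvg_chord_node],
    [pcvg_sine_node]).

    Inner products. The functional [gint] integrates a polynomial against
    [exp (- x^2)] through its moments. Riemann sums on the nodes converge to it
    ([rsum_cvg]): integration by parts, as a telescoping sum with the mean value
    theorem, reduces all moments to that of order zero, which is the Gauss integral.
    Integration by parts also makes the Hermite polynomials orthogonal for [gint], so
    the Hermite functions come from the monomials by Gram-Schmidt
    ([hpoly_gram_schmidt]).

    The limit. Because all eigenvectors are orthonormal, [phi_n] is the normalization of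
    [f - sum_(j < n) (f . phi_j) phi_j] for any [f] that is a positive multiple of the
    family vector of rank [n] up to the span of [phi_0, ..., phi_(n-1)]
    ([phi_leading]). If [f], suitably scaled, tends to a positive multiple of
    [x^n exp (- x^2 / 2)], and the claim holds for smaller [n], then the inner products
    converge and the limit of [phi_n] is the Gram-Schmidt vector of [x^n], that is, the
    Hermite function ([phi_limit]). For [n <= 7] such an [f] is found explicitly: its
    entries contain the power [X^(n./2)] as an exact factor, and, for odd [n], the factor
    [sin (2 pi k / N)] ([limit_phi0] to [limit_phi7]). *)

Set Implicit Arguments.
Unset Strict Implicit.
Unset Printing Implicit Defensive.
Local Open Scope classical_set_scope.
Local Open Scope ring_scope.

(** * Sines at multiples of pi / N *)

Section Trigonometry.
Variables (R : realType) (L : nat).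
Implicit Types (a b d j k : int) (n : nat).

Definition angle a : R := pi * a%:~R / (dimN L)%:R.

(** [chord a] is the length of a chord of the unit circle subtending [a] of the
    [N] equal arcs; with the doubling the sum and product formulas have no
    denominators. *)
Definition chord a : R := 2 * sin (angle a).
Definition cochord a : R := 2 * cos (angle a).

(** The product [S] with an integer argument, so that shifts by [k] and [- k]
    can be written without truncated subtraction. *)
Definition sprod a : R := sinprod R L `|a|%N.

Local Notation ss := chord.
Local Notation cc := cochord.
Local Notation sp := sprod.

Lemma dimN_gt0 : 0 < (dimN L)%:R :> R.
Proof. by rewrite ltr0n. Qed.

Lemma angleD a b : angle (a + b) = angle a + angle b.
Proof. by rewrite /angle intrD mulrDr mulrDl. Qed.

Lemma angleB a b : angle (a - b) = angle a - angle b.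
Proof. by rewrite /angle intrB mulrBr mulrBl. Qed.

Lemma angleN a : angle (- a) = - angle a.
Proof. by rewrite /angle intrN mulrN mulNr. Qed.

Lemma angle_dimN : angle (dimN L)%:Z = pi.
Proof. by rewrite /angle -mulrA divff ?mulr1 // gt_eqF // dimN_gt0. Qed.

Lemma chordM a b : ss a * ss b = cc (a - b) - cc (a + b).
Proof. by rewrite /ss /cc angleB angleD cosB cosD; ring. Qed.

Lemma cochordM a b : cc a * cc b = cc (a + b) + cc (a - b).
Proof. by rewrite /cc angleB angleD cosB cosD; ring. Qed.

Lemma chord_cochordM a b : ss a * cc b = ss (a + b) + ss (a - b).
Proof. by rewrite /cc /ss angleB angleD sinB sinD; ring. Qed.

Lemma cochordN a : cc (- a) = cc a.
Proof. by rewrite /cc angleN cosN. Qed.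

Lemma chordN a : ss (- a) = - ss a.
Proof. by rewrite /ss angleN sinN mulrN. Qed.

Lemma cochordDN a : cc (a + (dimN L)%:Z) = - cc a.
Proof. by rewrite /cc angleD angle_dimN cosDpi mulrN. Qed.

Lemma chordDN a : ss (a + (dimN L)%:Z) = - ss a.
Proof. by rewrite /ss angleD angle_dimN sinDpi mulrN. Qed.

Lemma chord0 : ss 0 = 0.
Proof. by rewrite /ss /angle mulr0 mul0r sin0 mulr0. Qed.

Lemma chordMN a : ss (a * (dimN L)%:Z) = 0.
Proof.
suff H n : ss (n%:Z * (dimN L)%:Z) = 0.
  by case: a => n; rewrite ?NegzE ?mulNr ?chordN H ?oppr0.
elim: n => [|n IH]; first by rewrite mul0r chord0.
by rewrite intS addrC mulrDl mul1r chordDN IH oppr0.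
Qed.

Lemma chord_gt0 a : 0 < a -> a < (dimN L)%:Z -> 0 < ss a.
Proof.
move=> a0 aN; rewrite /ss mulr_gt0 // sin_gt0_pi // /angle.
rewrite divr_gt0 ?dimN_gt0 ?mulr_gt0 ?pi_gt0 ?ltr0z //=.
by rewrite ltr_pdivrMr ?dimN_gt0 // ltr_pM2l ?pi_gt0 // -[ltRHS]/((dimN L)%:Z%:~R) ltr_int.
Qed.

Lemma sprod0 : sp 0 = 1.
Proof. by rewrite /sp /sinprod big_geq. Qed.

Lemma sprodS a : 0 <= a -> sp (a + 1) = ss (a + 1) * sp a.
Proof.
case: a => // n _; rewrite /sp /sinprod -PoszD addn1 /=.
by rewrite big_nat_recr //= mulrC.
Qed.

Lemma sprod_eq0 a : (dimN L)%:Z <= a -> sp a = 0.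
Proof.
case: a => // n; rewrite lez_nat => nN; rewrite /sp /sinprod /=.
apply/eqP; rewrite prodf_seq_eq0; apply/hasP; exists (dimN L).
  by rewrite mem_index_iota.
rewrite /= (_ : sin _ = 0) ?mulr0 //.
by rewrite -mulrA divff ?mulr1 ?sinpi // gt_eqF // dimN_gt0.
Qed.

Lemma sprod_gt0 a : 0 <= a -> a < (dimN L)%:Z -> 0 < sp a.
Proof.
case: a => // n _; rewrite ltz_nat => nN.
elim: n nN => [|n IH] nN; first by rewrite sprod0 ltr01.
rewrite -addn1 PoszD sprodS // mulr_gt0 ?chord_gt0 ?IH //; lia.
Qed.

Lemma sprod_reflect a : 0 <= a -> a < (dimN L)%:Z -> sp a * sp ((4 * L)%:Z - a) = sp (4 * L)%:Z.
Proof.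
case: a => // n _; rewrite ltz_nat => nN.
elim: n nN => [|n IH] nN; first by rewrite subr0 sprod0 mul1r.
rewrite -IH ?(ltnW nN) //.
have -> : (4 * L)%:Z - n%:Z = (4 * L)%:Z - n.+1%:Z + 1 by rewrite intS; ring.
rewrite sprodS; last lia.
rewrite -addn1 [in sp (n + 1)%:Z]PoszD sprodS //.
have -> : ss (n%:Z + 1) = ss ((4 * L)%:Z - (n + 1)%N%:Z + 1).
  rewrite -[LHS]opprK -chordN -chordDN; congr ss; lia.
ring.
Qed.

End Trigonometry.

(** * The finite Fourier transform of the vectors u and v *)

Section FourierSums.
Variables (R : realType) (L : nat).
Implicit Types (a b d j k : int) (n : nat).

Local Notation N := (dimN L)%:Z.
Local Notation ss := (@chord R L).
Local Notation cc := (@cochord R L).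
Local Notation sp := (@sprod R L).
Local Notation SS := (@SS R L).

Lemma cochordD2N a b : cc (a + 2 * (b * N)) = cc a.
Proof.
apply/eqP; rewrite eq_sym -subr_eq0; apply/eqP.
have <- : ss (a + b * N) * ss (b * N) = 0 by rewrite chordMN mulr0.
by rewrite chordM; congr (cc _ - cc _); ring.
Qed.

Lemma SSE d k : SS d k = sp ((3 * L)%:Z + d + k) * sp ((3 * L)%:Z + d - k).
Proof. by []. Qed.

Lemma SSN d k : SS d (- k) = SS d k.
Proof. by rewrite !SSE opprK mulrC. Qed.

Lemma SS_step d k : 0 <= (3 * L)%:Z + d + k -> 0 <= (3 * L)%:Z + d - k ->
  SS (d + 1) k = (cc (2 * k) - cc (2 * ((3 * L)%:Z + d + 1))) * SS d k.
Proof.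
move=> h1 h2; rewrite !SSE.
have -> : (3 * L)%:Z + (d + 1) + k = ((3 * L)%:Z + d + k) + 1 by ring.
have -> : (3 * L)%:Z + (d + 1) - k = ((3 * L)%:Z + d - k) + 1 by ring.
rewrite !sprodS // mulrACA chordM; congr ((cc _ - cc _) * _); ring.
Qed.

Lemma cidx_bound (i : 'I_(dimN L)) :
  (- (2 * L)%:Z <= cidx i) && (cidx i <= (2 * L)%:Z).
Proof. by have := ltn_ord i; rewrite /cidx => ?; lia. Qed.

(** Multiplying by [chord j] makes the sum telescope. *)
Lemma sum_cochord j : j != 0 -> - (2 * L)%:Z <= j -> j <= (2 * L)%:Z ->
  \sum_(i < dimN L) cc (2 * cidx i * j) = 0.
Proof.
move=> j0 jl ju.
have sj : ss j != 0.
  have [jp|] := ltP 0 j; first by rewrite gt_eqF // chord_gt0 //; lia.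
  by move=> jn; rewrite -[j]opprK chordN oppr_eq0 gt_eqF // chord_gt0 //; lia.
apply: (mulfI sj); rewrite mulr0 big_distrr /=.
pose f (n : nat) := ss (j * (2 * (n%:Z - (2 * L)%:Z) - 1)).
transitivity (\sum_(0 <= n < dimN L) (f n.+1 - f n)).
  rewrite big_mkord; apply: eq_bigr => i _; rewrite chord_cochordM /f /cidx intS.
  rewrite -[X in _ - X]opprK -chordN opprK.
  by congr (ss _ + ss _); ring.
rewrite telescope_sumr // /f.
have -> : j * (2 * ((dimN L)%:Z - (2 * L)%:Z) - 1) = j * N by congr (_ * _); lia.
have -> : j * (2 * (0%:Z - (2 * L)%:Z) - 1) = - j * N.
  by rewrite mulNr -mulrN; congr (_ * _); lia.
by rewrite !chordMN subr0.
Qed.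

(** Twice the (unnormalized) transform of the even vector [u_d]. *)
Definition cos_transform d j : R := \sum_(i < dimN L) cc (2 * cidx i * j) * SS d (cidx i).

Lemma cos_transformDN d j b : cos_transform d (j + b * N) = cos_transform d j.
Proof.
apply: eq_bigr => i _; congr (_ * _).
by rewrite -[RHS](@cochordD2N _ (cidx i * b)); congr cc; ring.
Qed.

(** The transform is periodic in [j], and [SS (- d)] vanishes at both ends
    [2 L] and [2 L + 1] of the period, so that a formula valid on one period
    extends by one step on each side. *)
Lemma cos_transform_extend d (c e : R) : d < L%:Z ->
  (forall j, - (2 * L)%:Z <= j -> j <= (2 * L)%:Z -> e * cos_transform d j = c * SS (- d) j) ->
  forall j, - (2 * L)%:Z - 1 <= j -> j <= (2 * L)%:Z + 1 -> e * cos_transform d j = c * SS (- d) j.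
Proof.
move=> dL IH j jl ju.
have bd : SS (- d) (2 * L)%:Z = 0 by rewrite SSE sprod_eq0 ?mul0r //; lia.
have bd1 : SS (- d) ((2 * L)%:Z + 1) = 0 by rewrite SSE sprod_eq0 ?mul0r //; lia.
have [->|jne] := eqVneq j ((2 * L)%:Z + 1).
  have -> : (2 * L)%:Z + 1 = - (2 * L)%:Z + 1 * N by lia.
  rewrite cos_transformDN IH; [|lia..].
  have -> : - (2 * L)%:Z + 1 * N = (2 * L)%:Z + 1 by lia.
  by rewrite SSN bd bd1.
have [->|jne'] := eqVneq j (- (2 * L)%:Z - 1).
  have -> : - (2 * L)%:Z - 1 = (2 * L)%:Z + (- 1) * N by lia.
  rewrite cos_transformDN IH; [|lia..].
  have -> : (2 * L)%:Z + (- 1) * N = - ((2 * L)%:Z + 1) by lia.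
  by rewrite SSN bd bd1.
by apply: IH; lia.
Qed.

(** By induction on [d]. Passing from [u_d] to [u_(d+1)] multiplies by
    [2 cos (2 pi k / N)] minus a constant, and the transform turns the cosine into
    a sum of two shifts, which act on [u_(-d)] by a product formula for sines.
    The induction starts at [d = - L], where [u_d] is constant and [u_(-d)] is
    supported at the origin. Both sides carry a factor ([S(4L)] and [N]) that is
    cancelled only afterwards: their equality is itself read off at the other end
    [d = L] of the induction. *)
Lemma cos_transform_scaled d : - L%:Z <= d -> d <= L%:Z ->
  forall j, - (2 * L)%:Z <= j -> j <= (2 * L)%:Z ->
  sp (4 * L)%:Z * cos_transform d j =
  2 * (dimN L)%:R * sp ((2 * L)%:Z + 2 * d) * SS (- d) j.
Proof.
move=> dl; have [n ->] : exists n : nat, d = n%:Z - L%:Z.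
  by exists (absz (d + L%:Z)%R); lia.
elim: n {d dl} => [|n IH] dl j jl ju.
  rewrite /cos_transform.
  have S0 (i : 'I_(dimN L)) : SS (0%:Z - L%:Z) (cidx i) = sp (4 * L)%:Z.
    have /andP[? ?] := cidx_bound i.
    rewrite SSE -(@sprod_reflect _ _ ((2 * L)%:Z + cidx i)); [|lia..].
    by congr (sp _ * sp _); lia.
  under eq_bigr do rewrite S0.
  rewrite -mulr_suml.
  have -> : (2 * L)%:Z + 2 * (0%:Z - L%:Z) = 0 by lia.
  rewrite sprod0 SSE.
  have [->|j0] := eqVneq j 0.
    under eq_bigr do rewrite mulr0 /cochord /angle mulr0 mul0r cos0 mulr1.
    rewrite sumr_const card_ord -[(4 * L).+1]/(dimN L).
    have -> : (3 * L)%:Z - (0%:Z - L%:Z) + 0 = (4 * L)%:Z by lia.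
    by rewrite -mulr_natr; ring.
  rewrite sum_cochord // mul0r mulr0.
  have [jp|jn] := ltP 0 j.
    by rewrite sprod_eq0 ?mul0r ?mulr0 //; lia.
  by rewrite (@sprod_eq0 _ _ (_ - j)) ?mulr0 //; lia.
set d := n%:Z - L%:Z in IH.
have -> : n.+1%:Z - L%:Z = d + 1 by rewrite /d intS; ring.
have {dl} dL : d + 1 <= L%:Z by rewrite /d; lia.
have dl : - L%:Z <= d by rewrite /d; lia.
have dL' : d <= L%:Z by lia.
have {}IH := IH dL'.
have {}IH := cos_transform_extend _ IH.
have {}IH := IH ltac:(lia).
transitivity (sp (4 * L)%:Z * (cos_transform d (j + 1) + cos_transform d (j - 1)
     - cc (2 * ((3 * L)%:Z + d + 1)) * cos_transform d j)).
  congr (_ * _); rewrite /cos_transform -big_split /= mulr_sumr -sumrB.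
  apply: eq_bigr => i _; have /andP[? ?] := cidx_bound i.
  rewrite SS_step; [|lia..].
  rewrite mulrA mulrBr cochordM.
  have -> : 2 * cidx i * j + 2 * cidx i = 2 * cidx i * (j + 1) by ring.
  have -> : 2 * cidx i * j - 2 * cidx i = 2 * cidx i * (j - 1) by ring.
  ring.
rewrite mulrBr mulrDr mulrCA !IH; [|lia..].
set A := (3 * L)%:Z - d - 1.
have A0 : (2 * L)%:Z <= A by rewrite /A; lia.
have E1 : SS (- d) (j + 1) = ss (A + j + 2) * ss (A + j + 1) * SS (- (d + 1)) j.
  rewrite !SSE.
  have -> : (3 * L)%:Z - d + (j + 1) = A + j + 1 + 1 by rewrite /A; ring.
  have -> : (3 * L)%:Z - d - (j + 1) = A - j by rewrite /A; ring.
  have -> : (3 * L)%:Z - (d + 1) + j = A + j by rewrite /A; ring.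
  have -> : (3 * L)%:Z - (d + 1) - j = A - j by rewrite /A; ring.
  rewrite !sprodS; [|lia..].
  by rewrite -[A + j + 1 + 1]addrA -[1 + 1]/2 !mulrA.
have E2 : SS (- d) (j - 1) = ss (A - j + 2) * ss (A - j + 1) * SS (- (d + 1)) j.
  rewrite !SSE.
  have -> : (3 * L)%:Z - d - (j - 1) = A - j + 1 + 1 by rewrite /A; ring.
  have -> : (3 * L)%:Z - d + (j - 1) = A + j by rewrite /A; ring.
  have -> : (3 * L)%:Z - (d + 1) + j = A + j by rewrite /A; ring.
  have -> : (3 * L)%:Z - (d + 1) - j = A - j by rewrite /A; ring.
  rewrite !sprodS; [|lia..].
  by rewrite -[A - j + 1 + 1]addrA -[1 + 1]/2 !mulrA [_ * sp (A + j)]mulrC !mulrA.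
have E3 : SS (- d) j = ss (A + j + 1) * ss (A - j + 1) * SS (- (d + 1)) j.
  rewrite !SSE.
  have -> : (3 * L)%:Z - d - j = A - j + 1 by rewrite /A; ring.
  have -> : (3 * L)%:Z - d + j = A + j + 1 by rewrite /A; ring.
  have -> : (3 * L)%:Z - (d + 1) + j = A + j by rewrite /A; ring.
  have -> : (3 * L)%:Z - (d + 1) - j = A - j by rewrite /A; ring.
  rewrite !sprodS; [|lia..].
  ring.
have E4 : sp ((2 * L)%:Z + 2 * (d + 1)) =
    ss ((2 * L)%:Z + 2 * d + 2) * ss ((2 * L)%:Z + 2 * d + 1) * sp ((2 * L)%:Z + 2 * d).
  have -> : (2 * L)%:Z + 2 * (d + 1) = (2 * L)%:Z + 2 * d + 1 + 1 by ring.
  rewrite !sprodS; [|lia..].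
  by rewrite -[_ + 1 + 1]addrA -[1 + 1]/2 !mulrA.
have E5 : ss (A + j + 2) * ss (A + j + 1) + ss (A - j + 2) * ss (A - j + 1)
    - cc (2 * ((3 * L)%:Z + d + 1)) * (ss (A + j + 1) * ss (A - j + 1))
  = ss ((2 * L)%:Z + 2 * d + 2) * ss ((2 * L)%:Z + 2 * d + 1).
  rewrite !chordM.
  have -> : (2 * L)%:Z + 2 * d + 2 - ((2 * L)%:Z + 2 * d + 1) = 1 by ring.
  have -> : A + j + 2 - (A + j + 1) = 1 by ring.
  have -> : A - j + 2 - (A - j + 1) = 1 by ring.
  have -> : A + j + 1 - (A - j + 1) = 2 * j by ring.
  have -> : A + j + 1 + (A - j + 1) = 2 * A + 2 by ring.
  have -> : A + j + 2 + (A + j + 1) = (2 * A + 3) + 2 * j by ring.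
  have -> : A - j + 2 + (A - j + 1) = (2 * A + 3) - 2 * j by ring.
  (* The two arguments add up to 3 N. *)
  have -> : cc (2 * ((3 * L)%:Z + d + 1)) = - cc (2 * A + 3).
    rewrite -cochordDN -cochordN -(@cochordD2N (2 * A + 3 + N) (- 2)).
    by congr cc; rewrite /A; lia.
  (* The two arguments add up to 4 N. *)
  have -> : cc ((2 * L)%:Z + 2 * d + 2 + ((2 * L)%:Z + 2 * d + 1)) =
            cc ((2 * A + 3) + (2 * A + 2)).
    rewrite -cochordN -(@cochordD2N (2 * A + 3 + (2 * A + 2)) (- 2)).
    by congr cc; rewrite /A; lia.
  have E6 := cochordM R L (2 * A + 3) (2 * j).
  have E7 := cochordM R L (2 * A + 3) (2 * A + 2).
  have e1 : 2 * A + 3 - (2 * A + 2) = 1 by ring.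
  rewrite e1 in E7.
  lra.
rewrite E1 E2 E3 E4 -E5; ring.
Qed.

(** At [d = L] the vector [u_L] is supported at the origin, and its transform
    at [j = 0] is a single term. *)
Lemma sprod_top : sp (4 * L)%:Z = (dimN L)%:R.
Proof.
have h1 : - L%:Z <= L%:Z by lia.
have h2 : - (2 * L)%:Z <= 0 by lia.
have /(_ 0 h2 isT) := cos_transform_scaled h1 (lexx _).
have nz : sp (4 * L)%:Z != 0 by rewrite gt_eqF // sprod_gt0 //; lia.
have -> : (2 * L)%:Z + 2 * L%:Z = (4 * L)%:Z by lia.
rewrite [SS _ 0]SSE addr0 ?subr0.
have -> : sp ((3 * L)%:Z - L%:Z) * sp ((3 * L)%:Z - L%:Z) = sp (4 * L)%:Z.
  by rewrite -(@sprod_reflect _ _ ((3 * L)%:Z - L%:Z)); [congr (_ * sp _)| |]; lia.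
have i0P : (2 * L < dimN L)%N by lia.
rewrite /cos_transform (bigD1 (Ordinal i0P)) //= big1 ?addr0; last first.
  move=> i i0; have {}i0 : (i : nat) <> (2 * L)%N by move=> e; case/eqP: i0; exact: val_inj.
  have ci : cidx i != 0 by apply/eqP; rewrite /cidx; lia.
  have /andP[? ?] := cidx_bound i.
  rewrite SSE; have [cp|cn] := ltP 0 (cidx i).
    by rewrite sprod_eq0 ?mul0r ?mulr0 //; lia.
  by rewrite (@sprod_eq0 _ _ (_ - cidx i)) ?mulr0 //; lia.
rewrite mulr0 /cochord /angle mulr0 mul0r cos0 mulr1 SSE {1 2}/cidx /= subrr addr0 ?subr0.
have -> : (3 * L)%:Z + L%:Z = (4 * L)%:Z by lia.
move=> e; apply/esym; apply: (mulfI nz); apply: (mulfI nz).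
by apply: (@mulfI _ 2); [rewrite pnatr_eq0|rewrite !mulrA; lra].
Qed.

(** Up to a constant, [u_d (k)] is the symmetric q-binomial coefficient
    [2 (L - d)] over [L - d + k] at [q = exp (2 pi i / N)], and this is the finite
    q-binomial theorem. *)
Lemma cos_transformE d : - L%:Z <= d -> d <= L%:Z ->
  forall j, - (2 * L)%:Z <= j -> j <= (2 * L)%:Z ->
  cos_transform d j = 2 * sp ((2 * L)%:Z + 2 * d) * SS (- d) j.
Proof.
move=> dl du j jl ju; have := cos_transform_scaled dl du jl ju.
rewrite sprod_top [2 * _]mulrC -!mulrA => /mulfI; apply.
by rewrite pnatr_eq0.
Qed.

(** Multiplication by a sine becomes a difference of two shifts. *)
Lemma sin_transformE d : - L%:Z <= d -> d < L%:Z ->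
  forall j, - (2 * L)%:Z <= j -> j <= (2 * L)%:Z ->
  \sum_(i < dimN L) ss (2 * cidx i * j) * (ss (2 * cidx i) * SS d (cidx i)) =
  2 * sp ((2 * L)%:Z + 2 * d + 1) * (ss (2 * j) * SS (- d - 1) j).
Proof.
move=> dl du j jl ju.
have H j' : - (2 * L)%:Z - 1 <= j' -> j' <= (2 * L)%:Z + 1 ->
    1 * cos_transform d j' = 2 * sp ((2 * L)%:Z + 2 * d) * SS (- d) j'.
  by apply: cos_transform_extend => // k kl ku; rewrite mul1r cos_transformE // ltW.
transitivity (1 * cos_transform d (j - 1) - 1 * cos_transform d (j + 1)).
  rewrite !mul1r -sumrB; apply: eq_bigr => i _; rewrite mulrA chordM -mulrBl.
  by congr ((cc _ - cc _) * _); ring.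
rewrite !H; [|lia..].
set A := (3 * L)%:Z - d - 1.
have A0 : (2 * L)%:Z <= A by rewrite /A; lia.
have E1 : SS (- d) (j + 1) = ss (A + j + 2) * ss (A + j + 1) * SS (- d - 1) j.
  rewrite !SSE.
  have -> : (3 * L)%:Z - d + (j + 1) = A + j + 1 + 1 by rewrite /A; ring.
  have -> : (3 * L)%:Z - d - (j + 1) = A - j by rewrite /A; ring.
  have -> : (3 * L)%:Z + (- d - 1) + j = A + j by rewrite /A; ring.
  have -> : (3 * L)%:Z + (- d - 1) - j = A - j by rewrite /A; ring.
  rewrite !sprodS; [|lia..].
  by rewrite -[A + j + 1 + 1]addrA -[1 + 1]/2 !mulrA.
have E2 : SS (- d) (j - 1) = ss (A - j + 2) * ss (A - j + 1) * SS (- d - 1) j.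
  rewrite !SSE.
  have -> : (3 * L)%:Z - d - (j - 1) = A - j + 1 + 1 by rewrite /A; ring.
  have -> : (3 * L)%:Z - d + (j - 1) = A + j by rewrite /A; ring.
  have -> : (3 * L)%:Z + (- d - 1) + j = A + j by rewrite /A; ring.
  have -> : (3 * L)%:Z + (- d - 1) - j = A - j by rewrite /A; ring.
  rewrite !sprodS; [|lia..].
  by rewrite -[A - j + 1 + 1]addrA -[1 + 1]/2 !mulrA [_ * sp (A + j)]mulrC !mulrA.
have E4 : sp ((2 * L)%:Z + 2 * d + 1) = ss ((2 * L)%:Z + 2 * d + 1) * sp ((2 * L)%:Z + 2 * d).
  by apply: sprodS; lia.
have E5 : ss (A - j + 2) * ss (A - j + 1) - ss (A + j + 2) * ss (A + j + 1) =
    ss ((2 * L)%:Z + 2 * d + 1) * ss (2 * j).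
  (* The two arguments add up to 2 N. *)
  have -> : ss ((2 * L)%:Z + 2 * d + 1) = - ss (2 * A + 3).
    have -> : (2 * L)%:Z + 2 * d + 1 = - (2 * A + 3) + N + N by rewrite /A; lia.
    by rewrite !chordDN opprK chordN.
  rewrite mulNr !chordM.
  have -> : A + j + 2 - (A + j + 1) = 1 by ring.
  have -> : A - j + 2 - (A - j + 1) = 1 by ring.
  have -> : A + j + 2 + (A + j + 1) = (2 * A + 3) + 2 * j by ring.
  have -> : A - j + 2 + (A - j + 1) = (2 * A + 3) - 2 * j by ring.
  by ring.
rewrite E1 E2 E4 -mulrBr -mulrBl E5; ring.
Qed.

End FourierSums.

(** * Eigenvectors and Gram-Schmidt orthogonalization *)

Section Eigenvectors.
Variables (R : realType) (L : nat).
Implicit Types (a b d j k : int) (n m : nat) (u v : 'rV[R]_(dimN L)).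

Local Notation N := (dimN L)%:Z.
Local Notation ss := (@chord R L).
Local Notation cc := (@cochord R L).
Local Notation sp := (@sprod R L).
Local Notation SS := (@SS R L).
Local Notation C := (real_complex R).
Local Notation T := (@toC R (dimN L)).

Lemma DFT_is_linear (z : R[i]) (U V : 'rV[R[i]]_(dimN L)) :
  DFT (z *: U + V) = z *: DFT U + DFT V.
Proof.
apply/rowP => j; rewrite !mxE [RHS]addrC mulrCA -mulrDr; congr (_ * _).
rewrite mulr_sumr -big_split /=; apply: eq_bigr => k _; rewrite !mxE; ring.
Qed.

Lemma DFTD (U V : 'rV[R[i]]_(dimN L)) : DFT (U + V) = DFT U + DFT V.
Proof. by rewrite -[U]scale1r DFT_is_linear !scale1r. Qed.

Lemma DFT0 : DFT (0 : 'rV[R[i]]_(dimN L)) = 0.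
Proof. by apply: (addrI (DFT 0)); rewrite -DFTD !addr0. Qed.

Lemma DFTZ z (U : 'rV[R[i]]_(dimN L)) : DFT (z *: U) = z *: DFT U.
Proof. by rewrite -[z *: U]addr0 DFT_is_linear DFT0 addr0. Qed.

Lemma toCD u v : T (u + v) = T u + T v.
Proof. exact: map_mxD. Qed.

Lemma toCZ (a : R) u : T (a *: u) = C a *: T u.
Proof. exact: map_mxZ. Qed.

Lemma toCN u : T (- u) = - T u.
Proof. exact: map_mxN. Qed.

Lemma toC0 : T 0 = 0.
Proof. exact: map_mx0. Qed.

Lemma Complex_mulr (a b r : R) : Complex a b * C r = Complex (a * r) (b * r).
Proof. by apply/eqP; rewrite eq_complex /=; apply/andP; split; apply/eqP; ring. Qed.

Lemma Complex_mull (a b r : R) : C r * Complex a b = Complex (r * a) (r * b).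
Proof. by rewrite mulrC Complex_mulr ![r * _]mulrC. Qed.

Lemma Ni_mulr (r : R) : - 'i%C * C r = Complex 0 (- r).
Proof. by apply/eqP; rewrite eq_complex /=; apply/andP; split; apply/eqP; ring. Qed.

Lemma sum_Complex (I : finType) (f g : I -> R) :
  \sum_i Complex (f i) (g i) = Complex (\sum_i f i) (\sum_i g i).
Proof. by elim/big_rec3: _ => // i x y _ _ ->. Qed.

Lemma DFT_toCE u (j : 'I_(dimN L)) :
  DFT (T u) 0 j = Complex
    ((Num.sqrt (dimN L)%:R)^-1 * (2^-1 * \sum_i cc (2 * cidx i * cidx j) * u 0 i))
    (- ((Num.sqrt (dimN L)%:R)^-1 * (2^-1 * \sum_i ss (2 * cidx i * cidx j) * u 0 i))).
Proof.
rewrite !mxE.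
have E i : expi (- (2 * pi * (cidx i)%:~R * (cidx j)%:~R / (dimN L)%:R)) * T u 0 i
   = Complex (2^-1 * (cc (2 * cidx i * cidx j) * u 0 i)) (- (2^-1 * (ss (2 * cidx i * cidx j) * u 0 i))).
  have -> : 2 * pi * (cidx i)%:~R * (cidx j)%:~R / (dimN L)%:R = angle R L (2 * cidx i * cidx j).
    by rewrite /angle !intrM; ring.
  rewrite mxE /expi cosN sinN /chord /cochord Complex_mulr.
  by congr Complex; field.
under eq_bigr do rewrite E.
rewrite sum_Complex -!mulr_sumr sumrN -mulr_sumr.
by rewrite Complex_mull mulrN.
Qed.

Lemma cidx_rev (i : 'I_(dimN L)) : cidx (rev_ord i) = - cidx i.
Proof. by rewrite /cidx /=; have := ltn_ord i; lia. Qed.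

Lemma sum_odd0 (f : int -> R) : (forall k, f (- k) = - f k) ->
  \sum_(i < dimN L) f (cidx i) = 0.
Proof.
move=> fN; have : \sum_(i < dimN L) f (cidx i) = - \sum_(i < dimN L) f (cidx i).
  rewrite [LHS](reindex_inj rev_ord_inj) /= -sumrN; apply: eq_bigr => i _.
  by rewrite cidx_rev fN.
by move=> e; lra.
Qed.

Definition dft_coef (a : int) : R := (Num.sqrt (dimN L)%:R)^-1 * sp a.

Lemma vec_uE d i : vec_u R L d 0 i = SS d (cidx i).
Proof. by rewrite mxE. Qed.

Lemma vec_vE d i : vec_v R L d 0 i = 2^-1 * ss (2 * cidx i) * SS d (cidx i).
Proof.
rewrite mxE; congr (_ * _); rewrite /chord mulKf ?pnatr_eq0 //; congr sin.
by rewrite /angle intrM; ring.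
Qed.

Lemma DFT_u d : - L%:Z <= d -> d <= L%:Z ->
  DFT (T (vec_u R L d)) = C (dft_coef ((2 * L)%:Z + 2 * d)) *: T (vec_u R L (- d)).
Proof.
move=> dl du; apply/rowP => j; rewrite DFT_toCE.
have /andP[? ?] := cidx_bound j.
rewrite !mxE.
under eq_bigr do rewrite vec_uE.
rewrite -/(cos_transform _ _ _ _) cos_transformE //.
under eq_bigr do rewrite vec_uE.
rewrite (@sum_odd0 (fun k => ss (2 * k * cidx j) * SS d k)); last first.
  by move=> k; rewrite SSN mulrN mulNr chordN mulNr.
rewrite !mulr0 oppr0 -rmorphM /= /dft_coef; congr Complex.
by field; rewrite sqrtr_eq0 -ltNge ltr0n.
Qed.

Lemma DFT_v d : - L%:Z <= d -> d < L%:Z ->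
  DFT (T (vec_v R L d)) =
  (- 'i%C * C (dft_coef ((2 * L)%:Z + 2 * d + 1))) *: T (vec_v R L (- d - 1)).
Proof.
move=> dl du; apply/rowP => j; rewrite DFT_toCE.
have /andP[? ?] := cidx_bound j.
rewrite [RHS]mxE [T _ _ _]mxE [vec_v _ _ _ _ _]vec_vE.
have -> : \sum_i ss (2 * cidx i * cidx j) * vec_v R L d 0 i =
    2^-1 * (2 * sp ((2 * L)%:Z + 2 * d + 1) * (ss (2 * cidx j) * SS (- d - 1) (cidx j))).
  by rewrite -sin_transformE // mulr_sumr; apply: eq_bigr => i _; rewrite vec_vE; ring.
under eq_bigr do rewrite vec_vE.
rewrite (@sum_odd0 (fun k => cc (2 * k * cidx j) * (2^-1 * ss (2 * k) * SS d k))); last first.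
  by move=> k; rewrite SSN !mulrN mulNr cochordN chordN; ring.
rewrite !mulr0 -[RHS]mulrA -rmorphM /= Ni_mulr /dft_coef; congr Complex.
by field; rewrite sqrtr_eq0 -ltNge ltr0n.
Qed.

(** The transform squares to the identity on even vectors and to its opposite on
    odd ones, so the coefficients of two opposite vectors are mutually inverse. *)
Lemma dft_coefM a b : 0 <= a -> 0 <= b -> a + b = (4 * L)%:Z -> dft_coef a * dft_coef b = 1.
Proof.
move=> a0 b0 ab; rewrite /dft_coef mulrACA -invfM -expr2 sqr_sqrtr ?ler0n //.
have -> : b = (4 * L)%:Z - a by lia.
by rewrite sprod_reflect ?sprod_top ?mulVf // ?pnatr_eq0; lia.
Qed.

Lemma coefS_dft n : coefS R L n = dft_coef n%:Z.
Proof. by []. Qed.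

(** The exponent [n] is relevant modulo 4 only; taking the mode itself as index
    avoids reductions. *)
Definition eigvec n u := DFT (T u) = (- 'i%C) ^+ n *: T u.

Lemma eigvecD n u v : eigvec n u -> eigvec n v -> eigvec n (u + v).
Proof. by rewrite /eigvec toCD DFTD scalerDr => -> ->. Qed.

Lemma eigvecZ n (a : R) u : eigvec n u -> eigvec n (a *: u).
Proof. by rewrite /eigvec toCZ DFTZ => ->; rewrite !scalerA mulrC. Qed.

Lemma eigvec0 n : eigvec n 0.
Proof. by rewrite /eigvec toC0 DFT0 scaler0. Qed.

Lemma expNi_mod4 n : (- 'i%C : R[i]) ^+ n = (- 'i%C) ^+ (n %% 4).
Proof.
rewrite {1}(divn_eq n 4) exprD mulnC exprM (_ : _ ^+ 4 = 1) ?expr1n ?mul1r //.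
by rewrite (exprM (- _) 2 2) sqrrN sqr_i sqrrN expr1n.
Qed.

(** The transform exchanges [u_n] and [u_(-n)] up to mutually inverse factors,
    and [w_n] is the symmetric combination; the other three families are the
    antisymmetric one and the analogues for [v_n] and [v_(-n-1)]. *)
Lemma eigvec_w n : (n <= L)%N -> eigvec 0 (vec_w R L n).
Proof.
move=> nL; rewrite /eigvec /vec_w expr0 scale1r coefS_dft toCD toCZ DFTD DFTZ.
rewrite !DFT_u; [|lia..].
rewrite opprK scalerA -rmorphM /= addrC.
rewrite [dft_coef _ * _]dft_coefM; [|lia..].
rewrite rmorph1 scale1r; congr (_ + C (dft_coef _) *: _); lia.
Qed.

Lemma eigvec_x n : (n < L)%N -> eigvec 1 (vec_x R L n).
Proof.
move=> nL; rewrite /eigvec /vec_x expr1 coefS_dft toCD toCZ DFTD DFTZ.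
rewrite !DFT_v; [|lia..].
have -> : - (- n%:Z - 1) - 1 = n%:Z by ring.
rewrite !scalerDr !scalerA addrC; congr (_ *: _ + _ *: _).
  rewrite mulrCA -rmorphM /= dft_coefM ?rmorph1 ?mulr1 //; lia.
Qed.

Lemma eigvec_y n : (n < L)%N -> eigvec 2 (vec_y R L n).
Proof.
move=> nL; rewrite /eigvec /vec_y sqrrN sqr_i coefS_dft toCD toCN toCZ DFTD DFTZ.
rewrite -scaleN1r DFTZ !DFT_u; [|lia..].
have -> : - (- n%:Z - 1) = n%:Z + 1 by ring.
have -> : - (n%:Z + 1) = - n%:Z - 1 by ring.
rewrite !scalerDr !scalerA addrC; congr (_ *: _ + _ *: _).
  by rewrite mulrNN mulr1 -rmorphM /= dft_coefM ?rmorph1 //; lia.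
by congr (_ * C (dft_coef _)); lia.
Qed.

Lemma eigvec_z n : (n < L)%N -> eigvec 3 (vec_z R L n).
Proof.
move=> nL; rewrite /eigvec /vec_z exprS sqrrN sqr_i mulrN1 opprK coefS_dft.
rewrite toCD toCN toCZ DFTD DFTZ -scaleN1r DFTZ !DFT_v; [|lia..].
have -> : - (- n%:Z - 1) - 1 = n%:Z by ring.
rewrite !scalerDr !scalerA addrC; congr (_ *: _ + _ *: _).
  by rewrite mulrCA -rmorphM /= dft_coefM ?rmorph1 ?mulr1 ?mulrN1 //; lia.
by rewrite mulN1r mulNr opprK; congr (_ * C (dft_coef _)); lia.
Qed.

(** The kernel is a symmetric matrix; with real
    vectors this makes eigenvectors of different eigenvalues orthogonal. *)
Lemma DFT_sym (U V : 'rV[R[i]]_(dimN L)) : dot (DFT U) V = dot U (DFT V).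
Proof.
rewrite /dot; under eq_bigr do rewrite mxE -mulrA mulr_suml mulr_sumr.
under [RHS]eq_bigr do rewrite mxE mulrCA mulr_sumr mulr_sumr.
rewrite exchange_big /=; apply: eq_bigr => k _; apply: eq_bigr => j _.
have -> : 2 * pi * (cidx j)%:~R * (cidx k)%:~R / (dimN L)%:R =
          2 * pi * (cidx k)%:~R * (cidx j)%:~R / (dimN L)%:R :> R by ring.
ring.
Qed.

Lemma dot_toC u v : dot (T u) (T v) = C (dot u v).
Proof. by rewrite /dot rmorph_sum; apply: eq_bigr => i _; rewrite !mxE -rmorphM. Qed.

Lemma expNi_inj m n : (- 'i%C : R[i]) ^+ m = (- 'i%C) ^+ n -> m = n %[mod 4].
Proof.
rewrite expNi_mod4 [RHS]expNi_mod4.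
have := ltn_pmod n (isT : 0 < 4)%N; have := ltn_pmod m (isT : 0 < 4)%N.
have E0 : (- 'i%C : R[i]) ^+ 0 = Complex 1 0 by [].
have E1 : (- 'i%C : R[i]) ^+ 1 = Complex (- 0) (- 1) by [].
have E2 : (- 'i%C : R[i]) ^+ 2 = Complex (- 1) (- 0) by rewrite sqrrN sqr_i.
have E3 : (- 'i%C : R[i]) ^+ 3 = Complex 0 1.
  by rewrite exprS sqrrN sqr_i mulrN1 opprK.
case: (m %% 4)%N => [|[|[|[|//]]]] _; case: (n %% 4)%N => [|[|[|[|//]]]] _;
  rewrite ?(E0, E1, E2, E3) // => -[] h1 h2; exfalso; move: h1 h2; clear; lra.
Qed.

Lemma eigvec_orth m n u v : m <> n %[mod 4] -> eigvec m u -> eigvec n v -> dot u v = 0.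
Proof.
move=> mn hu hv; have := DFT_sym (T u) (T v); rewrite hu hv.
have dotZl z (U V : 'rV[R[i]]_(dimN L)) : dot (z *: U) V = z * dot U V.
  by rewrite /dot mulr_sumr; apply: eq_bigr => i _; rewrite mxE mulrA.
have dotZr z (U V : 'rV[R[i]]_(dimN L)) : dot U (z *: V) = z * dot U V.
  by rewrite /dot mulr_sumr; apply: eq_bigr => i _; rewrite mxE mulrCA.
rewrite dotZl dotZr dot_toC => e; apply/eqP; apply: contra_notT mn => nz.
apply: expNi_inj; apply: mulIf e; by rewrite -(rmorph0 C) (inj_eq (@complexI R)).
Qed.

End Eigenvectors.

Section GramSchmidt.
Variables (R : realType) (m : nat).
Implicit Types (u v w : 'rV[R]_m) (a : nat -> 'rV[R]_m) (n : nat).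

Lemma dotC u v : dot u v = dot v u.
Proof. by apply: eq_bigr => i _; rewrite mulrC. Qed.

Lemma dotDl u v w : dot (u + v) w = dot u w + dot v w.
Proof. by rewrite /dot -big_split; apply: eq_bigr => i _; rewrite mxE mulrDl. Qed.

Lemma dotZl (c : R) u v : dot (c *: u) v = c * dot u v.
Proof. by rewrite /dot mulr_sumr; apply: eq_bigr => i _; rewrite mxE mulrA. Qed.

Lemma dotZr (c : R) u v : dot u (c *: v) = c * dot u v.
Proof. by rewrite dotC dotZl dotC. Qed.

Lemma dotBl u v w : dot (u - v) w = dot u w - dot v w.
Proof. by rewrite -scaleN1r dotDl dotZl mulN1r. Qed.

Lemma dot0l u : dot 0 u = 0.
Proof. by rewrite -(scale0r 0) dotZl mul0r. Qed.

Lemma dot_suml (I : Type) (s : seq I) (P : pred I) (f : I -> 'rV[R]_m) u :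
  dot (\sum_(i <- s | P i) f i) u = \sum_(i <- s | P i) dot (f i) u.
Proof.
apply: (big_morph (fun v => dot v u)) => [v w|]; first exact: dotDl.
exact: dot0l.
Qed.

Lemma dot_ge0 u : 0 <= dot u u.
Proof. by apply: sumr_ge0 => i _; rewrite -expr2 sqr_ge0. Qed.

Lemma dot_eq0 u : (dot u u == 0) = (u == 0).
Proof.
apply/idP/eqP => [|->]; last by rewrite dot0l.
rewrite psumr_eq0 => [/allP h|i _]; last by rewrite -expr2 sqr_ge0.
apply/rowP => i; rewrite mxE; apply/eqP.
by have := h i (mem_index_enum i); rewrite /= -expr2 sqrf_eq0.
Qed.

Lemma enorm_sqr u : enorm u ^+ 2 = dot u u.
Proof. by rewrite /enorm sqr_sqrtr ?dot_ge0. Qed.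

Lemma enorm_gt0 u : u != 0 -> 0 < enorm u.
Proof. by move=> u0; rewrite sqrtr_gt0 lt_def dot_eq0 u0 dot_ge0. Qed.

Lemma gs_closed (P : 'rV[R]_m -> Prop) a n :
  P 0 -> (forall c u v, P u -> P v -> P (c *: u + v)) ->
  (forall j, (j <= n)%N -> P (a j)) -> P (gs a n).
Proof.
move=> P0 PL; elim/ltn_ind: n => n IH Pa; rewrite gsE addrC -scaleN1r.
apply: (PL (-1) _ _ _ _); last exact: Pa.
apply: (big_ind P) => // [u v Pu Pv|j _]; first by rewrite -[u]scale1r; exact: PL.
rewrite -[_ *: _]addr0; apply: PL => //; apply: IH => // i ij; apply: Pa.
exact: leq_trans ij (ltnW (ltn_ord j)).
Qed.

Lemma gs_orth a i j : i != j -> dot (gs a i) (gs a j) = 0.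
Proof.
suff H n : forall k, (k < n)%N -> dot (gs a n) (gs a k) = 0.
  by rewrite neq_ltn => /orP[?|?]; [rewrite dotC|]; exact: H.
elim/ltn_ind: n => n IH k kn; rewrite gsE dotBl dot_suml.
rewrite (bigD1 (Ordinal kn)) //= big1 => [|l lk]; last first.
  rewrite dotZl; have [ij|ij|e] := ltngtP l k.
  - by rewrite (dotC (gs a l) (gs a k)) IH ?mulr0.
  - by rewrite IH ?mulr0.
  - by case/eqP: lk; exact: val_inj.
rewrite addr0 dotZl enorm_sqr; have [->|z] := eqVneq (gs a k) 0.
  by rewrite dotC !dot0l mulr0 subr0.
by rewrite divfK ?subrr // dot_eq0.
Qed.

(** Used to see that the orthogonalized vectors do not vanish. *)
Lemma gs_triangular a n (i : 'I_m) :
  (forall j, (j < n)%N -> a j 0 i = 0) -> gs a n 0 i = a n 0 i.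
Proof.
move=> ai; rewrite gsE mxE [X in _ + X]mxE summxE big1 ?oppr0 ?addr0 // => j _; rewrite mxE.
rewrite (@gs_closed (fun u => u 0 i = 0)) ?mulr0 //.
- by rewrite mxE.
- by move=> c u v u0 v0; rewrite !mxE u0 v0 mulr0 addr0.
- by move=> k kj; apply: ai; exact: leq_ltn_trans kj (ltn_ord j).
Qed.

Lemma dot_normalize u : u != 0 -> dot (normalize u) (normalize u) = 1.
Proof.
move=> u0; rewrite dotZl dotZr mulrA -invfM -expr2 enorm_sqr mulVf //.
by rewrite dot_eq0.
Qed.

Lemma orthonormal_basis (b : nat -> 'rV[R]_m) :
  (forall i j, (i < m)%N -> (j < m)%N -> dot (b i) (b j) = (i == j)%:R) ->
  basis_of {: 'rV[R]_m} (mkseq b m).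
Proof.
move=> ob; rewrite basisEfree size_mkseq dimvf /dim /= mul1n leqnn subvf !andbT.
rewrite -(in_tupleE (mkseq b m)); apply/freeP => c.
rewrite /= => c0 i.
have im : (i < m)%N by rewrite -[X in (_ < X)%N](size_mkseq b m).
have := congr1 (fun v => dot v (b i)) c0; rewrite dot0l dot_suml (bigD1 i) //= big1.
  by rewrite dotZl nth_mkseq // ob // eqxx mulr1 addr0.
move=> j ji; have jm : (j < m)%N by rewrite -[X in (_ < X)%N](size_mkseq b m).
rewrite dotZl nth_mkseq // ob //; have [e|_] := eqVneq; last by rewrite mulr0.
by case/eqP: ji; exact: val_inj.
Qed.

End GramSchmidt.

(** * The orthonormal eigenbasis *)

Section Basis.
Variables (R : realType) (L : nat).
Implicit Types (a b d k : int) (n m r : nat).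

Local Notation ss := (@chord R L).
Local Notation sp := (@sprod R L).
Local Notation SS := (@SS R L).

Definition family r : nat -> 'rV[R]_(dimN L) :=
  match r with
  | 0 => vec_w R L | 1 => vec_x R L | 2 => vec_y R L | _ => vec_z R L
  end.

Lemma phiE n : phi R L n = normalize (gs (family (n %% 4)) (n %/ 4)).
Proof. by []. Qed.

Lemma family_eigvec r n : (r < 4)%N -> (4 * n + r < dimN L)%N -> eigvec r (family r n).
Proof.
case: r => [|[|[|[|//]]]] _ h /=.
- by apply: eigvec_w; lia.
- by apply: eigvec_x; lia.
- by apply: eigvec_y; lia.
- by apply: eigvec_z; lia.
Qed.

Lemma sprod_ge0 a : 0 <= a -> 0 <= sp a.
Proof.
move=> a0; have [aN|aN] := ltP a (dimN L)%:Z; first exact/ltW/sprod_gt0.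
by rewrite sprod_eq0.
Qed.

Lemma dft_coef_gt0 a : 0 <= a -> a < (dimN L)%:Z -> 0 < dft_coef R L a.
Proof. by move=> a0 aN; rewrite mulr_gt0 ?sprod_gt0 // invr_gt0 sqrtr_gt0 ltr0n. Qed.

(** The vector of rank [n] in each family extends one step further out than
    its predecessors, which gives linear independence. *)
Lemma family_peak r n : (r < 4)%N -> (4 * n + r < dimN L)%N ->
  exists i : 'I_(dimN L), family r n 0 i != 0 /\
    forall j : nat, (j < n)%N -> family r j 0 i = 0.
Proof.
(* The outermost nonzero position is k = L + n for w_n and k = L + n + 1 for the others. *)
move=> r4 nr; pose p := (3 * L + n + (r != 0))%N.
have pN : (p < dimN L)%N by rewrite /p; lia.
have cp : cidx (Ordinal pN) = (L + n + (r != 0))%N%:Z by rewrite /cidx /p /=; lia.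
exists (Ordinal pN).
have u0 d : (L + n + (r != 0))%N%:Z + d > L%:Z -> vec_u R L d 0 (Ordinal pN) = 0.
  by move=> h; rewrite vec_uE SSE cp sprod_eq0 ?mul0r //; lia.
have v0 d : (L + n + (r != 0))%N%:Z + d > L%:Z -> vec_v R L d 0 (Ordinal pN) = 0.
  by move=> h; rewrite vec_vE SSE cp sprod_eq0 ?mul0r ?mulr0 //; lia.
have up d : (L + n + (r != 0))%N%:Z + d = L%:Z -> 0 < vec_u R L d 0 (Ordinal pN).
  by move=> h; rewrite vec_uE SSE cp mulr_gt0 // sprod_gt0 //; lia.
have vp d : (0 < r)%N -> (L + n + (r != 0))%N%:Z + d = L%:Z -> 0 < vec_v R L d 0 (Ordinal pN).
  move=> r0 h; rewrite vec_vE SSE cp -mulrA pmulr_rgt0 ?invr_gt0 ?ltr0n //.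
  apply: mulr_gt0; first by apply: chord_gt0; lia.
  by apply: mulr_gt0; apply: sprod_gt0; lia.
case: r r4 nr @p pN cp u0 v0 up vp => [|[|[|[|//]]]] _ nr p pN cp u0 v0 up vp /=.
- split => [|j jn]; rewrite !mxE.
    rewrite gt_eqF // ltr_wpDl //.
      by rewrite mulr_ge0 // sprod_ge0 //; rewrite cp; lia.
    rewrite mulr_gt0 //; last by have := up (- n%:Z); rewrite mxE; apply; lia.
    by rewrite [coefS _ _ _]coefS_dft dft_coef_gt0 //; lia.
  have := u0 j%:Z; have := u0 (- j%:Z); rewrite !mxE => -> ; last lia.
  by move=> ->; rewrite ?mulr0 ?addr0 //; lia.
- split => [|j jn]; rewrite mxE [X in _ + X]mxE.
    rewrite v0 ?add0r; last lia.
    rewrite mulf_neq0 // ?gt_eqF ?vp //; try lia.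
    by rewrite [coefS _ _ _]coefS_dft dft_coef_gt0 //; lia.
  by rewrite !v0 ?mulr0 ?addr0 //; lia.
- split => [|j jn]; rewrite mxE [X in _ + X]mxE [X in X + _]mxE.
    rewrite u0 ?oppr0 ?add0r; last lia.
    rewrite mulf_neq0 // ?gt_eqF ?up //; try lia.
    by rewrite [coefS _ _ _]coefS_dft dft_coef_gt0 //; lia.
  by rewrite !u0 ?mulr0 ?oppr0 ?addr0 //; lia.
- split => [|j jn]; rewrite mxE [X in _ + X]mxE [X in X + _]mxE.
    rewrite v0 ?oppr0 ?add0r; last lia.
    rewrite mulf_neq0 // ?gt_eqF ?vp //; try lia.
    by rewrite [coefS _ _ _]coefS_dft dft_coef_gt0 //; lia.
  by rewrite !v0 ?mulr0 ?oppr0 ?addr0 //; lia.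
Qed.

Lemma gs_family_neq0 r n : (r < 4)%N -> (4 * n + r < dimN L)%N -> gs (family r) n != 0.
Proof.
move=> r4 nr; have [i [ni ji]] := family_peak r4 nr.
apply: contraNneq ni => e; rewrite -(gs_triangular ji) e mxE eqxx //.
Qed.

Lemma phi_index n : (n < dimN L)%N -> (n %% 4 < 4)%N /\ (4 * (n %/ 4) + n %% 4 < dimN L)%N.
Proof. by move=> nN; rewrite mulnC -divn_eq; split => //; rewrite ltn_mod. Qed.

Lemma eigvec_phi n : (n < dimN L)%N -> eigvec n (phi R L n).
Proof.
move=> /phi_index[r4 nr]; rewrite /eigvec expNi_mod4; apply: eigvecZ.
apply: gs_closed => [|c u v hu hv|j jn]; first exact: eigvec0.
  by apply: eigvecD => //; exact: eigvecZ.
apply: family_eigvec => //; apply: leq_ltn_trans nr.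
by rewrite leq_add2r leq_pmul2l.
Qed.

Lemma phi_orthonormal m n : (m < dimN L)%N -> (n < dimN L)%N ->
  dot (phi R L m) (phi R L n) = (m == n)%:R.
Proof.
move=> mN nN; have [<-|mn] := eqVneq.
  have [r4 nr] := phi_index mN.
  by rewrite phiE dot_normalize // gs_family_neq0.
have [e|/eqP ne] := eqVneq (m %% 4)%N (n %% 4)%N; last first.
  exact: eigvec_orth ne (eigvec_phi mN) (eigvec_phi nN).
rewrite !phiE e dotZl dotZr gs_orth ?mulr0 //; apply: contra_neq mn => e'.
by rewrite (divn_eq m 4) (divn_eq n 4) e e'.
Qed.

End Basis.

(** * Hermite polynomials and Gaussian moments *)

Section HermitePolynomials.
Variable R : realType.
Implicit Types (p q : {poly R}) (n : nat).

Fixpoint moment n : R :=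
  match n with
  | 0 => Num.sqrt pi
  | 1 => 0
  | m.+2 => m.+1%:R / 2 * moment m
  end.

(** The integral of [p (x) exp (- x^2)] over the real line, given by the moments;
    the identification with a limit of Riemann sums comes later. *)
Definition gint p : R := \sum_(i < size p) p`_i * moment i.

Lemma gintE n p : (size p <= n)%N -> gint p = \sum_(i < n) p`_i * moment i.
Proof.
move=> pn; rewrite /gint (big_ord_widen n (fun i => p`_i * moment i) pn) big_mkcond /=.
apply: eq_bigr => i _; case: ltnP => // h.
by rewrite nth_default // mul0r.
Qed.

Lemma gintD p q : gint (p + q) = gint p + gint q.
Proof.
rewrite (gintE (size_polyD p q)) (gintE (leq_maxl (size p) (size q))).
rewrite (gintE (leq_maxr (size p) (size q))).
by rewrite -big_split; apply: eq_bigr => i _; rewrite coefD mulrDl.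
Qed.

Lemma gintZ a p : gint (a *: p) = a * gint p.
Proof.
rewrite (gintE (size_scale_leq a p)) /gint mulr_sumr.
by apply: eq_bigr => i _; rewrite coefZ mulrA.
Qed.

Lemma gint0 : gint 0 = 0.
Proof. by rewrite -(scale0r 0) gintZ mul0r. Qed.

Lemma gintB p q : gint (p - q) = gint p - gint q.
Proof. by rewrite -scaleN1r gintD gintZ mulN1r. Qed.

Lemma gint1 : gint 1 = Num.sqrt pi.
Proof. by rewrite /gint size_poly1 big_ord1 coef1 mul1r. Qed.

(** Integration by parts against the weight [exp (- x^2)]. *)
Lemma gint_deriv p : gint p^`() = 2 * gint ('X * p).
Proof.
have s1 : (size p^`() <= size p)%N.
  exact: leq_trans (size_poly _ _) (leq_pred _).
have s2 : (size ('X * p)%R <= (size p).+2)%N.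
  by rewrite (leq_trans (size_polyMleq _ _)) // size_polyX.
rewrite (gintE s1) (gintE s2) big_ord_recl coefXM mul0r add0r big_ord_recl /=.
rewrite coefXM /= mulr0 add0r mulr_sumr; apply: eq_bigr => i _.
rewrite coef_deriv coefXM /= -mulr_natr; by field.
Qed.

Fixpoint hpoly n : {poly R} :=
  if n is m.+1 then 2 *: ('X * hpoly m) - (hpoly m)^`() else 1.

(** Rodrigues: each factor of the recurrence is one integration by parts. *)
Lemma gint_hpolyM n q : gint (hpoly n * q) = gint q^`(n).
Proof.
elim: n q => [|n IH] q; first by rewrite mul1r derivn0.
have -> : hpoly n.+1 * q = 2 *: ('X * (hpoly n * q)) - (hpoly n * q)^`() + hpoly n * q^`().
  by rewrite derivM /= -!mul_polyC; ring.
by rewrite gintD gintB gintZ gint_deriv subrr add0r IH -derivSn.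
Qed.

Lemma size_hpoly_lead n : (size (hpoly n) <= n.+1)%N /\ (hpoly n)`_n = 2 ^+ n.
Proof.
elim: n => [|n [sH cH]]; first by rewrite size_poly1 coef1 expr0.
have sD : (size (hpoly n)^`() <= n.+1)%N.
  by rewrite (leq_trans (size_poly _ _)) // (leq_trans (leq_pred _)).
split.
  rewrite /= (leq_trans (size_polyD _ _)) // size_polyN geq_max.
  rewrite (leq_trans (size_scale_leq _ _)) /=; last first.
    by rewrite (leq_trans (size_polyMleq _ _)) // size_polyX.
  exact: leqW.
by rewrite /= coefB coefZ coefXM /= cH [X in _ - X]nth_default // subr0 -exprS.
Qed.

Lemma gint_hpoly_small n q : (size q <= n)%N -> gint (hpoly n * q) = 0.
Proof. by move=> qn; rewrite gint_hpolyM derivn_poly0 // gint0. Qed.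

Lemma gint_hpoly_sqr n : gint (hpoly n * hpoly n) = 2 ^+ n * n`!%:R * Num.sqrt pi.
Proof.
have [sH cH] := size_hpoly_lead n.
rewrite gint_hpolyM -gint1 -gintZ; congr gint; apply/polyP => i.
rewrite coef_derivn coefZ coef1; case: i => [|i].
  by rewrite addn0 cH ffactnn mulr1 mulr_natr.
by rewrite nth_default ?mul0rn ?mulr0 //; rewrite (leq_trans sH) // addnS ltnS leq_addr.
Qed.

Definition hnorm n : R := (Num.sqrt pi * 2 ^+ n * n`!%:R) `^ (- 2^-1).
(** The Hermite function of order [n] divided by [exp (- x^2 / 2)]. *)
Definition hermite_poly n : {poly R} := hnorm n *: hpoly n.

Lemma hnorm_gt0 n : 0 < hnorm n.
Proof.
by rewrite powR_gt0 // !mulr_gt0 ?exprn_gt0 ?ltr0n ?fact_gt0 // sqrtr_gt0 pi_gt0.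
Qed.

Lemma hnorm_sqr n : hnorm n ^+ 2 = (Num.sqrt pi * 2 ^+ n * n`!%:R)^-1.
Proof.
set c := Num.sqrt pi * _ * _.
have c0 : 0 <= c by rewrite !mulr_ge0 ?exprn_ge0 ?ler0n.
by rewrite -powR_mulrn ?powR_ge0 // -powRrM mulNr mulVf ?pnatr_eq0 // powR_inv1.
Qed.

Lemma size_hermite_poly n : (size (hermite_poly n) <= n.+1)%N.
Proof. by rewrite (leq_trans (size_scale_leq _ _)) // (size_hpoly_lead n).1. Qed.

Lemma gint_hermite_poly_sqr n : gint (hermite_poly n * hermite_poly n) = 1.
Proof.
rewrite /hermite_poly -scalerAl -scalerAr scalerA gintZ gint_hpoly_sqr -expr2 hnorm_sqr.
rewrite [X in _ * X](_ : _ = Num.sqrt pi * 2 ^+ n * n`!%:R); last by ring.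
by rewrite mulVf // !mulf_neq0 ?expf_neq0 ?pnatr_eq0 -?lt0n ?fact_gt0 // gt_eqF // sqrtr_gt0 pi_gt0.
Qed.

(** The normalized Hermite polynomials of order less than [n] are an orthonormal
    basis of the polynomials of size at most [n]. *)
Lemma hermite_poly_expansion n q : (size q <= n)%N ->
  q = \sum_(j < n) gint (q * hermite_poly j) *: hermite_poly j.
Proof.
elim: n q => [|n IH] q qn.
  by rewrite big_ord0; apply/eqP; rewrite -size_poly_eq0 -leqn0.
have [sH cH] := size_hpoly_lead n.
pose c := q`_n / 2 ^+ n; pose q' := q - c *: hpoly n.
have q'n : (size q' <= n)%N.
  apply/leq_sizeP => j; rewrite leq_eqVlt => /predU1P[<-|nj].
    by rewrite coefB coefZ cH divfK ?subrr // expf_neq0 // pnatr_eq0.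
  by rewrite coefB coefZ !nth_default ?mulr0 ?subr0 // ?(leq_trans qn) ?(leq_trans sH).
have qE : q = q' + c *: hpoly n by rewrite subrK.
clearbody q'.
rewrite big_ord_recr /= {1}qE (IH _ q'n); congr (_ + _).
  apply: eq_bigr => j _; congr (_ *: _); rewrite qE mulrDl gintD -scalerAl gintZ.
  by rewrite gint_hpoly_small ?mulr0 ?addr0 // (leq_trans (size_hermite_poly j)).
rewrite qE mulrDl gintD [q' * _]mulrC /hermite_poly -!scalerAl !gintZ gint_hpoly_small // mulr0 add0r.
rewrite -scalerAr gintZ gint_hpoly_sqr scalerA; congr (_ *: _).
rewrite [RHS](_ : _ = c * (hnorm n ^+ 2 * (Num.sqrt pi * 2 ^+ n * n`!%:R))); last by ring.
rewrite hnorm_sqr mulVf ?mulr1 //.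
by rewrite !mulf_neq0 ?expf_neq0 ?pnatr_eq0 -?lt0n ?fact_gt0 // gt_eqF // sqrtr_gt0 pi_gt0.
Qed.

(** The difference of the monomial and the scaled Hermite polynomial has lower
    degree, and the Hermite polynomial is orthogonal to lower degrees. *)
Lemma hpoly_gram_schmidt n :
  'X^n - \sum_(j < n) gint ('X^n * hermite_poly j) *: hermite_poly j = 2 ^- n *: hpoly n.
Proof.
have [sH cH] := size_hpoly_lead n.
pose q := 'X^n - 2 ^- n *: hpoly n.
have qn : (size q <= n)%N.
  apply/leq_sizeP => j; rewrite leq_eqVlt => /predU1P[<-|nj].
    by rewrite coefB coefZ cH coefXn eqxx mulVf ?subrr // expf_neq0 // pnatr_eq0.
  rewrite coefB coefZ coefXn gtn_eqF // nth_default ?mulr0 ?subr0 //.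
  exact: leq_trans sH nj.
rewrite [X in _ - X](_ : _ = q); first by rewrite /q subKr.
rewrite [RHS](hermite_poly_expansion qn); apply: eq_bigr => j _; congr (_ *: _).
rewrite /q mulrBl gintB -scalerAl gintZ gint_hpoly_small ?mulr0 ?subr0 //.
by rewrite (leq_trans (size_hermite_poly j)).
Qed.

Lemma is_derive_horner p (x : R) : is_derive x 1 (horner p) p^`().[x].
Proof.
elim/poly_ind: p => [|p c IH].
  have -> : horner (0 : {poly R}) = cst 0 by apply/funext => y; rewrite horner0.
  by rewrite deriv0 horner0; exact: is_derive_cst.
have -> : horner (p * 'X + c%:P) = horner p * id + cst c.
  by apply/funext => y; rewrite !hornerE.
apply: is_derive_eq; rewrite derivD derivM derivX derivC !hornerE.
by rewrite /GRing.scale /=; ring.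
Qed.

Lemma is_derive_gauss p (x : R) :
  is_derive x 1 (fun t => p.[t] * expR (- t ^+ 2))
    ((p^`() - 2 *: ('X * p)).[x] * expR (- x ^+ 2)).
Proof.
have h := is_derive_horner p x.
apply: is_derive_eq; rewrite !hornerE /GRing.scale /=.
ring.
Qed.

(** Differentiating [hpoly n] times the Gaussian applies the recurrence of the
    Hermite polynomials, up to sign. *)
Lemma derive1n_gauss n :
  derive1n n (fun t : R => expR (- t ^+ 2)) =
  (fun t => (-1) ^+ n * ((hpoly n).[t] * expR (- t ^+ 2))).
Proof.
elim: n => [|n IH]; first by apply/funext => t; rewrite /= hornerC ?expr0 !mul1r.
rewrite derive1nS IH; apply/funext => t; rewrite derive1E.
have h := is_derive_gauss (hpoly n) t.
rewrite derive_val.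
by rewrite [(-1) ^+ n.+1]exprS /GRing.scale /= !(hornerD, hornerN, hornerZ, hornerM, hornerX); ring.
Qed.

Lemma hermiteE n (x : R) : hermite n x = (hermite_poly n).[x] * expR (- (x ^+ 2 / 2)).
Proof.
rewrite /hermite derive1n_gauss /hermite_poly hornerZ.
have -> : expR (- (x ^+ 2 / 2)) = expR (x ^+ 2 / 2) * expR (- x ^+ 2).
  by rewrite -expRD; congr expR; field.
have e : (-1) ^+ n * (-1) ^+ n = 1 :> R by rewrite -exprMn mulrNN mulr1 expr1n.
set r := RHS; rewrite -[r]mul1r -[X in X * r]e /r -/(hnorm n).
by move: (hnorm n) (expR _) (expR _) => a b c; ring.
Qed.

End HermitePolynomials.

(** * Elementary bounds *)

Section GaussianBounds.
Variable R : realType.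
Implicit Types (x y t : R) (p q : {poly R}) (m n : nat).

(** Bound [1 + y] by [exp y] and complete the square. *)
Lemma expXn_gauss_bound m (c : R) : 0 < c ->
  exists2 C : R, 0 < C & forall y, 0 <= y -> (1 + y) ^+ m * expR (- (c * y ^+ 2)) <= C.
Proof.
move=> c0; exists (expR (m%:R ^+ 2 / (4 * c))); first exact: expR_gt0.
move=> y y0; apply: (@le_trans _ _ (expR (m%:R * y) * expR (- (c * y ^+ 2)))).
  rewrite ler_wpM2r ?expR_ge0 // expRM_natl lerXn2r ?nnegrE ?expR_ge0 ?expR_ge1Dx //.
  exact: addr_ge0.
rewrite -expRD ler_expR -subr_ge0.
have -> : m%:R ^+ 2 / (4 * c) - (m%:R * y + - (c * y ^+ 2)) = (m%:R - 2 * c * y) ^+ 2 / (4 * c).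
  by field; rewrite gt_eqF.
by rewrite divr_ge0 ?sqr_ge0 // mulr_ge0 // ltW.
Qed.

Lemma expXn_gauss_tail m (c e : R) : 0 < c -> 0 < e ->
  exists2 X : R, 0 < X & forall y, X <= y -> (1 + y) ^+ m * expR (- (c * y ^+ 2)) <= e.
Proof.
move=> c0 e0; have [C C0 HC] := expXn_gauss_bound m.+1 c0.
exists (C / e) => [|y yX]; first exact: divr_gt0.
have y0 : 0 < y by apply: lt_le_trans yX; exact: divr_gt0.
have y1 : 0 < 1 + y by rewrite ltr_wpDl.
rewrite -(ler_pM2l y1) mulrA -exprS (le_trans (HC _ (ltW y0))) //.
rewrite -ler_pdivrMr // (le_trans yX) // ler_wpDl //.
Qed.

Lemma horner_growth p : exists C m, 0 < C /\ forall x, `|p.[x]| <= C * (1 + `|x|) ^+ m.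
Proof.
elim/poly_ind: p => [|p c [C [m [C0 H]]]].
  by exists 1, 0%N; split => // x; rewrite horner0 normr0 expr0 mulr1.
exists (C + `|c|), m.+1; split=> [|x]; first by rewrite ltr_pwDl.
rewrite hornerMXaddC (le_trans (ler_normD _ _)) // mulrDl lerD //.
  rewrite normrM exprS mulrCA mulrC ler_pM // ?H //.
  by rewrite lerDr.
rewrite ler_peMr // -[X in X <= _](expr1n _ m.+1) lerXn2r ?nnegrE //.
by rewrite lerDl.
Qed.

Lemma horner_gauss_bound p m (c : R) : 0 < c ->
  exists2 C, 0 < C & forall x, (1 + `|x|) ^+ m * `|p.[x]| * expR (- (c * x ^+ 2)) <= C.
Proof.
move=> c0; have [A [d [A0 HA]]] := horner_growth p.
have [B B0 HB] := expXn_gauss_bound (m + d) c0.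
exists (A * B) => [|x]; first exact: mulr_gt0.
have h : 0 <= 1 + `|x| by rewrite addr_ge0.
rewrite -(real_normK (num_real x)).
apply: (@le_trans _ _ (A * ((1 + `|x|) ^+ (m + d) * expR (- (c * `|x| ^+ 2))))).
  rewrite [leRHS]mulrA ler_wpM2r ?expR_ge0 // exprD mulrCA ler_wpM2l ?exprn_ge0 //.
by rewrite ler_pM2l // HB.
Qed.

Lemma MVT_step (f f' : R -> R) (a e : R) : 0 < e -> (forall x, is_derive x 1 f (f' x)) ->
  exists2 z, a <= z <= a + e & f (a + e) - f a = f' z * e.
Proof.
move=> e0 df; have ae : a < a + e by rewrite ltrDl.
have [z] := @MVT R f f' a (a + e) ae (fun x _ => df x)
  (derivable_within_continuous (fun x _ => @ex_derive _ _ _ _ _ _ _ (df x))).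
rewrite in_itv /= => /andP[/ltW az /ltW ze] ->; exists z; first by rewrite az ze.
by congr (_ * _); ring.
Qed.

Lemma sin_le x : `|sin x| <= `|x|.
Proof.
wlog x0 : x / 0 < x.
  move=> H; have [x0|x0|->] := ltgtP x 0; last by rewrite sin0.
    by have := H (- x); rewrite sinN !normrN oppr_gt0; apply.
  exact: H.
have [z _] := @MVT_step (@sin R) cos 0 x x0 (@is_derive_sin R).
rewrite add0r sin0 subr0 => ->.
by rewrite normrM ler_piMl ?cos_max.
Qed.

Lemma cos_near1 x : `|cos x - 1| <= x ^+ 2.
Proof.
have -> : cos x - 1 = - (2 * sin (x / 2) ^+ 2).
  have -> : cos x = cos ((x / 2) *+ 2) by congr cos; rewrite -mulr_natr; field.
  by rewrite cos_mulr2n cos2sin2 -mulr_natr; ring.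
rewrite normrN ger0_norm; last by rewrite mulr_ge0 // sqr_ge0.
have : sin (x / 2) ^+ 2 <= (x / 2) ^+ 2.
  by rewrite -(real_normK (num_real (sin _))) -[leRHS](real_normK (num_real _))
    lerXn2r ?nnegrE ?sin_le.
have := sqr_ge0 x; have -> : (x / 2) ^+ 2 = x ^+ 2 / 4 by field.
lra.
Qed.

Lemma sin_near_id x : `|sin x - x| <= `|x| ^+ 3.
Proof.
wlog x0 : x / 0 < x.
  move=> H; have [x0|x0|->] := ltgtP x 0; last by rewrite sin0 subrr normr0 expr0n.
    have := H (- x); rewrite sinN -opprD !normrN oppr_gt0; exact.
  exact: H.
have [z /andP[z0 zx]] := @MVT_step (@sin R) cos 0 x x0 (@is_derive_sin R).
rewrite add0r in zx *; rewrite sin0 subr0 => ->.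
rewrite -[X in _ - X]mul1r -mulrBl normrM exprSr ler_wpM2r // (le_trans (cos_near1 _)) //.
by rewrite lerXn2r ?nnegrE // ger0_norm // ltW.
Qed.

End GaussianBounds.

(** * Riemann sums on the nodes *)

Section Nodes.
Variable R : realType.
Implicit Types (x y t : R) (p q : {poly R}) (m n : nat).

Definition node L (i : 'I_(dimN L)) : R := eps R L * (cidx i)%:~R.

Lemma eps_sqr L : eps R L ^+ 2 = 2 * pi / (dimN L)%:R.
Proof. by rewrite sqr_sqrtr // divr_ge0 ?mulr_ge0 ?pi_ge0 ?ler0n. Qed.

Lemma eps_gt0 L : 0 < eps R L.
Proof. by rewrite sqrtr_gt0 divr_gt0 ?mulr_gt0 ?pi_gt0 ?ltr0n. Qed.

Lemma near_ger (e : R) : \forall L \near \oo, e <= L%:R.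
Proof. exact: nbhs_infty_ger. Qed.

Lemma near_eps (e : R) : 0 < e -> \forall L \near \oo, eps R L <= e.
Proof.
move=> e0; near=> L.
rewrite -ler_sqr ?nnegrE ?(ltW (eps_gt0 _)) ?(ltW e0) // eps_sqr.
rewrite ler_pdivrMr ?ltr0n // [leRHS]mulrC -ler_pdivrMr ?exprn_gt0 //.
apply: (@le_trans _ _ L%:R); first by near: L; exact: near_ger.
by rewrite ler_nat; lia.
Unshelve. all: by end_near. Qed.

Lemma near_node_end (X : R) : \forall L \near \oo, X <= eps R L * (2 * L)%:R.
Proof.
near=> L.
have L1 : (1 <= L)%N by near: L; exists 1%N.
apply: (@le_trans _ _ (Num.max X 0)); first by rewrite le_max lexx.
rewrite -ler_sqr ?nnegrE ?le_max ?lexx ?orbT ?mulr_ge0 ?(ltW (eps_gt0 _)) ?ler0n //.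
apply: (@le_trans _ _ L%:R); first by near: L; exact: near_ger.
rewrite exprMn eps_sqr -natrX mulrAC ler_pdivlMr ?ltr0n //.
apply: (@le_trans _ _ (2 * 2 * ((2 * L) ^ 2)%:R)).
  by rewrite -!natrM ler_nat; nia.
rewrite ler_wpM2r ?ler0n // ler_pM2l //; exact: pi_ge2.
Unshelve. all: by end_near. Qed.

(** The bounded function [x / (1 + |x|)] increases on a step of length at most 1 by
    at least half the weight. The alternative holds for consecutive nodes because
    the origin is a node. *)
Lemma node_next_weight x e : 0 < e -> e <= 1 -> 0 <= x \/ x + e <= 0 ->
  e / (1 + `|x|) ^+ 2 <= 2 * ((x + e) / (1 + `|x + e|) - x / (1 + `|x|)).
Proof.
move=> e0 e1 [x0|x0].
  have xe : 0 <= x + e by rewrite addr_ge0 // ltW.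
  rewrite !ger0_norm //.
  have a0 : 0 < 1 + x by rewrite ltr_wpDr.
  have b0 : 0 < 1 + (x + e) by rewrite ltr_wpDr.
  have -> : (x + e) / (1 + (x + e)) - x / (1 + x) = e / ((1 + x) * (1 + (x + e))).
    by field; rewrite !gt_eqF.
  rewrite mulrCA ler_pM2l // ler_pdivlMr ?mulr_gt0 // mulrC ler_pdivrMr ?exprn_gt0 //.
  by rewrite mulrC expr2; nra.
have xn : x <= 0 by lra.
rewrite !ler0_norm //.
have a0 : 0 < 1 - x by lra.
have b0 : 0 < 1 - (x + e) by lra.
have -> : (x + e) / (1 - (x + e)) - x / (1 - x) = e / ((1 - x) * (1 - (x + e))).
  by field; rewrite !gt_eqF.
rewrite mulrCA ler_pM2l // ler_pdivlMr ?mulr_gt0 // mulrC ler_pdivrMr ?exprn_gt0 //.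
by rewrite mulrC expr2; nra.
Qed.

(** A bound for all large [L] on the total weight, so that errors of order
    [(1 + |x|)^-2] are harmless in Riemann sums. *)
Lemma node_weight_sum L : eps R L <= 1 ->
  eps R L * \sum_(i < dimN L) (1 + `|node i|) ^- 2 <= 4.
Proof.
move=> e1; pose x n : R := eps R L * (n%:R - (2 * L)%:R).
pose g n := x n / (1 + `|x n|).
have xS n : x n.+1 = x n + eps R L by rewrite /x -natr1; ring.
apply: (@le_trans _ _ (\sum_(i < dimN L) 2 * (g i.+1 - g i))).
  rewrite mulr_sumr; apply: ler_sum => i _.
  have -> : node i = x i by rewrite /node /x /cidx intrB.
  rewrite /g xS; apply: node_next_weight => //; first exact: eps_gt0.
  have [h|h] := leqP (2 * L) i; [left|right].
    by rewrite mulr_ge0 ?(ltW (eps_gt0 _)) // subr_ge0 ler_nat.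
  by rewrite -xS pmulr_rle0 ?eps_gt0 // subr_le0 ler_nat.
rewrite -mulr_sumr -(big_mkord xpredT (fun n => g n.+1 - g n)) telescope_sumr //.
have gb n : `|g n| <= 1.
  rewrite normf_div [`|1 + _|]ger0_norm ?addr_ge0 // ler_pdivrMr ?mul1r.
    by rewrite lerDr.
  by rewrite ltr_wpDr.
have := gb (dimN L); have := gb 0%N; rewrite !ler_norml => /andP[? ?] /andP[? ?].
lra.
Qed.

(** Riemann sums of a derivative: each step is compared with the mean value
    theorem, and the errors are summable. *)
Lemma riemann_gauss q (G : R -> R) :
  (forall x, is_derive x 1 G (q.[x] * expR (- x ^+ 2))) ->
  (fun L => eps R L * (\sum_(i < dimN L) q.[node i] * expR (- node i ^+ 2))
    - (G (eps R L * (2 * L).+1%:R) - G (- (eps R L * (2 * L)%:R)))) @ \oo --> (0 : R).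
Proof.
move=> dG; pose r := q^`() - 2 *: ('X * q).
have [C C0 HC] := horner_gauss_bound r 2 (ltr01 : 0 < 1).
have step x e : 0 < e -> e <= 1 ->
    `|q.[x] * expR (- x ^+ 2) * e - (G (x + e) - G x)| <= 4 * C * e * (e / (1 + `|x|) ^+ 2).
  move=> e0 e1; have [z /andP[xz ze] ->] := MVT_step x e0 dG.
  rewrite -mulrBl normrM (gtr0_norm e0) [leRHS]mulrAC ler_pM2r //.
  have [->|xz'] := eqVneq z x.
    by rewrite subrr normr0 !mulr_ge0 ?invr_ge0 ?exprn_ge0 ?addr_ge0 ?(ltW C0) ?(ltW e0).
  have zx : 0 < z - x by rewrite subr_gt0 lt_def xz' xz.
  have [w /andP[xw wz]] := MVT_step x zx (is_derive_gauss q).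
  rewrite addrC subrK in wz *; rewrite -normrN opprB => ->.
  rewrite -/r normrM (gtr0_norm zx) [leRHS](_ : _ = 4 * C / (1 + `|x|) ^+ 2 * e); last by ring.
  apply: ler_pM => //; [exact: ltW|idtac|by move: ze xz; clear; lra].
  have := HC w; rewrite mul1r normrM (ger0_norm (expR_ge0 _)).
  have W0 : 0 < 1 + `|w| by rewrite ltr_wpDr.
  have X0 : 0 < 1 + `|x| by rewrite ltr_wpDr.
  have XW : 1 + `|x| <= 2 * (1 + `|w|).
    have : `|x| <= `|w| + `|x - w| by rewrite -{1}(subrK w x) addrC ler_normD.
    have : `|x - w| <= 1 by rewrite distrC ger0_norm ?subr_ge0 //; lra.
    by have := normr_ge0 w; lra.
  move: (`|r.[w]|) (normr_ge0 r.[w]) (expR _) (expR_ge0 (- w ^+ 2)) => A A0 B B0 h.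
  apply: (@le_trans _ _ (C / (1 + `|w|) ^+ 2)).
    by rewrite ler_pdivlMr ?exprn_gt0 // mulrC mulrA.
  have X2 : (1 + `|x|) ^+ 2 <= 4 * (1 + `|w|) ^+ 2.
    have -> : 4 * (1 + `|w|) ^+ 2 = (2 * (1 + `|w|)) ^+ 2 by ring.
    by rewrite lerXn2r ?nnegrE ?mulr_ge0 ?(ltW X0) ?(ltW W0).
  rewrite ler_pdivrMr ?exprn_gt0 // [leRHS]mulrAC ler_pdivlMr ?exprn_gt0 //.
  by rewrite [leRHS](_ : _ = C * (4 * (1 + `|w|) ^+ 2)) ?ler_pM2l //; ring.
apply/cvgrPdist_le => e e0; near=> L.
have e1 : eps R L <= 1 by near: L; exact: near_eps.
have eC : eps R L <= e / (16 * C).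
  by near: L; apply: near_eps; rewrite divr_gt0 ?mulr_gt0.
rewrite sub0r normrN.
pose x n : R := eps R L * (n%:R - (2 * L)%:R).
have xS n : x n.+1 = x n + eps R L by rewrite /x -natr1; ring.
have -> : G (eps R L * (2 * L).+1%:R) - G (- (eps R L * (2 * L)%:R)) =
    \sum_(i < dimN L) (G (x i.+1) - G (x i)).
  rewrite -(big_mkord xpredT (fun n => G (x n.+1) - G (x n))) telescope_sumr //.
  rewrite /x; congr (G _ - G _); last by ring.
  by congr (_ * _); rewrite -natrB; [congr (_%:R)|]; lia.
rewrite mulr_sumr -sumrB (le_trans (ler_norm_sum _ _ _)) //.
apply: (@le_trans _ _ (\sum_(i < dimN L) 4 * C * eps R L * (eps R L * (1 + `|node i|) ^- 2))).
  apply: ler_sum => i _; have -> : node i = x i by rewrite /node /x /cidx intrB.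
  by rewrite xS mulrC; apply: step => //; exact: eps_gt0.
rewrite -!mulr_sumr; apply: (@le_trans _ _ (4 * C * eps R L * 4)).
  by rewrite ler_pM2l ?node_weight_sum // !mulr_gt0 ?eps_gt0.
by move: eC; rewrite ler_pdivlMr ?mulr_gt0 //; lra.
Unshelve. all: by end_near. Qed.

End Nodes.

(** * A primitive of the Gaussian *)

Section GaussPrimitive.
Variable R : realType.
Local Notation mu := (@lebesgue_measure R).

Lemma cvg_integral0_gauss :
  @gauss_integral_proof.integral0_gauss R x @[x --> +oo] --> Num.sqrt pi / 2.
Proof.
have : Num.sqrt (@gauss_integral_proof.integral0_gauss R x ^+ 2) @[x --> +oo]
    --> Num.sqrt (pi / 4).
  apply: continuous_cvg; first exact: sqrt_continuous.
  exact: gauss_integral_proof.cvg_integral0_gauss_sqr.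
rewrite sqrtrM ?pi_ge0 // sqrtrV // (_ : 4 = 2 ^+ 2); last by rewrite expr2 -natrM.
rewrite sqrtr_sqr ger0_norm // => h; apply: cvg_trans h; apply: near_eq_cvg.
near=> x; rewrite sqrtr_sqr ger0_norm //.
exact: gauss_integral_proof.integral0_gauss_ge0.
Unshelve. all: by end_near. Qed.

(** The integral from minus infinity is differentiable everywhere; subtracting its
    value at 0 makes it odd, which gives the limit on the left from the one on the
    right. *)
Lemma gauss_primitive : exists G : R -> R,
  [/\ forall x : R, is_derive x 1 G (expR (- x ^+ 2)),
      G x @[x --> +oo] --> Num.sqrt pi / 2 &
      G (- x) @[x --> +oo] --> - (Num.sqrt pi / 2)].
Proof.
pose F x := (\int[mu]_(t in `]-oo, x]) gauss_fun t)%R.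
have dF (x : R) : is_derive x 1 F (expR (- x ^+ 2)).
  have [||//||d e] := @continuous_FTC1 R gauss_fun -oo%O x (x + 1) _ _ _ _.
  - by rewrite ltrDl.
  - by apply: (integrableS _ _ _ integrableT_gauss) => //; exact: measurable_itv.
  - by rewrite ltNyr.
  - exact: continuous_gauss_fun.
  - by apply: DeriveDef; [exact: d|rewrite -derive1E e].
have cF x : {for x, continuous F}.
  by apply/differentiable_continuous/derivable1_diffP; have [] := dF x.
pose G x := F x - F 0.
have dG (x : R) : is_derive x 1 G (expR (- x ^+ 2)).
  by have h := dF x; apply: is_derive_eq; rewrite subr0.
have oddG x : G (- x) = - G x.
  pose S x := F x + F (- x).
  have dS (y : R) : is_derive y 1 S 0.
    have h := dF y; have h' := dF (- y).
    apply: is_derive_eq.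
    by rewrite sqrrN mulrN1 subrr.
  have := is_derive_0_is_cst x 0 dS; rewrite /S /G oppr0 => e.
  lra.
have cvgG : G x @[x --> +oo] --> Num.sqrt pi / 2.
  apply: cvg_trans cvg_integral0_gauss; apply: near_eq_cvg; near=> x.
  have x0 : 0 < x by near: x; exact: nbhs_pinfty_gt.
  rewrite /gauss_integral_proof.integral0_gauss /Rintegral.
  rewrite (@continuous_FTC2 R _ F 0 x x0) //.
  - by apply: continuous_subspaceT => z; exact: continuous_gauss_fun.
  - split; [by move=> z _; have [] := dF z| |].
      by apply: cvg_at_right_filter; exact: cF.
    by apply: cvg_at_left_filter; exact: cF.
  - by move=> z _; rewrite derive1E; have [] := dF z.
exists G; split=> //.
have -> : (fun x => G (- x)) = (fun x => - G x) by apply/funext.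
exact: cvgN.
Unshelve. all: by end_near. Qed.
End GaussPrimitive.

(** * Limits of Gaussian Riemann sums *)

Section Convergence.
Variable R : realType.
Implicit Types (x y t : R) (p q : {poly R}) (m n : nat).
Local Notation family_of_values := (forall L, 'I_(dimN L) -> R).
Implicit Types (a b : family_of_values).

Local Notation weight i := (1 + `|node R i|).

Lemma cvg_node_end (c : nat -> nat) : (forall L, (2 * L <= c L)%N) ->
  eps R L * (c L)%:R @[L --> \oo] --> +oo.
Proof.
move=> hc; apply/cvgryPge => A; near=> L.
apply: (@le_trans _ _ (eps R L * (2 * L)%:R)); first by near: L; exact: near_node_end.
by rewrite ler_pM2l ?eps_gt0 // ler_nat.
Unshelve. all: by end_near. Qed.

Definition rsum q L : R :=
  eps R L * \sum_(i < dimN L) q.[node R i] * expR (- node R i ^+ 2).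

Lemma rsum_primitive q (G : R -> R) (l1 l2 : R) :
  (forall x, is_derive x 1 G (q.[x] * expR (- x ^+ 2))) ->
  G x @[x --> +oo] --> l1 -> G (- x) @[x --> +oo] --> l2 ->
  rsum q @ \oo --> l1 - l2.
Proof.
move=> dG G1 G2; have := riemann_gauss dG.
have E1 := cvg_comp _ _ (@cvg_node_end (fun L => (2 * L).+1) (fun L => leqnSn _)) G1.
have E2 := cvg_comp _ _ (@cvg_node_end (fun L => (2 * L)%N) (fun L => leqnn _)) G2.
move=> E; rewrite -[l1 - l2]add0r.
have -> : rsum q = (fun L => (eps R L * (\sum_(i < dimN L) q.[node R i] * expR (- node R i ^+ 2))
    - (G (eps R L * (2 * L).+1%:R) - G (- (eps R L * (2 * L)%:R))))
    + (G (eps R L * (2 * L).+1%:R) - G (- (eps R L * (2 * L)%:R)))).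
  by apply/funext => L; rewrite subrK.
by apply: cvgD; [exact: E|apply: cvgB; [exact: E1|exact: E2]].
Qed.

Lemma horner_gauss_cvg0 p : p.[x] * expR (- x ^+ 2) @[x --> +oo] --> (0 : R).
Proof.
have [C C0 HC] := @horner_gauss_bound R p 1 1 ltr01.
apply/cvgr0Pnorm_le => e e0; near=> x.
have xe : C / e <= x by near: x; apply: nbhs_pinfty_ge; exact: num_real.
have x0 : 0 < x by rewrite (lt_le_trans _ xe) // divr_gt0.
have := HC x; rewrite expr1 mul1r (gtr0_norm x0) normrM (ger0_norm (expR_ge0 _)) -mulrA.
move=> h; rewrite -(ler_pM2l (_ : 0 < 1 + x)) ?ltr_wpDl // (le_trans h) //.
by rewrite -ler_pdivrMr // (le_trans xe) // lerDr.
Unshelve. all: by end_near. Qed.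

(** The sampled function is the derivative of [p (x) exp (- x^2)], which vanishes at
    both ends. *)
Lemma rsum_parts p : rsum (p^`() - 2 *: ('X * p)) @ \oo --> (0 : R).
Proof.
rewrite -(subrr 0); apply: rsum_primitive.
- exact: is_derive_gauss.
- exact: horner_gauss_cvg0.
have -> : (fun x : R => p.[- x] * expR (- (- x) ^+ 2)) =
          (fun x => (p \Po (- 'X)).[x] * expR (- x ^+ 2)).
  by apply/funext => x; rewrite horner_comp hornerN hornerX sqrrN.
exact: horner_gauss_cvg0.
Qed.

Lemma rsumD p q L : rsum (p + q) L = rsum p L + rsum q L.
Proof.
rewrite /rsum -mulrDr -big_split; congr (_ * _); apply: eq_bigr => i _.
by rewrite hornerD mulrDl.
Qed.

Lemma rsumZ c p L : rsum (c *: p) L = c * rsum p L.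
Proof.
rewrite /rsum [RHS]mulrCA [in RHS]mulr_sumr; congr (_ * _); apply: eq_bigr => i _.
by rewrite hornerZ mulrA.
Qed.

Lemma rsum_Xn n : rsum 'X^n @ \oo --> (moment R n : R).
Proof.
suff [] : (rsum 'X^n @ \oo --> (moment R n : R)) /\ (rsum 'X^(n.+1) @ \oo --> (moment R n.+1 : R)) by [].
elim: n => [|n [IH0 IH1]]; split=> //.
- have [G [dG G1 G2]] := gauss_primitive R.
  rewrite expr0 /= -[X in _ --> X](_ : Num.sqrt pi / 2 - - (Num.sqrt pi / 2) = _); last by field.
  apply: (rsum_primitive _ G1 G2) => x; rewrite hornerC mul1r; exact: dG.
- have -> : rsum 'X^1 = (fun L => - 2^-1 * rsum (1^`() - 2 *: ('X * 1)) L).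
    apply/funext => L; rewrite mulr1 derivC sub0r -scaleNr rsumZ expr1.
    by rewrite mulrA mulrNN mulVf ?mul1r ?pnatr_eq0.
  by have := cvgMl_tmp (a := - 2^-1) (@rsum_parts 1); rewrite mulr0; exact.
have -> : rsum 'X^(n.+2) = (fun L => 2^-1 *
    (n.+1%:R * rsum 'X^n L - rsum ('X^(n.+1)^`() - 2 *: ('X * 'X^(n.+1))) L)).
  apply/funext => L.
  have -> : 'X^(n.+1)^`() - 2 *: ('X * 'X^(n.+1)) = n.+1%:R *: 'X^n + (- 2) *: 'X^(n.+2) :> {poly R}.
    by rewrite derivXn -exprS (scaler_nat n.+1) scaleNr.
  rewrite rsumD !rsumZ.
  by field.
have := cvgMl_tmp (a := 2^-1) (cvgB (cvgMl_tmp (a := n.+1%:R) IH0) (@rsum_parts 'X^(n.+1))).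
rewrite (_ : 2^-1 * (n.+1%:R * moment R n - 0) = moment R n.+2); last by rewrite /=; field.
exact.
Qed.

Lemma cvg_sum_ord n (f : nat -> nat -> R) (l : nat -> R) :
  (forall i, f i @ \oo --> l i) ->
  (fun L => \sum_(i < n) f i L) @ \oo --> \sum_(i < n) l i.
Proof.
move=> h; elim: n => [|n IH].
  rewrite big_ord0 (_ : (fun _ => _) = cst 0); first exact: cvg_cst.
  by apply/funext => L; rewrite big_ord0.
rewrite big_ord_recr /=.
rewrite (_ : (fun _ => _) = (fun L => \sum_(i < n) f i L + f n L)).
  by apply: cvgD => //; exact: h.
by apply/funext => L; rewrite big_ord_recr.
Qed.

Lemma rsum_cvg q : rsum q @ \oo --> gint q.
Proof.
rewrite /gint.
have -> : rsum q = (fun L => \sum_(i < size q) q`_i * rsum 'X^i L).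
  apply/funext => L; rewrite -[q in LHS]coefK poly_def /rsum.
  under eq_bigr do rewrite horner_sum mulr_suml.
  rewrite exchange_big mulr_sumr; apply: eq_bigr => i _.
  rewrite [RHS]mulrCA [in RHS]mulr_sumr; congr (_ * _).
  by apply: eq_bigr => j _; rewrite hornerZ mulrA.
by apply: (@cvg_sum_ord _ (fun i L => q`_i * rsum 'X^i L) (fun i => q`_i * moment R i)) => i; apply: cvgMl_tmp; exact: rsum_Xn.
Qed.

End Convergence.

(** * Convergence of sampled functions to a polynomial times the Gaussian *)

Section GaussianConvergence.
Variable R : realType.
Implicit Types (x y t : R) (p q : {poly R}) (m n : nat).
Implicit Types (a b : forall L, 'I_(dimN L) -> R).

Local Notation weight i := (1 + `|node R i|).
Local Notation gauss x := (expR (- (x ^+ 2 / 2))).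

(** Uniform convergence against every polynomial weight: it allows multiplication by
    functions of polynomial growth, and it makes Riemann sums converge. *)
Definition gcvg a p := forall m (e : R), 0 < e -> \forall L \near \oo,
  forall i : 'I_(dimN L), weight i ^+ m * `|a L i - p.[node R i] * gauss (node R i)| <= e.

(** Uniform convergence up to some polynomial weight, suitable for multipliers such
    as sampled sines, which are close to [x] only for moderate [x]. *)
Definition pcvg b q := exists m, forall e : R, 0 < e -> \forall L \near \oo,
  forall i : 'I_(dimN L), `|b L i - q.[node R i]| <= e * weight i ^+ m.

Lemma weight_ge1 L (i : 'I_(dimN L)) : 1 <= weight i.
Proof. by rewrite lerDl. Qed.

Lemma weight_ge0 L (i : 'I_(dimN L)) : 0 <= weight i.
Proof. exact: le_trans (weight_ge1 i). Qed.

Lemma weightX_ge0 L (i : 'I_(dimN L)) m : 0 <= weight i ^+ m.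
Proof. by rewrite exprn_ge0 // weight_ge0. Qed.

Lemma weightX_homo L (i : 'I_(dimN L)) m n : (m <= n)%N -> weight i ^+ m <= weight i ^+ n.
Proof. by move=> mn; rewrite ler_weXn2l // weight_ge1. Qed.

Lemma gcvg_ext a b p : (\forall L \near \oo, a L =1 b L) -> gcvg a p -> gcvg b p.
Proof.
move=> ab ha m e e0; near=> L.
have h1 : a L =1 b L by near: L.
by move=> i; rewrite -h1; move: i; near: L; exact: ha.
Unshelve. all: by end_near. Qed.

Lemma pcvgD b c p q : pcvg b p -> pcvg c q -> pcvg (fun L i => b L i + c L i) (p + q).
Proof.
move=> [m hb] [n hc]; exists (maxn m n) => e e0.
have e2 : 0 < e / 2 by rewrite divr_gt0.
near=> L.
have h1 : forall i : 'I_(dimN L), `|b L i - p.[node R i]| <= e / 2 * weight i ^+ m.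
  by near: L; exact: hb.
have h2 : forall i : 'I_(dimN L), `|c L i - q.[node R i]| <= e / 2 * weight i ^+ n.
  by near: L; exact: hc.
move=> i; have {}h1 := h1 i; have {}h2 := h2 i.
rewrite hornerD opprD addrACA (le_trans (ler_normD _ _)) //.
rewrite [e in e * _](splitr e) mulrDl lerD //.
  by rewrite (le_trans h1) // ler_pM2l // weightX_homo // leq_maxl.
by rewrite (le_trans h2) // ler_pM2l // weightX_homo // leq_maxr.
Unshelve. all: by end_near. Qed.

Lemma pcvgM b c p q : pcvg b p -> pcvg c q -> pcvg (fun L i => b L i * c L i) (p * q).
Proof.
move=> [m hb] [n hc].
have [A [k [A0 HA]]] := horner_growth p; have [B [l [B0 HB]]] := horner_growth q.
exists (m + n + k + l)%N => e e0.
pose d := Num.min 1 (e / (1 + A + B)).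
have D0 : 0 < 1 + A + B by rewrite !addr_gt0.
have d0 : 0 < d by rewrite lt_min ltr01 divr_gt0.
near=> L.
have h1 : forall i : 'I_(dimN L), `|b L i - p.[node R i]| <= d * weight i ^+ m.
  by near: L; exact: hb.
have h2 : forall i : 'I_(dimN L), `|c L i - q.[node R i]| <= d * weight i ^+ n.
  by near: L; exact: hc.
move=> i; have {}h1 := h1 i; have {}h2 := h2 i.
set x := node R i in h1 h2 *.
have -> : b L i * c L i - (p * q).[x] =
  (b L i - p.[x]) * (c L i - q.[x]) + (b L i - p.[x]) * q.[x] + p.[x] * (c L i - q.[x]).
  by rewrite hornerM; ring.
set W := 1 + `|x| in h1 h2 *.
have W1 : 1 <= W by rewrite lerDl.
have Wk j : 0 <= W ^+ j by rewrite exprn_ge0 // (le_trans _ W1).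
have WW j j' : (j <= j')%N -> W ^+ j <= W ^+ j' by move=> jj; rewrite ler_weXn2l.
have dd : d * d <= d by rewrite ler_piMr ?(ltW d0) // ge_min lexx.
have dE : d * (1 + A + B) <= e by rewrite -ler_pdivlMr // ge_min lexx orbT.
apply: (@le_trans _ _ (d * (1 + B + A) * W ^+ (m + n + k + l))); last first.
  by rewrite ler_wpM2r // addrAC.
set V := W ^+ (m + n + k + l).
rewrite [leRHS](_ : _ = d * V + d * B * V + d * A * V); last by ring.
apply: (le_trans (ler_normD _ _)); apply: lerD.
  apply: (le_trans (ler_normD _ _)); apply: lerD.
  - rewrite normrM (le_trans (ler_pM _ _ h1 h2)) // mulrACA -exprD.
  by apply: ler_pM => //; [by apply: mulr_ge0; exact: ltW|apply: WW; clear; lia].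
  - rewrite normrM (le_trans (ler_pM _ _ h1 (HB x))) // mulrACA -exprD.
  by apply: ler_pM => //; [by apply: mulr_ge0; exact: ltW|apply: WW; clear; lia].
rewrite normrM (le_trans (ler_pM _ _ (HA x) h2)) // mulrACA -exprD [A * d]mulrC.
  by apply: ler_pM => //; [by apply: mulr_ge0; exact: ltW|apply: WW; clear; lia].
Unshelve. all: by end_near. Qed.

Lemma pcvg_cst (c : nat -> R) (l : R) : c @ \oo --> l -> pcvg (fun L _ => c L) l%:P.
Proof.
move=> cl; exists 0%N => e e0; near=> L => i.
rewrite hornerC expr0 mulr1 distrC; near: L.
by move/cvgrPdist_le : cl; apply.
Unshelve. all: by end_near. Qed.

Lemma weighted_bound (w v s t e K : R) : 0 <= w -> 0 <= t -> 0 <= e ->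
  s <= e * v -> w * v * t <= K -> w * (s * t) <= e * K.
Proof.
move=> w0 t0 e0 sv wK; apply: (@le_trans _ _ (e * (w * v * t))); last exact: ler_wpM2l.
have -> : e * (w * v * t) = w * (e * v * t) by ring.
by rewrite ler_wpM2l // ler_wpM2r.
Qed.

Lemma gcvgM b a p q : pcvg b q -> gcvg a p -> gcvg (fun L i => b L i * a L i) (q * p).
Proof.
move=> [d hb] ha m e e0.
have [A [k [A0 HA]]] := horner_growth q.
have [C C0 HC] := @horner_gauss_bound R p (m + d) 2^-1 (ltac:(by rewrite invr_gt0)).
(* The product is expanded around the limits into three terms, of total size e1 + e1 C + A e2 = e. *)
pose e1 := e / (2 * (1 + C)); pose e2 := e / (2 * A).
have e10 : 0 < e1 by rewrite divr_gt0 // mulr_gt0 // addr_gt0.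
have e20 : 0 < e2 by rewrite divr_gt0 // mulr_gt0.
near=> L.
have h1 : forall i : 'I_(dimN L), `|b L i - q.[node R i]| <= e1 * weight i ^+ d.
  by near: L; exact: hb.
have h2 : forall i : 'I_(dimN L), weight i ^+ (m + d) * `|a L i - p.[node R i] * gauss (node R i)| <= 1.
  by near: L; exact: ha.
have h3 : forall i : 'I_(dimN L), weight i ^+ (m + k) * `|a L i - p.[node R i] * gauss (node R i)| <= e2.
  by near: L; exact: ha.
move=> i; have {}h1 := h1 i; have {}h2 := h2 i; have {}h3 := h3 i.
set x := node R i in h1 h2 h3 *.
have {HC} := HC x; rewrite [2^-1 * _]mulrC.
set W := 1 + `|x| in h1 h2 h3 *; set E := gauss x in h2 h3 * => HC.
have E0 : 0 <= E by exact: expR_ge0.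
have W0 : 0 <= W by rewrite addr_ge0.
have Wk j : 0 <= W ^+ j by exact: exprn_ge0.
have -> : b L i * a L i - (q * p).[x] * E =
  (b L i - q.[x]) * (a L i - p.[x] * E) + (b L i - q.[x]) * (p.[x] * E) + q.[x] * (a L i - p.[x] * E).
  by rewrite hornerM; ring.
apply: (@le_trans _ _ (e1 * 1 + e1 * C + A * e2)); last first.
  rewrite -mulrDr le_eqVlt; apply/orP; left; apply/eqP.
  by rewrite /e1 /e2; field; rewrite !gt_eqF // addr_gt0.
have q0 := HA x; rewrite -/W in q0.
have tri (X Y Z : R) : `|X + Y + Z| <= `|X| + `|Y| + `|Z|.
  by rewrite (le_trans (ler_normD _ _)) // lerD2r ler_normD.
apply: (le_trans (ler_wpM2l (Wk m) (tri _ _ _))); rewrite 2!mulrDr.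
apply: lerD; first apply: lerD; rewrite normrM.
- by apply: weighted_bound h1 _ => //; [exact: ltW|rewrite -exprD].
- apply: weighted_bound h1 _ => //; first exact: ltW.
  by rewrite -exprD normrM (ger0_norm E0) mulrA.
- by apply: weighted_bound q0 _ => //; [exact: ltW|rewrite -exprD].
Unshelve. all: by end_near. Qed.

Lemma gcvgD a b p q : gcvg a p -> gcvg b q -> gcvg (fun L i => a L i + b L i) (p + q).
Proof.
move=> ha hb m e e0; have e2 : 0 < e / 2 by rewrite divr_gt0.
near=> L.
have h1 : forall i : 'I_(dimN L),
    weight i ^+ m * `|a L i - p.[node R i] * gauss (node R i)| <= e / 2.
  by near: L; exact: ha.
have h2 : forall i : 'I_(dimN L),
    weight i ^+ m * `|b L i - q.[node R i] * gauss (node R i)| <= e / 2.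
  by near: L; exact: hb.
move=> i; rewrite hornerD mulrDl opprD addrACA (splitr e).
apply: (le_trans _ (lerD (h1 i) (h2 i))).
by rewrite -mulrDr; apply: ler_wpM2l; [exact: weightX_ge0|exact: ler_normD].
Unshelve. all: by end_near. Qed.

Lemma gcvgZ (c : nat -> R) (l : R) a p : c @ \oo --> l -> gcvg a p ->
  gcvg (fun L i => c L * a L i) (l *: p).
Proof. by move=> cl ha; rewrite -mul_polyC; exact: gcvgM (pcvg_cst cl) ha. Qed.

Lemma gcvg0 : gcvg (fun _ _ => 0) 0.
Proof.
move=> m e e0; near=> L => i.
by rewrite horner0 mul0r subrr normr0 mulr0 ltW.
Unshelve. all: by end_near. Qed.

Lemma gcvg_sum n (a : nat -> forall L, 'I_(dimN L) -> R) (p : nat -> {poly R}) :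
  (forall j, (j < n)%N -> gcvg (a j) (p j)) ->
  gcvg (fun L i => \sum_(j < n) a j L i) (\sum_(j < n) p j).
Proof.
elim: n => [|n IH] h.
  rewrite big_ord0; apply: gcvg_ext gcvg0; near=> L => i.
  by rewrite big_ord0.
rewrite big_ord_recr /=.
apply: (@gcvg_ext (fun L i => \sum_(j < n) a j L i + a n L i)).
  by near=> L => i; rewrite big_ord_recr.
by apply: gcvgD; [apply: IH => j jn; apply: h; exact: ltnW|exact: h].
Unshelve. all: by end_near. Qed.

Lemma gauss_sqr x : gauss x * gauss x = expR (- x ^+ 2).
Proof. by rewrite -expRD; congr expR; field. Qed.

(** Each product differs from its limit by a small multiple of [(1 + |x|)^-2]. *)
Lemma gcvg_dot a b p q : gcvg a p -> gcvg b q ->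
  (fun L => eps R L * \sum_(i < dimN L) a L i * b L i) @ \oo --> gint (p * q).
Proof.
move=> ha hb.
have half0 : 0 < 2^-1 :> R by rewrite invr_gt0.
have [A A0 HA] := @horner_gauss_bound R p 0 2^-1 half0.
have [B B0 HB] := @horner_gauss_bound R q 0 2^-1 half0.
rewrite -[gint _]add0r.
have -> : (fun L => eps R L * \sum_(i < dimN L) a L i * b L i) =
  (fun L => (eps R L * \sum_(i < dimN L) a L i * b L i - rsum (p * q) L) + rsum (p * q) L).
  by apply/funext => L; rewrite subrK.
apply: cvgD; last exact: rsum_cvg.
apply/cvgr0Pnorm_le => e e0.
pose d := Num.min 1 (e / (4 * (1 + A + B))).
have D0 : 0 < 1 + A + B by rewrite !addr_gt0.
have d0 : 0 < d by rewrite lt_min ltr01 divr_gt0 // mulr_gt0.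
have d1 : d <= 1 by rewrite ge_min lexx.
near=> L.
have e1 : eps R L <= 1 by near: L; exact: near_eps.
have h1 : forall i : 'I_(dimN L),
    weight i ^+ 2 * `|a L i - p.[node R i] * gauss (node R i)| <= d.
  by near: L; exact: ha.
have h2 : forall i : 'I_(dimN L),
    weight i ^+ 2 * `|b L i - q.[node R i] * gauss (node R i)| <= d.
  by near: L; exact: hb.
have h3 : forall i : 'I_(dimN L),
    weight i ^+ 0 * `|b L i - q.[node R i] * gauss (node R i)| <= 1.
  by near: L; exact: hb.
have term (i : 'I_(dimN L)) : `|a L i * b L i - (p * q).[node R i] * expR (- node R i ^+ 2)| <=
    d * (1 + A + B) * (1 + `|node R i|) ^- 2.
  have := HA (node R i); have := HB (node R i); have := h1 i; have := h2 i; have := h3 i.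
  rewrite !expr0 !mul1r [2^-1 * _]mulrC -gauss_sqr hornerM.
  set P := p.[_]; set Q := q.[_]; set E := gauss _; set W := (1 + _) ^+ 2.
  have W0 : 0 < W by rewrite exprn_gt0 // ltr_wpDr.
  have E0 : 0 <= E by exact: expR_ge0.
  move=> k3 k2 k1 kB kA.
  have {}kA : `|P * E| <= A by rewrite normrM (ger0_norm E0).
  have {}kB : `|Q * E| <= B by rewrite normrM (ger0_norm E0).
  rewrite ler_pdivlMr // mulrC.
  have -> : a L i * b L i - P * Q * (E * E) = (a L i - P * E) * (b L i - Q * E)
     + (a L i - P * E) * (Q * E) + (b L i - Q * E) * (P * E) by ring.
  have tri (X Y Z : R) : `|X + Y + Z| <= `|X| + `|Y| + `|Z|.
    by rewrite (le_trans (ler_normD _ _)) // lerD2r ler_normD.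
  apply: (le_trans (ler_wpM2l (ltW W0) (tri _ _ _))).
  have -> : d * (1 + A + B) = d * 1 + d * B + d * A by ring.
  rewrite 2!mulrDr; apply: lerD; first apply: lerD; rewrite normrM mulrA ler_pM // ?mulr_ge0 // ltW.
have -> : eps R L * (\sum_(i < dimN L) a L i * b L i) - rsum (p * q) L =
  eps R L * \sum_(i < dimN L) (a L i * b L i - (p * q).[node R i] * expR (- node R i ^+ 2)).
  by rewrite /rsum -mulrBr -sumrB.
rewrite normrM (gtr0_norm (eps_gt0 _ _)).
apply: (@le_trans _ _ (d * (1 + A + B) * 4)); last first.
  by rewrite -mulrA [_ * 4]mulrC -ler_pdivlMr ?mulr_gt0 // ge_min lexx orbT.
apply: (@le_trans _ _ (d * (1 + A + B) * (eps R L * \sum_(i < dimN L) (1 + `|node R i|) ^- 2))).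
  rewrite mulrCA ler_pM2l ?eps_gt0 // mulr_sumr (le_trans (ler_norm_sum _ _ _)) //.
  by apply: ler_sum => i _; exact: term.
by rewrite ler_pM2l ?node_weight_sum // mulr_gt0.
Unshelve. all: by end_near. Qed.

End GaussianConvergence.

(** * The ratio of two sines near pi / 4 *)

Section SineRatio.
Variable R : realType.
Implicit Types (x y t al be d : R).

Lemma sin_ge_cosM be : 0 <= be -> be <= pi -> cos be * be <= sin be.
Proof.
rewrite le_eqVlt => /predU1P[<-|b0] bpi; first by rewrite mulr0 sin0.
have [z] := @MVT_step R (@sin R) cos 0 be b0 (@is_derive_sin R).
rewrite add0r sin0 subr0 => /andP[z0 zb] ->; rewrite ler_pM2r //.
by rewrite leNgt ltr_cos ?in_itv /= -?leNgt // ?z0 ?(ltW b0) //= (le_trans zb).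
Qed.

Lemma one_sub_ratio al be : sin (al + be) != 0 ->
  1 - sin (al - be) / sin (al + be) = 2 * cos al * sin be / sin (al + be).
Proof. by rewrite sinB sinD => h; field. Qed.

Lemma ratio_inv_sub al be : sin (al - be) != 0 ->
  sin (al + be) / sin (al - be) - 1 = 2 * cos al * sin be / sin (al - be).
Proof. by rewrite sinB sinD => h; field. Qed.

Lemma ratio_le_exp al be t : 0 < sin (al + be) ->
  t * sin (al + be) <= 2 * cos al * sin be ->
  sin (al - be) / sin (al + be) <= expR (- t).
Proof.
move=> s0 h; apply: le_trans (expR_ge1Dx _).
suff : t <= 1 - sin (al - be) / sin (al + be) by lra.
by rewrite one_sub_ratio ?gt_eqF // ler_pdivlMr.
Qed.

Lemma ratio_ge_exp al be t : 0 < sin (al + be) -> 0 < sin (al - be) ->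
  2 * cos al * sin be <= t * sin (al - be) ->
  expR (- t) <= sin (al - be) / sin (al + be).
Proof.
move=> s0 s1 h; rewrite -[leRHS]invrK expRN lef_pV2 ?posrE ?expR_gt0 ?invr_gt0 ?divr_gt0 //.
rewrite invf_div; apply: le_trans (expR_ge1Dx _).
suff : sin (al + be) / sin (al - be) - 1 <= t by lra.
by rewrite ratio_inv_sub ?gt_eqF // ler_pdivrMr.
Qed.

(** Near [pi / 4] the sine and the cosine of [al] agree, so one minus the ratio, and
    the inverse of the ratio minus one, are both close to [2 be]. *)
Lemma ratio_near_exp al be d : 0 < d -> d <= 1 ->
  0 < sin (al + be) -> 0 < sin (al - be) -> 2^-1 <= sin al -> 0 <= cos al ->
  `|cos al - sin al| <= d / 16 -> 0 <= be -> be <= d / 16 ->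
  expR (- ((1 + d) * (2 * be))) <= sin (al - be) / sin (al + be) <= expR (- ((1 - d) * (2 * be))).
Proof.
move=> d0 d1 sp sm sa ca; rewrite ler_norml => /andP[c1 c2] b0 bd.
have b1 : be <= 1 by lra.
have bpi : be <= pi by have := pi_ge2 R; lra.
have sb : sin be <= be.
  by have := sin_le be; rewrite (ger0_norm b0); apply: le_trans; rewrite ler_norm.
have sb0 : 0 <= sin be by rewrite sin_ge0_pi // b0.
have sb' := sin_ge_cosM b0 bpi.
have cb : 1 - be <= cos be.
  have := cos_near1 be; rewrite ler_norml => /andP[h _].
  have : be ^+ 2 <= be by rewrite expr2 ler_piMl.
  lra.
have cb1 := cos_le1 be.
have sa1 := sin_le1 al.
have ca1 := cos_le1 al.
have camb : cos al * sin be <= cos al * be by rewrite ler_wpM2l.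
have cab : cos al * be <= be by rewrite ler_piMl.
apply/andP; split.
  apply: ratio_ge_exp => //.
  have s1 : sin al - 2 * be <= sin (al - be).
    rewrite sinB; have : sin al * (1 - be) <= sin al * cos be by rewrite ler_wpM2l //; lra.
    by have : sin al * be <= be; [rewrite ler_piMl|lra].
  have h : cos al <= (1 + d) * (sin al - 2 * be).
    have : d * 2^-1 <= d * sin al by rewrite ler_pM2l.
    by have : d * be <= be; [rewrite ler_piMl|lra].
  apply: (@le_trans _ _ ((2 * be) * cos al)); first by lra.
  apply: (@le_trans _ _ ((2 * be) * ((1 + d) * (sin al - 2 * be)))).
    by rewrite ler_wpM2l // mulr_ge0.
  rewrite mulrA [2 * be * (1 + d)]mulrC ler_wpM2l // !mulr_ge0 //; lra.
apply: ratio_le_exp => //.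
have s1 : sin (al + be) <= sin al + be.
  rewrite sinD; have : sin al * cos be <= sin al by rewrite ler_piMr //; lra.
  lra.
have h : (1 - d) * (sin al + be) <= cos al * (1 - be).
  have : d * 2^-1 <= d * sin al by rewrite ler_pM2l.
  have : 0 <= d * be by rewrite mulr_ge0 // ltW.
  lra.
apply: (@le_trans _ _ ((2 * be) * ((1 - d) * (sin al + be)))).
  by rewrite [leRHS]mulrA [2 * be * (1 - d)]mulrC ler_wpM2l // !mulr_ge0 // subr_ge0.
apply: (@le_trans _ _ ((2 * be) * (cos al * (1 - be)))).
  by rewrite ler_wpM2l // mulr_ge0.
have : cos al * ((1 - be) * be) <= cos al * sin be.
  by rewrite ler_wpM2l // (le_trans _ sb') // ler_wpM2r.
lra.
Qed.
End SineRatio.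

(** * The profile of u_(-2) *)

Section GaussianLimit.
Variable R : realType.
Implicit Types (x y t al be d : R) (L k : nat).

Local Notation weight i := (1 + `|node R i|).
Local Notation gauss x := (expR (- (x ^+ 2 / 2))).

(** The half-sum [pi (2 L + 5) / 2 N] and the half-difference [pi (2 k + 1) / 2 N] of
    the two angles in the ratio of consecutive values of [u_(-2)]. *)
Definition alpha L : R := pi / 4 + 9 / 8 * eps R L ^+ 2.
Definition beta L k : R := eps R L ^+ 2 / 4 * (2 * k + 1)%:R.

Lemma cos_piquarter : cos (pi / 4) = sin (pi / 4) :> R.
Proof.
have c0 : cos (pi / 4) != 0 :> R.
  rewrite gt_eqF // cos_gt0_pihalf //.
  by apply/andP; split; have := pi_gt0 R; lra.
by have := @tan_piquarter R; rewrite /tan => /(congr1 ( *%R^~ (cos (pi / 4)))); rewrite divfK // mul1r.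
Qed.

Lemma near_alpha d : 0 < d -> \forall L \near \oo, `|cos (alpha L) - sin (alpha L)| <= d.
Proof.
move=> d0; near=> L.
have e1 : eps R L <= 1 by near: L; exact: near_eps.
have ed : eps R L <= d / 4 by near: L; apply: near_eps; rewrite divr_gt0.
have e0 := eps_gt0 R L.
have ee : eps R L ^+ 2 <= eps R L by rewrite expr2 ler_piMl // ltW.
rewrite /alpha cosD sinD cos_piquarter.
set t := 9 / 8 * _; set c := sin (pi / 4).
have -> : c * cos t - c * sin t - (c * cos t + c * sin t) = - (2 * (c * sin t)) by ring.
rewrite normrN normrM normrM (ger0_norm (_ : 0 <= 2)) //.
have t0 : 0 <= t by rewrite mulr_ge0 ?sqr_ge0.
have st : `|sin t| <= t by rewrite -[leRHS](ger0_norm t0) sin_le.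
have : `|c| * `|sin t| <= 1 * t by rewrite ler_pM // sin_max.
by rewrite mul1r /t; lra.
Unshelve. all: by end_near. Qed.

Lemma alpha_bounds L : 0 < cos (alpha L) -> 0 < sin (alpha L) ->
  `|cos (alpha L) - sin (alpha L)| <= 8^-1 ->
  2^-1 <= sin (alpha L) /\ 2^-1 <= cos (alpha L).
Proof.
move=> c0 s0; rewrite ler_norml => /andP[h1 h2].
have := cos2Dsin2 (alpha L); move: (cos _) (sin _) c0 s0 h1 h2 => c s c0 s0 h1 h2 e.
split; rewrite leNgt; apply/negP => h; nra.
Qed.

Lemma chord_minus L k : chord R L ((L + 2)%:Z - k%:Z) = 2 * sin (alpha L - beta L k).
Proof.
rewrite /chord /angle /alpha /beta eps_sqr intrB -!pmulrn.
congr (2 * sin _).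
have hN : (dimN L)%:R = 4 * L%:R + 1 :> R by rewrite -natr1 natrM.
have N0 : 4 * L%:R + 1 != 0 :> R by rewrite -hN pnatr_eq0.
by rewrite hN !natrD ?natrM; field.
Qed.

Lemma chord_plus L k : chord R L (L + 3 + k)%N%:Z = 2 * sin (alpha L + beta L k).
Proof.
rewrite /chord /angle /alpha /beta eps_sqr -!pmulrn.
congr (2 * sin _).
have hN : (dimN L)%:R = 4 * L%:R + 1 :> R by rewrite -natr1 natrM.
have N0 : 4 * L%:R + 1 != 0 :> R by rewrite -hN pnatr_eq0.
by rewrite hN !natrD ?natrM; field.
Qed.

(** [u_(-2)] divided by its value at the origin. Among the vectors that enter the
    first eight modes, it is the one of which all others are multiples by
    polynomials in sines. *)
Definition bell L k : R := SS R L (- 2) k%:Z / SS R L (- 2) 0.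

Lemma SS_center_gt0 L : (2 <= L)%N -> 0 < SS R L (- 2) 0.
Proof. by move=> L2; rewrite SSE mulr_gt0 // sprod_gt0 //; lia. Qed.

Lemma bell_ge0 L k : (2 <= L)%N -> (k <= 2 * L)%N -> 0 <= bell L k.
Proof.
move=> L2 kL; rewrite divr_ge0 ?(ltW (SS_center_gt0 _)) // SSE.
have [h|h] := leqP k (3 * L - 2); first by rewrite mulr_ge0 // sprod_ge0 //; lia.
by rewrite sprod_eq0 ?mul0r //; lia.
Qed.

Lemma bell0 L : (2 <= L)%N -> bell L 0 = 1.
Proof. by move=> L2; rewrite /bell divff // gt_eqF // SS_center_gt0. Qed.

Lemma bell_out L k : (2 <= L)%N -> (L + 3 <= k)%N -> bell L k = 0.
Proof. by move=> L2 kL; rewrite /bell SSE sprod_eq0 ?mul0r //; lia. Qed.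

(** The recurrence stops before the first zero, at [k + 1 = L + 3], so that both sines
    are positive. *)
Lemma bell_step L k : (2 <= L)%N -> (k <= L + 1)%N ->
  [/\ 0 < sin (alpha L + beta L k), 0 < sin (alpha L - beta L k) &
  bell L k.+1 = sin (alpha L - beta L k) / sin (alpha L + beta L k) * bell L k].
Proof.
move=> L2 kL.
have p0 : 0 < chord R L (L + 3 + k)%N%:Z by apply: chord_gt0; lia.
have m0 : 0 < chord R L ((L + 2)%:Z - k%:Z) by apply: chord_gt0; lia.
have e : SS R L (- 2) k.+1%:Z * chord R L (L + 3 + k)%N%:Z =
    chord R L ((L + 2)%:Z - k%:Z) * SS R L (- 2) k%:Z.
  rewrite !SSE.
  have -> : (3 * L)%:Z + (- 2) + k.+1%:Z = (3 * L)%:Z - 2 + k%:Z + 1 by lia.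
  have -> : (3 * L)%:Z + (- 2) - k%:Z = (3 * L)%:Z - 2 - k.+1%:Z + 1 by lia.
  rewrite !sprodS; [|lia..].
  have -> : chord R L ((3 * L)%:Z - 2 + k%:Z + 1) = chord R L ((L + 2)%:Z - k%:Z).
    by rewrite -[LHS]opprK -chordN -chordDN; congr chord; lia.
  have -> : chord R L ((3 * L)%:Z - 2 - k.+1%:Z + 1) = chord R L (L + 3 + k)%N%:Z.
    by rewrite -[LHS]opprK -chordN -chordDN; congr chord; lia.
  ring.
rewrite chord_plus pmulr_rgt0 // in p0; rewrite chord_minus pmulr_rgt0 // in m0.
split=> //; rewrite chord_plus chord_minus in e.
rewrite /bell; have c0 := SS_center_gt0 L2.
apply: (mulIf (lt0r_neq0 p0)); apply: (@mulfI _ 2) => //.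
rewrite [LHS](_ : _ = SS R L (- 2) k.+1%:Z * (2 * sin (alpha L + beta L k)) / SS R L (- 2) 0); last by ring.
by rewrite e; field; rewrite !gt_eqF.
Qed.

Lemma sum_beta L k : beta L k = eps R L ^+ 2 / 4 * (k.+1%:R ^+ 2 - k%:R ^+ 2).
Proof. by rewrite /beta -natr1 natrD natrM; ring. Qed.

(** The exponents add up: [beta j] is proportional to [2 j + 1], a difference of
    consecutive squares. *)
Lemma bell_le L k c : (2 <= L)%N -> (k <= L + 2)%N ->
  (forall j, (j < k)%N -> sin (alpha L - beta L j) / sin (alpha L + beta L j) <= expR (- (c * (2 * beta L j)))) ->
  bell L k <= expR (- (c * (eps R L * k%:R) ^+ 2 / 2)).
Proof.
move=> L2; elim: k => [|k IH] kL h.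
  by rewrite bell0 // mulr0 expr0n mulr0 mul0r oppr0 expR0.
have [|_ _ ->] := @bell_step L k L2; first by lia.
have {}IH := IH (ltnW kL) (fun j jk => h j (ltnW jk)).
apply: (@le_trans _ _ (expR (- (c * (2 * beta L k))) * expR (- (c * (eps R L * k%:R) ^+ 2 / 2)))).
  apply: ler_pM => //; last exact: h.
    have [|/ltW ? /ltW ? _] := @bell_step L k L2; first by lia.
    exact: divr_ge0.
  by apply: bell_ge0 => //; lia.
by rewrite -expRD sum_beta le_eqVlt; apply/orP; left; apply/eqP; congr expR; field.
Qed.

Lemma bell_ge L k c : (2 <= L)%N -> (k <= L + 2)%N ->
  (forall j, (j < k)%N -> expR (- (c * (2 * beta L j))) <= sin (alpha L - beta L j) / sin (alpha L + beta L j)) ->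
  expR (- (c * (eps R L * k%:R) ^+ 2 / 2)) <= bell L k.
Proof.
move=> L2; elim: k => [|k IH] kL h.
  by rewrite bell0 // mulr0 expr0n mulr0 mul0r oppr0 expR0.
have [|_ _ ->] := @bell_step L k L2; first by lia.
have {}IH := IH (ltnW kL) (fun j jk => h j (ltnW jk)).
apply: (@le_trans _ _ (expR (- (c * (2 * beta L k))) * expR (- (c * (eps R L * k%:R) ^+ 2 / 2)))).
  by rewrite -expRD sum_beta le_eqVlt; apply/orP; left; apply/eqP; congr expR; field.
by apply: ler_pM; rewrite ?expR_ge0 // h.
Qed.

End GaussianLimit.

(** * The profile tends to the Gaussian *)

Section BellLimit.
Variable R : realType.
Implicit Types (x y t al be d : R) (L k : nat).

Local Notation weight i := (1 + `|node R i|).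
Local Notation gauss x := (expR (- (x ^+ 2 / 2))).

Lemma near_alpha_good : \forall L \near \oo, [/\ (2 <= L)%N, 2^-1 <= sin (alpha R L),
  2^-1 <= cos (alpha R L) & alpha R L <= pi].
Proof.
near=> L.
have e1 : eps R L <= 2^-1 by near: L; apply: near_eps; rewrite invr_gt0.
have e0 := eps_gt0 R L; have p2 := pi_ge2 R.
have ee : eps R L ^+ 2 <= 2^-1 * 2^-1 by rewrite expr2 ler_pM // ltW.
have e2 : 0 < eps R L ^+ 2 by rewrite exprn_gt0.
have a0 : 0 < alpha R L by rewrite /alpha; lra.
have a1 : alpha R L < pi / 2 by rewrite /alpha; lra.
have c0 : 0 < cos (alpha R L) by rewrite cos_gt0_pihalf // a1 andbT; lra.
have s0 : 0 < sin (alpha R L) by rewrite sin_gt0_pi // a0; lra.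
have [|sa ca] := alpha_bounds c0 s0.
  by near: L; apply: near_alpha; rewrite invr_gt0.
by split=> //; [near: L; exists 2%N|lra].
Unshelve. all: by end_near. Qed.

(** A Gaussian bound with a worse rate than the true one, but for all [k]. *)
Lemma near_bell_decay : \forall L \near \oo, forall k, (k <= 2 * L)%N ->
  bell R L k <= expR (- (8^-1 * (eps R L * k%:R) ^+ 2)).
Proof.
near=> L.
have [L2 sa ca ap] : [/\ (2 <= L)%N, 2^-1 <= sin (alpha R L),
    2^-1 <= cos (alpha R L) & alpha R L <= pi] by near: L; exact: near_alpha_good.
move=> k kL; have [kL2|kL2] := leqP k (L + 2); last first.
  by rewrite bell_out ?expR_ge0 //; lia.
(* Each ratio is at most exp (- beta / 2): the cosines of alpha and beta are at least 1 / 2. *)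
rewrite [8^-1 * _](_ : _ = 4^-1 * (eps R L * k%:R) ^+ 2 / 2); last by field.
apply: bell_le => // j jk.
have [|sp sm _] := @bell_step R L j L2; first by move: jk kL2; clear; lia.
apply: ratio_le_exp => //.
have b0 : 0 <= beta R L j by rewrite mulr_ge0 ?divr_ge0 ?sqr_ge0.
have ba : beta R L j <= alpha R L.
  have : 0 <= angle R L ((L + 2)%:Z - j%:Z).
    by rewrite /angle divr_ge0 ?mulr_ge0 ?pi_ge0 ?ler0z ?ler0n //; lia.
  have -> : angle R L ((L + 2)%:Z - j%:Z) = alpha R L - beta R L j.
    rewrite /angle /alpha /beta eps_sqr intrB -!pmulrn.
    have hN : (dimN L)%:R = 4 * L%:R + 1 :> R by rewrite -natr1 natrM.
    have N0 : 4 * L%:R + 1 != 0 :> R by rewrite -hN pnatr_eq0.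
    by rewrite hN !natrD ?natrM; field.
  by rewrite subr_ge0.
have sb := sin_ge_cosM b0 (le_trans ba ap).
have cb : 2^-1 <= cos (beta R L j).
  apply: le_trans ca _; rewrite leNgt ltr_cos ?in_itv /= -?leNgt ?b0 ?(le_trans ba) //.
  by rewrite (le_trans b0).
have s1 := sin_le1 (alpha R L + beta R L j).
apply: (@le_trans _ _ (4^-1 * (2 * beta R L j) * 1)).
  by rewrite ler_wpM2l // mulr_ge0 ?invr_ge0 // mulr_ge0.
have h1 : 2^-1 * beta R L j <= sin (beta R L j) by apply: le_trans sb; rewrite ler_wpM2r.
have : 2^-1 * (2^-1 * beta R L j) <= cos (alpha R L) * sin (beta R L j).
  by apply: ler_pM => //; rewrite mulr_ge0.
lra.
Unshelve. all: by end_near. Qed.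

Lemma sub_gauss_le (A t : R) : 0 <= A -> A <= 1 -> 0 <= t -> A - A * expR (- t) <= t.
Proof.
move=> A0 A1 t0; rewrite -[X in X - _]mulr1 -mulrBr; have E := expR_ge1Dx (- t).
apply: (@le_trans _ _ (A * t)); last by rewrite ler_piMl.
by rewrite ler_wpM2l //; lra.
Qed.

(** On bounded sets of nodes all the angles [beta j] tend to zero uniformly, and the
    ratio bounds become sharp. *)
Lemma near_bell_local (X d : R) : 0 < X -> 0 < d -> d <= 1 -> \forall L \near \oo, forall k,
  (k <= L + 2)%N -> eps R L * k%:R <= X ->
  `|bell R L k - gauss (eps R L * k%:R)| <= d * X ^+ 2.
Proof.
move=> X0 d0 d1; near=> L.
have [L2 sa ca ap] : [/\ (2 <= L)%N, 2^-1 <= sin (alpha R L),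
    2^-1 <= cos (alpha R L) & alpha R L <= pi] by near: L; exact: near_alpha_good.
have ad : `|cos (alpha R L) - sin (alpha R L)| <= d / 16.
  by near: L; apply: near_alpha; rewrite divr_gt0.
have ed : eps R L <= d / 16 / X.
  by near: L; apply: near_eps; rewrite !divr_gt0.
have e0 := eps_gt0 R L.
move=> k kL kX.
have H j : (j < k)%N ->
    expR (- ((1 + d) * (2 * beta R L j))) <=
    sin (alpha R L - beta R L j) / sin (alpha R L + beta R L j) <=
    expR (- ((1 - d) * (2 * beta R L j))).
  move=> jk; have [|sp sm _] := @bell_step R L j L2; first by move: jk kL; clear; lia.
  have b0 : 0 <= beta R L j by rewrite mulr_ge0 ?divr_ge0 ?sqr_ge0.
  apply: ratio_near_exp => //; first by apply: le_trans ca.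
  apply: (@le_trans _ _ (eps R L * X)); last by rewrite -ler_pdivlMr.
  apply: (@le_trans _ _ (eps R L * (eps R L * k%:R))); last by rewrite ler_pM2l.
  rewrite /beta mulrA -expr2 -mulrA ler_pM2l ?exprn_gt0 //.
  have : (2 * j + 1)%:R <= (4 * k)%:R :> R by rewrite ler_nat; move: jk; clear; lia.
  by rewrite natrM; clear; lra.
set x := eps R L * k%:R in kX *.
have x0 : 0 <= x by rewrite mulr_ge0 // ltW.
have lo : expR (- ((1 + d) * x ^+ 2 / 2)) <= bell R L k.
  by apply: bell_ge => // j /H /andP[].
have hi : bell R L k <= expR (- ((1 - d) * x ^+ 2 / 2)).
  by apply: bell_le => // j /H /andP[].
have xX : x ^+ 2 <= X ^+ 2 by rewrite lerXn2r ?nnegrE // ltW.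
have dx0 : 0 <= d * x ^+ 2 by rewrite mulr_ge0 ?sqr_ge0 // ltW.
have dX : d * x ^+ 2 <= d * X ^+ 2 by rewrite ler_pM2l.
have g1 : expR (- ((1 + d) * x ^+ 2 / 2)) = gauss x * expR (- (d * x ^+ 2 / 2)).
  by rewrite -expRD; congr expR; field.
have g2 : gauss x = expR (- ((1 - d) * x ^+ 2 / 2)) * expR (- (d * x ^+ 2 / 2)).
  by rewrite -expRD; congr expR; field.
have mono A : 0 <= A -> A <= 1 -> A - A * expR (- (d * x ^+ 2 / 2)) <= d * X ^+ 2.
  move=> A0 A1; apply: le_trans dX; apply: le_trans (sub_gauss_le A0 A1 _) _.
    by rewrite divr_ge0.
  by move: (d * x ^+ 2) dx0; clear => u u0; lra.
have m1 : gauss x - expR (- ((1 + d) * x ^+ 2 / 2)) <= d * X ^+ 2.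
  rewrite g1; apply: mono; rewrite ?expR_ge0 // expR_le1 oppr_le0.
  by rewrite divr_ge0 ?sqr_ge0.
have m2 : expR (- ((1 - d) * x ^+ 2 / 2)) - gauss x <= d * X ^+ 2.
  rewrite g2; apply: mono; rewrite ?expR_ge0 // expR_le1 oppr_le0.
  by apply: divr_ge0 => //; apply: mulr_ge0; rewrite ?sqr_ge0 // subr_ge0.
by move: m1 m2 lo hi; clear; move: (gauss x) => g ? ? ? ?; rewrite ler_norml; apply/andP; split; lra.
Unshelve. all: by end_near. Qed.

Definition center L (i : 'I_(dimN L)) : R := SS R L (- 2) (cidx i) / SS R L (- 2) 0.

Lemma node_abs L (i : 'I_(dimN L)) : `|node R i| = eps R L * (absz (cidx i))%:R.
Proof. by rewrite /node normrM (gtr0_norm (eps_gt0 _ _)) natr_absz intr_norm. Qed.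

Lemma center_bell L (i : 'I_(dimN L)) : center i = bell R L (absz (cidx i)).
Proof.
rewrite /center /bell; have [h|h] := leP 0 (cidx i); first by rewrite gez0_abs.
by rewrite ltz0_abs // SSN.
Qed.

(** Far from the origin both functions are small by the decay bound; elsewhere the
    sharp local bound applies. *)
Lemma gcvg_center : gcvg center 1.
Proof.
move=> m e e0.
have [X X0 HX] := @expXn_gauss_tail R m 8^-1 (e / 2) (ltac:(by rewrite invr_gt0)) (ltac:(by rewrite divr_gt0)).
pose Y := X + 1; have Y0 : 0 < Y by rewrite addr_gt0.
have W0 : 0 < (1 + Y) ^+ m by rewrite exprn_gt0 // addr_gt0.
pose d := Num.min 1 (e / ((1 + Y) ^+ m * Y ^+ 2)).
have d0 : 0 < d by rewrite lt_min ltr01 divr_gt0 // mulr_gt0 // exprn_gt0.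
have d1 : d <= 1 by rewrite ge_min lexx.
near=> L.
have decay : forall k, (k <= 2 * L)%N ->
    bell R L k <= expR (- (8^-1 * (eps R L * k%:R) ^+ 2)).
  by near: L; exact: near_bell_decay.
have loc : forall k, (k <= L + 2)%N -> eps R L * k%:R <= Y ->
    `|bell R L k - gauss (eps R L * k%:R)| <= d * Y ^+ 2.
  by near: L; exact: near_bell_local.
have L2 : (2 <= L)%N by near: L; exists 2%N.
(* Past the support the node exceeds Y, so the local bound covers all nodes up to Y. *)
have far : Y < eps R L * (L + 3)%:R.
  have h : 2 * Y + 1 <= eps R L * (2 * L)%:R by near: L; exact: near_node_end.
  by have := eps_gt0 R L; move: h; rewrite natrM natrD; lra.
move=> i; rewrite hornerC mul1r center_bell -(real_normK (num_real (node R i))) node_abs.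
have : (absz (cidx i) <= 2 * L)%N by have := cidx_bound i; lia.
move: (absz _) => k kL; set x := eps R L * k%:R.
have x0 : 0 <= x by rewrite mulr_ge0 // ltW // eps_gt0.
have [xY|Yx] := leP x Y.
  have kL2 : (k <= L + 2)%N.
    rewrite leqNgt; apply/negP => h; have := lt_le_trans far (_ : _ <= x).
    rewrite ltNge xY => /(_ _)/negP; case => //.
    by rewrite ler_pM2l ?eps_gt0 // ler_nat; lia.
  apply: (@le_trans _ _ ((1 + Y) ^+ m * (d * Y ^+ 2))).
    apply: ler_pM; rewrite ?exprn_ge0 ?addr_ge0 // ?loc //.
    by apply: lerXn2r; rewrite ?nnegrE ?lerD2l //; apply: addr_ge0 => //; exact: ltW.
  rewrite [leLHS](_ : _ = d * ((1 + Y) ^+ m * Y ^+ 2)); last by ring.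
  have YY : 0 < (1 + Y) ^+ m * Y ^+ 2 by rewrite mulr_gt0 // exprn_gt0.
  by rewrite -ler_pdivlMr // /d ge_min lexx orbT.
have Xx : X <= x by move: Yx; rewrite /Y; lra.
have h8 : gauss x <= expR (- (8^-1 * x ^+ 2)).
  by rewrite ler_expR lerN2; have := sqr_ge0 x; lra.
apply: le_trans (_ : (1 + x) ^+ m * (2 * expR (- (8^-1 * x ^+ 2))) <= e).
  rewrite ler_wpM2l ?exprn_ge0 ?addr_ge0 // (le_trans (ler_normB _ _)) //.
  rewrite (ger0_norm (expR_ge0 _)) (ger0_norm (bell_ge0 _ L2 kL)).
  by have := decay k kL; rewrite -/x; lra.
by rewrite mulrCA; have := HX x Xx; lra.
Unshelve. all: by end_near. Qed.

End BellLimit.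

(** * Passing Gram-Schmidt to the limit *)

Section Spans.
Variables (R : realType) (L : nat).
Implicit Types (u v f : 'rV[R]_(dimN L)) (n r i j : nat) (c : R).
Local Notation ph := (phi R L).

(** The span of the first [n] eigenvectors, encoded as the fixed points of the
    orthogonal projection: closure under linear combinations is immediate, and the
    coefficients are explicit. *)
Definition inspan n u : Prop := u = \sum_(j < n) dot u (ph j) *: ph j.

Lemma inspan0 n : inspan n 0.
Proof. by rewrite /inspan big1 // => j _; rewrite dot0l scale0r. Qed.

Lemma inspanP n c u v : inspan n u -> inspan n v -> inspan n (c *: u + v).
Proof.
rewrite /inspan => hu hv; rewrite {1}hu {1}hv scaler_sumr -big_split /=.
by apply: eq_bigr => j _; rewrite dotDl dotZl scalerDl scalerA.
Qed.

Lemma inspanZ n c u : inspan n u -> inspan n (c *: u).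
Proof. by move=> hu; rewrite -[c *: u]addr0; apply: inspanP => //; exact: inspan0. Qed.

Lemma inspanD n u v : inspan n u -> inspan n v -> inspan n (u + v).
Proof. by move=> hu hv; rewrite -[u]scale1r; exact: inspanP. Qed.

Lemma inspanN n u : inspan n u -> inspan n (- u).
Proof. by rewrite -scaleN1r; exact: inspanZ. Qed.

Lemma inspanB n u v : inspan n u -> inspan n v -> inspan n (u - v).
Proof. by move=> hu hv; apply: inspanD => //; exact: inspanN. Qed.

Lemma inspan_phi n j : (j < n)%N -> (n <= dimN L)%N -> inspan n (ph j).
Proof.
move=> jn nN; have jN := leq_trans jn nN.
rewrite /inspan (bigD1 (Ordinal jn)) //= phi_orthonormal // eqxx scale1r.
rewrite big1 ?addr0 // => l lj; have lN := leq_trans (ltn_ord l) nN.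
rewrite phi_orthonormal //; have [e|_] := eqVneq; last by rewrite scale0r.
by case/eqP: lj; exact: val_inj.
Qed.

Lemma divmod4 i r : (r < 4)%N -> ((4 * i + r) %% 4 = r)%N /\ ((4 * i + r) %/ 4 = i)%N.
Proof. by move=> r4; rewrite mulnC modnMDl modn_small // divnMDl // divn_small // addn0. Qed.

Lemma gs_family_phi r i : (r < 4)%N ->
  (4 * i + r < dimN L)%N -> gs (family R L r) i = enorm (gs (family R L r) i) *: ph (4 * i + r).
Proof.
move=> r4 iN; have [e1 e2] := divmod4 i r4; rewrite phiE e1 e2 scalerA divff ?scale1r //.
by rewrite gt_eqF // enorm_gt0 // gs_family_neq0.
Qed.

(** Gram-Schmidt within a family only subtracts earlier vectors of that family, which
    are earlier eigenvectors. *)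
Lemma family_sub_phi n : (n < dimN L)%N ->
  inspan n (family R L (n %% 4) (n %/ 4) - enorm (gs (family R L (n %% 4)) (n %/ 4)) *: ph n).
Proof.
move=> nN; have [r4 nr] := phi_index nN.
set r := (n %% 4)%N in r4 nr *; set i := (n %/ 4)%N in nr *.
have e : n = (4 * i + r)%N by rewrite mulnC -divn_eq.
rewrite {2}e -gs_family_phi // gsE opprB addrCA subrr addr0.
apply: (big_ind (inspan n)) => [|u v|j _]; [exact: inspan0|exact: inspanD|].
have jr : (4 * j + r < n)%N by have := ltn_ord j; lia.
rewrite gs_family_phi //; last exact: ltn_trans jr nN.
by do 2 apply: inspanZ; apply: inspan_phi => //; exact: ltnW.
Qed.

Lemma inspanW m n u : (m <= n)%N -> (n <= dimN L)%N -> inspan m u -> inspan n u.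
Proof.
move=> mn nN ->; apply: (big_ind (inspan n)) => [|u' v|j _]; [exact: inspan0|exact: inspanD|].
apply: inspanZ; apply: inspan_phi => //; exact: leq_trans (ltn_ord j) mn.
Qed.

Lemma inspan_family r i n : (r < 4)%N -> (4 * i + r < n)%N -> (n <= dimN L)%N ->
  inspan n (family R L r i).
Proof.
move=> r4 rn nN; have rN := leq_trans rn nN.
have := @family_sub_phi (4 * i + r) rN.
have [-> ->] := divmod4 i r4.
set c := enorm _; move=> /(inspanW (ltnW rn) nN) h.
rewrite -[family R L r i](subrK (c *: ph (4 * i + r))).
by apply: inspanD => //; apply: inspanZ; apply: inspan_phi.
Qed.

Lemma normalizeZ c u : 0 < c -> normalize (c *: u) = normalize u.
Proof.
move=> c0; rewrite /normalize /enorm dotZl dotZr mulrA -expr2 sqrtrM ?sqr_ge0 //.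
by rewrite sqrtr_sqr (gtr0_norm c0) invfM scalerA mulrAC mulVf ?mul1r // gt_eqF.
Qed.

(** In the orthogonalization, the vector of the family may be replaced by any vector
    with a positive component along it and the rest in the earlier span. This leaves
    the freedom to choose one whose limit is visible. *)
Lemma phi_leading n f c : (n < dimN L)%N -> 0 < c ->
  inspan n (f - c *: family R L (n %% 4) (n %/ 4)) ->
  ph n = normalize (f - \sum_(j < n) dot f (ph j) *: ph j).
Proof.
move=> nN c0 hf; have [r4 nr] := phi_index nN.
set a := enorm (gs (family R L (n %% 4)) (n %/ 4)).
have a0 : 0 < a by rewrite enorm_gt0 // gs_family_neq0.
have h : inspan n (f - (c * a) *: ph n).
  rewrite (_ : f - _ = (f - c *: family R L (n %% 4) (n %/ 4)) +
    c *: (family R L (n %% 4) (n %/ 4) - a *: ph n)).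
    by apply: inspanD => //; apply: inspanZ; exact: family_sub_phi.
  by rewrite scalerBr (scalerA c a (ph n)) [RHS]addrA subrK.
have -> : f - \sum_(j < n) dot f (ph j) *: ph j = (c * a) *: ph n.
  apply/eqP; rewrite subr_eq addrC -subr_eq; apply/eqP; rewrite {1}h.
  apply: eq_bigr => j _; congr (_ *: _).
  rewrite dotBl dotZl phi_orthonormal ?(ltn_trans (ltn_ord j)) //.
  by rewrite gtn_eqF ?mulr0 ?subr0.
rewrite normalizeZ ?mulr_gt0 // /normalize /enorm phi_orthonormal // eqxx sqrtr1.
by rewrite invr1 scale1r.
Qed.

End Spans.

Section PhiLimit.
Variable R : realType.

Definition scaled_phi n L (i : 'I_(dimN L)) : R := eps R L `^ (- 2^-1) * phi R L n 0 i.

Lemma eps_powR L : eps R L `^ (- 2^-1) = (Num.sqrt (eps R L))^-1.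
Proof. by rewrite powRN powR12_sqrt // ltW // eps_gt0. Qed.

Lemma hpoly_hermite_poly n : hpoly R n = (hnorm R n)^-1 *: hermite_poly R n.
Proof. by rewrite /hermite_poly scalerA mulVf ?scale1r // gt_eqF // hnorm_gt0. Qed.

(** Gram-Schmidt passes to the limit: a vector with the same leading term as
    [phi n], sampling a monomial times the Gaussian, is turned into the
    Hermite function by the projections, whose coefficients converge. *)
Lemma phi_limit n (f : forall L, 'rV[R]_(dimN L)) (c : R) : 0 < c ->
  (\forall L \near \oo,
     phi R L n = normalize (f L - \sum_(j < n) dot (f L) (phi R L j) *: phi R L j)) ->
  gcvg (fun L i => f L 0 i) (c *: 'X^n) ->
  (forall j, (j < n)%N -> gcvg (scaled_phi j) (hermite_poly R j)) ->
  gcvg (scaled_phi n) (hermite_poly R n).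
Proof.
move=> c0 hphi hf hj.
pose r L := f L - \sum_(j < n) dot (f L) (phi R L j) *: phi R L j.
pose C : R := c * 2 ^- n / hnorm R n.
have C0 : 0 < C by rewrite divr_gt0 ?hnorm_gt0 // mulr_gt0 // invr_gt0 exprn_gt0.
have e0 L : eps R L != 0 by rewrite gt_eqF // eps_gt0.
have se L : Num.sqrt (eps R L) ^+ 2 = eps R L by rewrite sqr_sqrtr // ltW // eps_gt0.
have s0 L : Num.sqrt (eps R L) != 0 by rewrite gt_eqF // sqrtr_gt0 eps_gt0.
have hr : gcvg (fun L i => r L 0 i) (C *: hermite_poly R n).
  have -> : C *: hermite_poly R n =
      c *: 'X^n + (- 1) *: \sum_(j < n) gint (c *: 'X^n * hermite_poly R j) *: hermite_poly R j.
    rewrite scaleN1r (_ : \sum_(j < n) _ = c *: \sum_(j < n) gint ('X^n * hermite_poly R j) *: hermite_poly R j).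
      by rewrite -scalerBr hpoly_gram_schmidt hpoly_hermite_poly [RHS]scalerA [RHS]scalerA.
    by rewrite scaler_sumr; apply: eq_bigr => j _; rewrite -scalerAl gintZ scalerA.
  apply: (@gcvg_ext _ (fun L i => f L 0 i + (-1) * \sum_(j < n)
      (eps R L * \sum_(k < dimN L) f L 0 k * scaled_phi j k) * scaled_phi j i)).
    near=> L => i; rewrite [r]lock /= -lock /r mxE [X in _ = _ + X]mxE mulN1r summxE.
    congr (_ - _); apply: eq_bigr => j _; rewrite mxE.
    rewrite /scaled_phi eps_powR /dot.
    under eq_bigr do rewrite mulrCA.
    rewrite -mulr_sumr -[X in X * _ * _]se.
    by field.
  apply: gcvgD => //; apply: gcvgZ; first exact: cvg_cst.
  apply: (@gcvg_sum _ n (fun j L i => (eps R L * \sum_(k < dimN L) f L 0 k * scaled_phi j k) *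
     scaled_phi j i) (fun j => gint (c *: 'X^n * hermite_poly R j) *: hermite_poly R j)) => j jn.
  by apply: gcvgZ; [apply: gcvg_dot => //; exact: hj|exact: hj].
(* The limit has norm C, since the Hermite functions are normalized. *)
have nr : (fun L => Num.sqrt (eps R L) * enorm (r L)) @ \oo --> C.
  have h := gcvg_dot hr hr.
  rewrite -scalerAl -scalerAr scalerA gintZ gint_hermite_poly_sqr mulr1 -expr2 in h.
  rewrite -(gtr0_norm C0) -sqrtr_sqr.
  rewrite (_ : (fun L => _) = (fun L => Num.sqrt (eps R L * \sum_(i < dimN L) r L 0 i * r L 0 i))).
    by apply: continuous_cvg; [exact: sqrt_continuous|exact: h].
  by apply/funext => L; rewrite sqrtrM // ltW // eps_gt0.
have -> : hermite_poly R n = C^-1 *: (C *: hermite_poly R n) by rewrite scalerA mulVf ?scale1r // gt_eqF.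
apply: (@gcvg_ext _ (fun L i => (Num.sqrt (eps R L) * enorm (r L))^-1 * r L 0 i)).
  near=> L => i; rewrite /scaled_phi eps_powR.
  have -> : phi R L n = normalize (r L) by near: L; exact: hphi.
  by rewrite /normalize [X in _ = _ * X]mxE invfM mulrA.
by apply: gcvgZ => //; apply: cvgV => //; rewrite gt_eqF.
Unshelve. all: by end_near. Qed.

End PhiLimit.

(** * Limits of the coefficients and of the sampled sines *)

Section Coefficients.
Variable R : realType.
Implicit Types (L j n : nat) (d : int).

Lemma cvg_eps : @eps R @ \oo --> (0 : R).
Proof.
apply/cvgr0Pnorm_le => e e0; near=> L; rewrite gtr0_norm ?eps_gt0 //.
by near: L; exact: near_eps.
Unshelve. all: by end_near. Qed.

Lemma cvg_eps_sqr (c : R) : (fun L => eps R L ^+ 2 * c) @ \oo --> (0 : R).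
Proof.
rewrite (_ : (fun _ => _) = (fun L => c * (eps R L * eps R L))); last first.
  by apply/funext => L; rewrite mulrC expr2.
have := cvgMl_tmp (a := c) (cvgM cvg_eps cvg_eps); rewrite !mulr0; exact.
Qed.

Lemma cvg_continuous_eps (f : R -> R) (a c : R) : continuous f ->
  (fun L => f (a + eps R L ^+ 2 * c)) @ \oo --> f a.
Proof.
move=> fc; apply: (cvg_comp (fun L => a + eps R L ^+ 2 * c) f); last exact: fc.
by have := cvgD (@cvg_cst _ a _ \oo _) (cvg_eps_sqr c); rewrite addr0; exact.
Qed.

Lemma chord_center L j :
  chord R L (2 * L + j)%N%:Z = 2 * sin (pi / 2 + eps R L ^+ 2 * ((2 * j%:R - 1) / 4)).
Proof.
rewrite /chord /angle eps_sqr -pmulrn natrD natrM; congr (2 * sin _).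
have hN : (dimN L)%:R = 4 * L%:R + 1 :> R by rewrite -natr1 natrM.
have N0 : 4 * L%:R + 1 != 0 :> R by rewrite -hN pnatr_eq0.
by rewrite hN; field.
Qed.

Lemma cochord_center L d :
  cochord R L (2 * ((3 * L)%:Z + d)) = 2 * cos (pi / 2 + pi + eps R L ^+ 2 * (d%:~R - 3 / 4)).
Proof.
rewrite /cochord /angle eps_sqr intrM intrD -!pmulrn natrM; congr (2 * cos _).
have hN : (dimN L)%:R = 4 * L%:R + 1 :> R by rewrite -natr1 natrM.
have N0 : 4 * L%:R + 1 != 0 :> R by rewrite -hN pnatr_eq0.
by rewrite hN; field.
Qed.

(** The constant in the recurrence: the entries of [u_d] are those of [u_(d-1)]
    times [step_coef d - X], where [X] is the squared chord of the position. *)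
Definition step_coef d L : R := 2 - cochord R L (2 * ((3 * L)%:Z + d)).
Definition mid_coef j L : R := coefS R L (2 * L + j).

(** The angle tends to [3 pi / 2], where the cosine vanishes. *)
Lemma cvg_step_coef d : step_coef d @ \oo --> (2 : R).
Proof.
have h := @cvg_continuous_eps cos (pi / 2 + pi) (d%:~R - 3 / 4) (@continuous_cos R).
rewrite cosDpi cos_pihalf oppr0 in h.
rewrite [step_coef d](_ : _ = (fun L =>
    2 - 2 * cos (pi / 2 + pi + eps R L ^+ 2 * (d%:~R - 3 / 4)))); last first.
  by apply/funext => L; rewrite /step_coef cochord_center.
suff : (fun L => 2 - 2 * cos (pi / 2 + pi + eps R L ^+ 2 * (d%:~R - 3 / 4)))
    @ \oo --> (2 - 2 * 0 : R) by rewrite mulr0 subr0.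
by apply: cvgB; [exact: cvg_cst|exact: cvgMl_tmp].
Qed.

(** The square of [S(2L)] is [S(4L) = N], by reflection. *)
Lemma mid_coef0 L : mid_coef 0 L = 1.
Proof.
have h : sprod R L (2 * L)%:Z * sprod R L (2 * L)%:Z = (dimN L)%:R.
  by rewrite -sprod_top -(@sprod_reflect R L (2 * L)%:Z); [congr (_ * sprod _ _ _)|..]; lia.
have p0 : 0 <= sprod R L (2 * L)%:Z by apply: sprod_ge0.
rewrite /mid_coef addn0 [coefS _ _ _]coefS_dft /dft_coef -h -expr2 sqrtr_sqr ger0_norm // mulVf //.
by rewrite gt_eqF // sprod_gt0 //; lia.
Qed.

Lemma cvg_mid_coef j : mid_coef j @ \oo --> (2 ^+ j : R).
Proof.
elim: j => [|j IH].
  by rewrite expr0 (_ : mid_coef 0 = cst 1); [exact: cvg_cst|apply/funext => L; rewrite mid_coef0].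
have h := @cvg_continuous_eps sin (pi / 2) ((2 * j.+1%:R - 1) / 4) (@continuous_sin R).
rewrite sin_pihalf in h.
rewrite [mid_coef j.+1](_ : _ = (fun L =>
    2 * sin (pi / 2 + eps R L ^+ 2 * ((2 * j.+1%:R - 1) / 4)) * mid_coef j L)); last first.
  apply/funext => L; rewrite -chord_center /mid_coef ![coefS _ _ _]coefS_dft /dft_coef mulrCA; congr (_ * _).
  have -> : (2 * L + j.+1)%N%:Z = (2 * L + j)%N%:Z + 1 by lia.
  by rewrite sprodS.
have -> : 2 ^+ j.+1 = 2 * 1 * 2 ^+ j :> R by rewrite mulr1 exprS.
by apply: cvgM => //; exact: cvgMl_tmp.
Qed.

Lemma mid_coef_gt0 j L : (j <= 2 * L)%N -> 0 < mid_coef j L.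
Proof. by move=> jL; rewrite /mid_coef [coefS _ _ _]coefS_dft dft_coef_gt0 //; lia. Qed.

(** Both quantities sample a sine and tend to the node. Up to a factor [eps], [sine_node] is
    the quotient of the entries of [v_d] and [u_d], and [chord_node] is a square root of [X]. *)
Definition chord_node L (i : 'I_(dimN L)) : R := chord R L (cidx i) / eps R L.
Definition sine_node L (i : 'I_(dimN L)) : R := 2^-1 * chord R L (2 * cidx i) / eps R L.

Lemma pcvg_ext (b c : forall L, 'I_(dimN L) -> R) p :
  (forall L i, b L i = c L i) -> pcvg b p -> pcvg c p.
Proof.
move=> bc [m h]; exists m => e e0; near=> L.
have hL : forall i : 'I_(dimN L), `|b L i - p.[node R i]| <= e * (1 + `|node R i|) ^+ m.
  by near: L; exact: h.
by move=> i; rewrite -bc.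
Unshelve. all: by end_near.
Qed.

Lemma pcvg_sin (c : R) :
  pcvg (fun L i => sin (c * eps R L * node R i) / eps R L) (c *: 'X).
Proof.
exists 3%N => e e0.
have C0 : 0 < `|c| ^+ 3 + 1 by rewrite ltr_wpDl // exprn_ge0.
near=> L.
have e1 : eps R L <= 1 by near: L; exact: near_eps.
have ec : eps R L <= e / (`|c| ^+ 3 + 1) by near: L; apply: near_eps; rewrite divr_gt0.
move=> i; rewrite hornerZ hornerX; have h0 := eps_gt0 R L.
move: (node R i) => x; have -> : sin (c * eps R L * x) / eps R L - c * x =
    (sin (c * eps R L * x) - c * eps R L * x) / eps R L by field; rewrite gt_eqF.
rewrite normf_div (gtr0_norm h0) ler_pdivrMr // (le_trans (sin_near_id _)) //.
rewrite !normrM (gtr0_norm h0) !exprMn.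
have x3 : `|x| ^+ 3 <= (1 + `|x|) ^+ 3 by rewrite lerXn2r ?nnegrE ?addr_ge0 // lerDr.
have ee : eps R L ^+ 2 <= eps R L by rewrite expr2 ler_piMl // ltW.
have ce : `|c| ^+ 3 * eps R L ^+ 2 <= e.
  move: ec; rewrite ler_pdivlMr // mulrC => ec; apply: le_trans ec.
  by apply: ler_pM; rewrite ?exprn_ge0 ?(ltW h0) // lerDl.
have -> : `|c| ^+ 3 * eps R L ^+ 3 * `|x| ^+ 3 = (`|c| ^+ 3 * eps R L ^+ 2 * `|x| ^+ 3) * eps R L by ring.
rewrite ler_pM2r //; apply: ler_pM => //; by rewrite ?mulr_ge0 ?exprn_ge0 // ltW.
Unshelve. all: by end_near. Qed.

Lemma node_angle L (i : 'I_(dimN L)) (a : int) :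
  angle R L (a * cidx i) = a%:~R / 2 * eps R L * node R i.
Proof.
rewrite /angle /node intrM [RHS](_ : _ = a%:~R / 2 * (cidx i)%:~R * eps R L ^+ 2); last by ring.
have N0 := dimN_gt0 R L; rewrite eps_sqr; move: (_%:R) N0 => N N0.
by field; rewrite gt_eqF.
Qed.

Lemma pcvg_chord_node : pcvg chord_node 'X.
Proof.
have c2 : (fun _ : nat => 2) @ \oo --> (2 : R) by exact: cvg_cst.
have := pcvgM (pcvg_cst c2) (pcvg_sin 2^-1).
rewrite mul_polyC scalerA divff // scale1r; apply: pcvg_ext => L i.
by rewrite /chord_node /chord -[cidx i]mul1r node_angle mul1r mulrA.
Qed.

Lemma pcvg_sine_node : pcvg sine_node 'X.
Proof.
have := pcvg_sin 1; rewrite scale1r; apply: pcvg_ext => L i.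
by rewrite /sine_node /chord node_angle divff // mulKf.
Qed.

Lemma pcvg_chord_nodeX n : pcvg (fun L i => chord_node i ^+ n) (1 *: 'X^n).
Proof.
rewrite scale1r; elim: n => [|n IH].
  by rewrite expr0 -(@polyC1 R); apply: pcvg_cst; exact: cvg_cst.
have := pcvgM pcvg_chord_node IH; rewrite -exprS; apply: pcvg_ext => L i.
by rewrite exprS.
Qed.

Lemma pcvg_sine_chord_nodeX n : pcvg (fun L i => sine_node i * chord_node i ^+ n) (1 *: 'X^(n.+1)).
Proof. by have := pcvgM pcvg_sine_node (pcvg_chord_nodeX n); rewrite -scalerAr -exprS. Qed.

Lemma pcvgMc M (a : nat -> R) (l c : R) n : pcvg M (c *: 'X^n) -> a @ \oo --> l ->
  pcvg (fun L i => M L i * a L) ((c * l) *: 'X^n).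
Proof.
move=> hM ha; have := pcvgM hM (pcvg_cst ha).
by rewrite mulrC mul_polyC scalerA [l * c]mulrC.
Qed.

(** The squared chord is of order [eps^2], so it does not contribute to the limit. *)
Lemma pcvgMq M (a : nat -> R) (l c : R) n : pcvg M (c *: 'X^n) -> a @ \oo --> l ->
  pcvg (fun L i => M L i * (a L - chord R L (cidx i) ^+ 2)) ((c * l) *: 'X^n).
Proof.
move=> hM ha.
have h0 : (fun L => - eps R L ^+ 2) @ \oo --> (0 : R).
  rewrite (_ : (fun L => _) = (fun L => eps R L ^+ 2 * (-1))); first exact: cvg_eps_sqr.
  by apply/funext => L; rewrite mulrN1.
have := pcvgM hM (pcvgD (pcvg_cst ha) (pcvgM (pcvg_cst h0) (pcvg_chord_nodeX 2))).
rewrite mul0r addr0 mulrC mul_polyC scalerA [l * c]mulrC; apply: pcvg_ext => L i; congr (_ * (_ + _)).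
by rewrite /chord_node; field; rewrite gt_eqF // eps_gt0.
Qed.

End Coefficients.

(** * The vectors of the first eight modes *)

Section LowModes.
Variable R : realType.
Implicit Types (L n : nat) (d : int).
Local Notation u L d := (vec_u R L d).
Local Notation v L d := (vec_v R L d).
Local Notation q d := (step_coef R d).
Local Notation fam L := (family R L).

(** Here [M] is the cofactor of [u_(-2)] in the entries of [f], with the power of [eps]
    taken out. *)
Lemma phi_limit_entries n (f : forall L, 'rV[R]_(dimN L)) M (c : R) : 0 < c ->
  (\forall L \near \oo, exists2 b, 0 < b & inspan n (f L - b *: fam L (n %% 4) (n %/ 4))) ->
  (\forall L \near \oo, forall i, f L 0 i = eps R L ^+ n * M L i * u L (- 2) 0 i) ->
  pcvg M (c *: 'X^n) ->
  (forall j, (j < n)%N -> gcvg (scaled_phi R j) (hermite_poly R j)) ->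
  gcvg (scaled_phi R n) (hermite_poly R n).
Proof.
move=> c0 hspan hent hM hj.
pose s L := (SS R L (- 2) 0 * eps R L ^+ n)^-1.
apply: (@phi_limit _ n (fun L => s L *: f L) c) => //.
  near=> L.
  have L2 : (2 <= L)%N by near: L; exists 2%N.
  have nL : (n < dimN L)%N.
    have : (n <= L)%N by near: L; exists n.
    by clear; lia.
  have s0 : 0 < s L by rewrite invr_gt0 mulr_gt0 ?SS_center_gt0 // exprn_gt0 // eps_gt0.
  have [b b0 hb] : exists2 b, 0 < b & inspan n (f L - b *: fam L (n %% 4) (n %/ 4)).
    by near: L.
  apply: (@phi_leading _ _ _ _ (s L * b)) => //; first exact: mulr_gt0.
  by rewrite -scalerA -scalerBr; exact: inspanZ.
have := gcvgM hM (@gcvg_center R); rewrite mulr1; apply: gcvg_ext; near=> L => i.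
have L2 : (2 <= L)%N by near: L; exists 2%N.
have e : forall i, f L 0 i = eps R L ^+ n * M L i * u L (- 2) 0 i by near: L.
rewrite mxE e vec_uE /s /center; field.
by rewrite !gt_eqF ?SS_center_gt0 // exprn_gt0 // eps_gt0.
Unshelve. all: by end_near. Qed.

Lemma vec_w0E L : vec_w R L 0 = (1 + mid_coef R 0 L) *: u L 0.
Proof. by rewrite /vec_w /mid_coef !addn0 oppr0 scalerDl scale1r. Qed.

Lemma vec_x0E L : vec_x R L 0 = v L 0 + mid_coef R 1 L *: v L (- 1).
Proof. by rewrite /vec_x /mid_coef addn0 oppr0 sub0r. Qed.

Lemma vec_y0E L : vec_y R L 0 = - u L 1 + mid_coef R 2 L *: u L (- 1).
Proof. by rewrite /vec_y /mid_coef addn0 oppr0 sub0r add0r. Qed.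

Lemma vec_z0E L : vec_z R L 0 = - v L 0 + mid_coef R 1 L *: v L (- 1).
Proof. by rewrite /vec_z /mid_coef addn0 oppr0 sub0r. Qed.

Lemma vec_w1E L : vec_w R L 1 = u L 1 + mid_coef R 2 L *: u L (- 1).
Proof. by rewrite /vec_w /mid_coef muln1. Qed.

Lemma vec_x1E L : vec_x R L 1 = v L 1 + mid_coef R 3 L *: v L (- 2).
Proof. by rewrite /vec_x /mid_coef muln1 -addnA. Qed.

Lemma vec_y1E L : vec_y R L 1 = - u L 2 + mid_coef R 4 L *: u L (- 2).
Proof. by rewrite /vec_y /mid_coef muln1 -addnA. Qed.

Lemma vec_z1E L : vec_z R L 1 = - v L 1 + mid_coef R 3 L *: v L (- 2).
Proof. by rewrite /vec_z /mid_coef muln1 -addnA. Qed.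

Section Span.
Variables (L n : nat) (L2 : (2 <= L)%N) (nN : (n <= dimN L)%N).

Let mid_coefp j : (j <= 4)%N -> 0 < mid_coef R j L.
Proof. by move=> j4; apply: mid_coef_gt0; lia. Qed.

Lemma span_u0 : (0 < n)%N -> inspan n (u L 0).
Proof.
move=> n0; have h := @inspan_family R L 0 0 n isT n0 nN.
rewrite /= vec_w0E in h.
have c0 : 1 + mid_coef R 0 L != 0 by rewrite gt_eqF // addr_gt0 // mid_coefp.
by rewrite -[u L 0]scale1r -(mulVf c0) -scalerA; exact: inspanZ.
Qed.

Lemma span_v0 : (3 < n)%N -> inspan n (v L 0).
Proof.
move=> n3; have h := @inspan_family R L 3 0 n isT n3 nN.
have h' := @inspan_family R L 1 0 n isT (ltn_trans (isT : 1 < 3)%N n3) nN.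
rewrite /= vec_z0E in h; rewrite /= vec_x0E in h'.
have -> : v L 0 = 2^-1 *: (v L 0 + mid_coef R 1 L *: v L (- 1) - (- v L 0 + mid_coef R 1 L *: v L (- 1))).
  by apply/rowP => i; rewrite !mxE; field.
by apply: inspanZ; exact: inspanB.
Qed.

Lemma span_vN1 : (3 < n)%N -> inspan n (v L (- 1)).
Proof.
move=> n3; have h := @inspan_family R L 3 0 n isT n3 nN.
have h' := @inspan_family R L 1 0 n isT (ltn_trans (isT : 1 < 3)%N n3) nN.
rewrite /= vec_z0E in h; rewrite /= vec_x0E in h'.
have c0 := lt0r_neq0 (mid_coefp (isT : 1 <= 4)%N).
have -> : v L (- 1) = (2 * mid_coef R 1 L)^-1 *: (v L 0 + mid_coef R 1 L *: v L (- 1) + (- v L 0 + mid_coef R 1 L *: v L (- 1))).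
  by apply/rowP => i; rewrite !mxE; field.
by apply: inspanZ; exact: inspanD.
Qed.

Lemma span_u1 : (4 < n)%N -> inspan n (u L 1).
Proof.
move=> n4; have h := @inspan_family R L 0 1 n isT n4 nN.
have h' := @inspan_family R L 2 0 n isT (ltn_trans (isT : 2 < 4)%N n4) nN.
rewrite /= vec_w1E in h; rewrite /= vec_y0E in h'.
have -> : u L 1 = 2^-1 *: (u L 1 + mid_coef R 2 L *: u L (- 1) - (- u L 1 + mid_coef R 2 L *: u L (- 1))).
  by apply/rowP => i; rewrite !mxE; field.
by apply: inspanZ; exact: inspanB.
Qed.

Lemma span_uN1 : (4 < n)%N -> inspan n (u L (- 1)).
Proof.
move=> n4; have h := @inspan_family R L 0 1 n isT n4 nN.
have h' := @inspan_family R L 2 0 n isT (ltn_trans (isT : 2 < 4)%N n4) nN.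
rewrite /= vec_w1E in h; rewrite /= vec_y0E in h'.
have c0 := lt0r_neq0 (mid_coefp (isT : 2 <= 4)%N).
have -> : u L (- 1) = (2 * mid_coef R 2 L)^-1 *: (u L 1 + mid_coef R 2 L *: u L (- 1) + (- u L 1 + mid_coef R 2 L *: u L (- 1))).
  by apply/rowP => i; rewrite !mxE; field.
by apply: inspanZ; exact: inspanD.
Qed.

End Span.

Section Entries.
Variables (L : nat) (L2 : (2 <= L)%N) (i : 'I_(dimN L)).
Local Notation X := (chord R L (cidx i) ^+ 2).

Lemma u_step d : - 2 <= d -> u L (d + 1) 0 i = (q (d + 1) L - X) * u L d 0 i.
Proof.
move=> d2; have /andP[? ?] := cidx_bound i.
rewrite !vec_uE SS_step; [|lia..]; congr (_ * _); rewrite /step_coef addrA.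
have := chordM R L (cidx i) (cidx i); rewrite subrr -expr2 => ->.
have -> : cochord R L 0 = 2 by rewrite /cochord /angle mulr0 mul0r cos0 mulr1.
have -> : cidx i + cidx i = 2 * cidx i by ring.
ring.
Qed.

Lemma uN1E : u L (- 1) 0 i = (q (- 1) L - X) * u L (- 2) 0 i.
Proof. exact: (@u_step (- 2)). Qed.

Lemma u0E : u L 0 0 i = (q 0 L - X) * ((q (- 1) L - X) * u L (- 2) 0 i).
Proof. by rewrite -uN1E; exact: (@u_step (- 1)). Qed.

Lemma u1E : u L 1 0 i = (q 1 L - X) * ((q 0 L - X) * ((q (- 1) L - X) * u L (- 2) 0 i)).
Proof. by rewrite -u0E; exact: (@u_step 0). Qed.

Lemma u2E : u L 2 0 i =
  (q 2 L - X) * ((q 1 L - X) * ((q 0 L - X) * ((q (- 1) L - X) * u L (- 2) 0 i))).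
Proof. by rewrite -u1E; exact: (@u_step 1). Qed.

Lemma vE d : v L d 0 i = eps R L * sine_node R i * u L d 0 i.
Proof.
rewrite vec_vE vec_uE /sine_node; congr (_ * _).
by field; rewrite gt_eqF // eps_gt0.
Qed.

End Entries.
End LowModes.

(** * The first eight modes *)

Section Modes.
Variable R : realType.
Implicit Types (L n : nat) (d : int).
Local Notation u L d := (vec_u R L d).
Local Notation v L d := (vec_v R L d).
Local Notation q d := (step_coef R d).
Local Notation mid_coef j := (mid_coef R j).
Local Notation fam L := (family R L).
Local Notation limit n := (gcvg (scaled_phi R n) (hermite_poly R n)).

Lemma entryD m (a b : 'rV[R]_m) i : (a + b) 0 i = a 0 i + b 0 i. Proof. by rewrite mxE. Qed.
Lemma entryN m (a : 'rV[R]_m) i : (- a) 0 i = - a 0 i. Proof. by rewrite mxE. Qed.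
Lemma entryZ m c (a : 'rV[R]_m) i : (c *: a) 0 i = c * a 0 i. Proof. by rewrite mxE. Qed.

Lemma near_q_gt0 : \forall L \near \oo,
  [/\ (2 <= L)%N, 0 < q (- 1) L & 0 < q 0 L].
Proof.
near=> L; split.
- by near: L; exists 2%N.
- near: L; apply: (cvgr_gt (2 : R)); [exact: cvg_step_coef|exact: ltr0n].
- near: L; apply: (cvgr_gt (2 : R)); [exact: cvg_step_coef|exact: ltr0n].
Unshelve. all: by end_near. Qed.

Lemma cvg_ratio (a b : nat -> R) (l m : R) : m != 0 -> a @ \oo --> l -> b @ \oo --> m ->
  (fun L => a L / b L) @ \oo --> l / m.
Proof. by move=> m0 ha hb; apply: cvgM => //; exact: cvgV. Qed.

(** For each mode [n], a vector [f] is chosen in the class allowed by [phi_leading],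
    with entries [X^m] times [u_(-2)] times a factor that tends to a positive
    constant, with [m = n / 2], and an additional sine for odd [n]. As the factor
    [X^m] is exact, no expansion of the coefficients in powers of [1 / N] is needed.
    For [n = 0] and [n = 1] the vector of the family itself will do. *)
Lemma limit_phi0 : limit 0.
Proof.
apply: (@phi_limit_entries R 0 (fun L => vec_w R L 0)
  (fun L i => chord_node R i ^+ 0 * (1 + mid_coef 0 L) * (q 0 L - chord R L (cidx i) ^+ 2)
     * (q (- 1) L - chord R L (cidx i) ^+ 2)) (1 * (1 + 1) * 2 * 2)) => //.
- near=> L; exists 1 => //=; rewrite scale1r subrr; exact: inspan0.
- near=> L => i; have L2 : (2 <= L)%N by near: L; exists 2%N.
  by rewrite vec_w0E; rewrite !(entryD, entryN, entryZ) !(vE, u2E R L2, u1E R L2, u0E R L2, uN1E R L2) /chord_node; rewrite !expr0; ring.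
- apply: pcvgMq; last exact: cvg_step_coef.
  apply: pcvgMq; last exact: cvg_step_coef.
  apply: pcvgMc; first exact: pcvg_chord_nodeX.
  by apply: cvgD; [exact: cvg_cst|exact: (@cvg_mid_coef R 0)].
Unshelve. all: by end_near. Qed.

Lemma limit_phi1 : (forall j, (j < 1)%N -> limit j) -> limit 1.
Proof.
apply: (@phi_limit_entries R 1 (fun L => vec_x R L 0)
  (fun L i => sine_node R i * chord_node R i ^+ 0 * ((q 0 L + mid_coef 1 L) - chord R L (cidx i) ^+ 2)
     * (q (- 1) L - chord R L (cidx i) ^+ 2)) (1 * (2 + 2 ^+ 1) * 2)) => //.
- near=> L; exists 1 => //=; rewrite scale1r subrr; exact: inspan0.
- near=> L => i; have L2 : (2 <= L)%N by near: L; exists 2%N.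
  by rewrite vec_x0E; rewrite !(entryD, entryN, entryZ) !(vE, u2E R L2, u1E R L2, u0E R L2, uN1E R L2) /chord_node; rewrite !expr0; ring.
- apply: pcvgMq; last exact: cvg_step_coef.
  apply: pcvgMq; first exact: pcvg_sine_chord_nodeX.
  by apply: cvgD; [exact: cvg_step_coef|exact: cvg_mid_coef].
Unshelve. all: by end_near. Qed.

(** Multiples of [u_0] change the cofactor of [u_(-1)] by multiples of [q_0 - X]; the
    division of the constant by [q_0 - X], as a geometric series up to order 1,
    leaves a multiple of [X]. *)
Lemma limit_phi2 : (forall j, (j < 2)%N -> limit j) -> limit 2.
Proof.
apply: (@phi_limit_entries R 2
  (fun L => vec_y R L 0 + (q 1 L - mid_coef 2 L / q 0 L) *: u L 0)
  (fun L i => chord_node R i ^+ 2 * ((mid_coef 2 L / q 0 L + q 0 L) - chord R L (cidx i) ^+ 2)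
     * (q (- 1) L - chord R L (cidx i) ^+ 2)) (1 * (2 ^+ 2 / 2 + 2) * 2)) => //.
- near=> L; have [L2 _ _] : [/\ (2 <= L)%N, 0 < q (- 1) L & 0 < q 0 L].
    by near: L; exact: near_q_gt0.
  exists 1 => //=; rewrite scale1r addrAC subrr add0r.
  by apply: inspanZ; apply: span_u0 => //; lia.
- near=> L => i; have [L2 _ q0] : [/\ (2 <= L)%N, 0 < q (- 1) L & 0 < q 0 L].
    by near: L; exact: near_q_gt0.
  rewrite vec_y0E; rewrite !(entryD, entryN, entryZ) !(vE, u2E R L2, u1E R L2, u0E R L2, uN1E R L2) /chord_node; field.
  by rewrite !gt_eqF ?eps_gt0.
- apply: pcvgMq; last exact: cvg_step_coef.
  apply: pcvgMq; first exact: pcvg_chord_nodeX.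
  apply: cvgD; last exact: cvg_step_coef.
  by apply: cvg_ratio; [|exact: cvg_mid_coef|exact: cvg_step_coef].
Unshelve. all: by end_near. Qed.

(** The multiple of [x_0] cancels the constant term of the cofactor of [v_(-1)]. *)
Lemma limit_phi3 : (forall j, (j < 3)%N -> limit j) -> limit 3.
Proof.
apply: (@phi_limit_entries R 3
  (fun L => vec_z R L 0 + ((q 0 L - mid_coef 1 L) / (q 0 L + mid_coef 1 L)) *: vec_x R L 0)
  (fun L i => sine_node R i * chord_node R i ^+ 2 * (1 - (q 0 L - mid_coef 1 L) / (q 0 L + mid_coef 1 L))
     * (q (- 1) L - chord R L (cidx i) ^+ 2)) (1 * (1 - (2 - 2 ^+ 1) / (2 + 2 ^+ 1)) * 2)) => //.
- by rewrite expr1 subrr mul0r subr0 !mulr1 mul1r.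
- near=> L; have [L2 _ _] : [/\ (2 <= L)%N, 0 < q (- 1) L & 0 < q 0 L].
    by near: L; exact: near_q_gt0.
  exists 1 => //=; rewrite scale1r addrAC subrr add0r.
  by apply: inspanZ; apply: (@inspan_family R L 1 0) => //; lia.
- near=> L => i; have [L2 _ q0] : [/\ (2 <= L)%N, 0 < q (- 1) L & 0 < q 0 L].
    by near: L; exact: near_q_gt0.
  have c1 : 0 < mid_coef 1 L by apply: mid_coef_gt0; lia.
  rewrite vec_z0E vec_x0E; rewrite !(entryD, entryN, entryZ) !(vE, u2E R L2, u1E R L2, u0E R L2, uN1E R L2) /chord_node; field.
  by apply/andP; split; rewrite gt_eqF ?eps_gt0 // addr_gt0.
- apply: pcvgMq; last exact: cvg_step_coef.
  apply: pcvgMc; first exact: pcvg_sine_chord_nodeX.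
  apply: cvgB; first exact: cvg_cst.
  apply: cvg_ratio; first by rewrite gt_eqF // addr_gt0.
    by apply: cvgB; [exact: cvg_step_coef|exact: cvg_mid_coef].
  by apply: cvgD; [exact: cvg_step_coef|exact: cvg_mid_coef].
Unshelve. all: by end_near. Qed.

(** The vectors [u_1], [u_0], [u_(-1)] carry all the multiples of [u_(-1)] by
    polynomials in [X] of degree at most two, in particular by [X^2]. *)
Lemma limit_phi4 : (forall j, (j < 4)%N -> limit j) -> limit 4.
Proof.
apply: (@phi_limit_entries R 4
  (fun L => u L 1 - (q 0 L + q 1 L) *: u L 0 + (q 0 L ^+ 2) *: u L (- 1))
  (fun L i => chord_node R i ^+ 4 * (q (- 1) L - chord R L (cidx i) ^+ 2)) (1 * 2)) => //.
- near=> L; have [L2 _ _] : [/\ (2 <= L)%N, 0 < q (- 1) L & 0 < q 0 L].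
    by near: L; exact: near_q_gt0.
  have c2 : 0 < mid_coef 2 L by apply: mid_coef_gt0; lia.
  exists (2^-1 + q 0 L ^+ 2 / (2 * mid_coef 2 L)).
    by rewrite ltr_pwDl ?invr_gt0 // divr_ge0 ?sqr_ge0 // mulr_ge0 // ltW.
  rewrite [X in inspan _ X](_ : _ = (- 2^-1 + q 0 L ^+ 2 / (2 * mid_coef 2 L)) *: vec_y R L 0
     - (q 0 L + q 1 L) *: u L 0).
    apply: inspanB; apply: inspanZ; last by apply: span_u0 => //; lia.
    by apply: (@inspan_family R L 2 0) => //; lia.
  rewrite /= vec_w1E vec_y0E; apply/rowP => i; rewrite !(entryD, entryN, entryZ).
  by field; rewrite gt_eqF.
- near=> L => i; have [L2 _ q0] : [/\ (2 <= L)%N, 0 < q (- 1) L & 0 < q 0 L].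
    by near: L; exact: near_q_gt0.
  rewrite !(entryD, entryN, entryZ) !(vE, u2E R L2, u1E R L2, u0E R L2, uN1E R L2) /chord_node; field.
  by rewrite !gt_eqF ?eps_gt0.
- by apply: pcvgMq; [exact: pcvg_chord_nodeX|exact: cvg_step_coef].
Unshelve. all: by end_near. Qed.

(** The vectors [v_0] and [v_(-1)] carry the multiples of [v_(-1)] by polynomials of
    degree at most one in [X]; [l0] and [l1] come from the geometric series of the
    constant over [q_(-1) - X] up to order 1. *)
Lemma limit_phi5 : (forall j, (j < 5)%N -> limit j) -> limit 5.
Proof.
pose l0 L := - mid_coef 3 L / q (- 1) L - q 0 L * q 1 L.
pose l1 L := - mid_coef 3 L / q (- 1) L ^+ 2 + q 0 L + q 1 L.
apply: (@phi_limit_entries R 5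
  (fun L => vec_x R L 1 + ((l0 L + l1 L * q 0 L) *: v L (- 1) - l1 L *: v L 0))
  (fun L i => sine_node R i * chord_node R i ^+ 4 * ((mid_coef 3 L / q (- 1) L ^+ 2 + q (- 1) L)
     - chord R L (cidx i) ^+ 2)) (1 * (2 ^+ 3 / 2 ^+ 2 + 2))) => //.
- near=> L; have [L2 _ _] : [/\ (2 <= L)%N, 0 < q (- 1) L & 0 < q 0 L].
    by near: L; exact: near_q_gt0.
  exists 1 => //=; rewrite scale1r addrAC subrr add0r.
  by apply: inspanB; apply: inspanZ; [apply: span_vN1|apply: span_v0] => //; lia.
- near=> L => i; have [L2 q1 q0] : [/\ (2 <= L)%N, 0 < q (- 1) L & 0 < q 0 L].
    by near: L; exact: near_q_gt0.
  rewrite vec_x1E /l0 /l1; rewrite !(entryD, entryN, entryZ) !(vE, u2E R L2, u1E R L2, u0E R L2, uN1E R L2) /chord_node; field.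
  by rewrite !gt_eqF ?eps_gt0.
- apply: pcvgMq; first exact: pcvg_sine_chord_nodeX.
  apply: cvgD; last exact: cvg_step_coef.
  apply: cvg_ratio; [by rewrite expf_neq0|exact: cvg_mid_coef|].
  by rewrite expr2; apply: cvgM; exact: cvg_step_coef.
Unshelve. all: by end_near. Qed.

(** As in mode 5, now with all polynomials of degree at most two in [X] and the
    geometric series up to order 2, whose coefficients give [g0], [g1], [g2]. *)
Lemma limit_phi6 : (forall j, (j < 6)%N -> limit j) -> limit 6.
Proof.
pose g2 L := q 0 L + q 1 L + q 2 L - mid_coef 4 L / q (- 1) L ^+ 3.
pose g1 L := - (q 0 L * q 1 L + q 0 L * q 2 L + q 1 L * q 2 L) - mid_coef 4 L / q (- 1) L ^+ 2.
pose g0 L := q 0 L * q 1 L * q 2 L - mid_coef 4 L / q (- 1) L.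
apply: (@phi_limit_entries R 6
  (fun L => vec_y R L 1 + (g2 L *: (u L 1 - (q 0 L + q 1 L) *: u L 0 + q 0 L ^+ 2 *: u L (- 1))
     + g1 L *: (q 0 L *: u L (- 1) - u L 0) + g0 L *: u L (- 1)))
  (fun L i => chord_node R i ^+ 6 * ((mid_coef 4 L / q (- 1) L ^+ 3 + q (- 1) L)
     - chord R L (cidx i) ^+ 2)) (1 * (2 ^+ 4 / 2 ^+ 3 + 2))) => //.
- near=> L; have [L2 _ _] : [/\ (2 <= L)%N, 0 < q (- 1) L & 0 < q 0 L].
    by near: L; exact: near_q_gt0.
  have nN : (6 <= dimN L)%N by lia.
  have h0 : inspan 6 (u L 0) by apply: span_u0.
  have h1 : inspan 6 (u L 1) by apply: span_u1.
  have h2 : inspan 6 (u L (- 1)) by apply: span_uN1.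
  exists 1 => //=; rewrite scale1r addrAC subrr add0r.
  apply: inspanD; last exact: inspanZ.
  apply: inspanD; apply: inspanZ.
    by apply: inspanD; [apply: inspanB => //; exact: inspanZ|exact: inspanZ].
  by apply: inspanB => //; exact: inspanZ.
- near=> L => i; have [L2 q1 q0] : [/\ (2 <= L)%N, 0 < q (- 1) L & 0 < q 0 L].
    by near: L; exact: near_q_gt0.
  rewrite vec_y1E /g0 /g1 /g2; rewrite !(entryD, entryN, entryZ) !(vE, u2E R L2, u1E R L2, u0E R L2, uN1E R L2) /chord_node; field.
  by rewrite !gt_eqF ?eps_gt0.
- apply: pcvgMq; first exact: pcvg_chord_nodeX.
  apply: cvgD; last exact: cvg_step_coef.
  apply: cvg_ratio; [by rewrite expf_neq0|exact: cvg_mid_coef|].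
  by rewrite !exprS expr0 mulr1; do 2 (apply: cvgM; first exact: cvg_step_coef); exact: cvg_step_coef.
Unshelve. all: by end_near. Qed.

(** The vectors [v_(-2)], [v_(-1)], [v_0], [v_1] carry all the multiples of [v_(-2)] by
    polynomials in [X] of degree at most three, in particular by [X^3]. *)
Lemma limit_phi7 : (forall j, (j < 7)%N -> limit j) -> limit 7.
Proof.
apply: (@phi_limit_entries R 7
  (fun L => q (- 1) L ^+ 3 *: v L (- 2) - v L 1
     - (q (- 1) L + q 0 L + q 1 L) *: (q 0 L *: v L (- 1) - v L 0)
     - (q (- 1) L ^+ 2 - q 0 L * q 1 L) *: v L (- 1))
  (fun L i => sine_node R i * chord_node R i ^+ 6) 1) => //.
- near=> L; have [L2 q1 _] : [/\ (2 <= L)%N, 0 < q (- 1) L & 0 < q 0 L].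
    by near: L; exact: near_q_gt0.
  have nN : (7 <= dimN L)%N by lia.
  have h0 : inspan 7 (v L 0) by apply: span_v0.
  have h1 : inspan 7 (v L (- 1)) by apply: span_vN1.
  have c3 : 0 < mid_coef 3 L by apply: mid_coef_gt0; lia.
  exists (2^-1 + q (- 1) L ^+ 3 / (2 * mid_coef 3 L)).
    by rewrite addr_gt0 ?invr_gt0 // divr_gt0 ?exprn_gt0 // mulr_gt0.
  rewrite [X in inspan _ X](_ : _ = (q (- 1) L ^+ 3 / (2 * mid_coef 3 L) - 2^-1) *: vec_x R L 1
     - (q (- 1) L + q 0 L + q 1 L) *: (q 0 L *: v L (- 1) - v L 0)
     - (q (- 1) L ^+ 2 - q 0 L * q 1 L) *: v L (- 1)).
    apply: inspanB; last exact: inspanZ.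
    apply: inspanB; apply: inspanZ; last by apply: inspanB => //; exact: inspanZ.
    exact: (@inspan_family R L 1 1).
  rewrite /= vec_z1E vec_x1E; apply/rowP => i; rewrite !(entryD, entryN, entryZ).
  by field; rewrite gt_eqF.
- near=> L => i; have [L2 q1 q0] : [/\ (2 <= L)%N, 0 < q (- 1) L & 0 < q 0 L].
    by near: L; exact: near_q_gt0.
  rewrite !(entryD, entryN, entryZ) !(vE, u2E R L2, u1E R L2, u0E R L2, uN1E R L2) /chord_node; field.
  by rewrite !gt_eqF ?eps_gt0.
- exact: pcvg_sine_chord_nodeX.
Unshelve. all: by end_near. Qed.

Lemma limit_phi n : (n <= 7)%N -> limit n.
Proof.
elim/ltn_ind: n => n IH n7; have {}IH j : (j < n)%N -> limit j.
  by move=> jn; apply: IH => //; apply: leq_trans n7; exact: ltnW.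
case: n n7 IH => [|[|[|[|[|[|[|[|//]]]]]]]] _; [move=> _; exact: limit_phi0|exact: limit_phi1|
  exact: limit_phi2|exact: limit_phi3|exact: limit_phi4|exact: limit_phi5|exact: limit_phi6|exact: limit_phi7].
Qed.

End Modes.

Theorem theorem3 (R : realType) :
  (forall L : nat,
    [/\ (forall m n : nat, (m < dimN L)%N -> (n < dimN L)%N ->
           dot (phi R L m) (phi R L n) = (m == n)%:R),
        basis_of {: 'rV[R]_(dimN L)} (mkseq (phi R L) (dimN L)) &
        forall n : nat, (n < dimN L)%N ->
          DFT (toC (phi R L n)) = (- 'i%C) ^+ n *: toC (phi R L n)]) /\
  (forall n : nat, (n <= 7)%N ->
    (fun L : nat =>
       \big[Num.max/0]_(i < dimN L)
          `|eps R L `^ (- 2^-1) * phi R L n 0 i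
            - hermite n (eps R L * (cidx i)%:~R)|) @ \oo --> (0 : R)).
Proof.
split=> [L|n n7].
  split; [exact: phi_orthonormal| |exact: eigvec_phi].
  by apply: orthonormal_basis => i j; exact: phi_orthonormal.
apply/cvgr0Pnorm_le => e e0; near=> L.
have h : forall i : 'I_(dimN L), (1 + `|node R i|) ^+ 0 *
    `|scaled_phi R n i - (hermite_poly R n).[node R i] * expR (- (node R i ^+ 2 / 2))| <= e.
  by near: L; exact: (limit_phi n7).
rewrite ger0_norm; last by elim/big_ind: _ => // x y x0 y0; rewrite le_max x0.
apply/bigmax_leP; split=> [|i _]; first exact: ltW.
by have := h i; rewrite expr0 mul1r -hermiteE.
Unshelve. all: by end_near. Qed.
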